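(* For $a\in\mathbb{C}$ with $\operatorname{Re} a>0$, $$\log\Gamma(a)=\log\sqrt{2\pi}-\gamma\Bigl(a-\frac12\Bigr)+\frac{1}{2\pi i}\int_L\frac{z^{-1}e^{az}\operatorname{Log} z}{1-e^z}\,dz,$$ i.e. $\log\Gamma(a)=\log\sqrt{2\pi}-\gamma\left(a-\frac12\right)+g(0,a)$.
   Context: $\log\Gamma$ is the analytic branch on $\operatorname{Re} a>0$ that is real on the positive reals. $\psi=\Gamma'/\Gamma$ is the digamma function, $\gamma=-\psi(1)$ is Euler's constant, and $g(0,a)=\zeta'(0,a)+\psi(1)\zeta(0,a)$, where $\zeta(s,a)$ is the Hurwitz zeta function (analytically continued in $s$ from $\zeta(s,a)=\sum_{n\ge 0}(n+a)^{-s}$, $\operatorname{Re} s>1$) and $\zeta'=\partial_s\zeta$. $L=L_-\cup L_\epsilon\cup L_+$ is the Hankel contour, with small $\epsilon$ ($0<\epsilon<2\pi$): $L_-$ is the lower side ($\arg z=-\pi$) of the ray $(-\infty,-\epsilon)$ traced left to right; $L_\epsilon=\{\epsilon e^{i\theta}:-\pi\le\theta\le\pi\}$ is traced counterclockwise; $L_+$ is the upper side ($\arg z=\pi$) of the ray traced right to left. $\operatorname{Log} z=\ln|z|+i\arg z$ with $\arg z=-\pi$ on $L_-$, $\arg z=\theta$ on $L_\epsilon$, $\arg z=\pi$ on $L_+$. *)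

(* Defs.v *)
From Stdlib Require Import Reals.
From Coquelicot Require Import Coquelicot.
Open Scope R_scope.
Open Scope C_scope.

Definition Cexp (z : C) : C :=
  (exp (Re z) * cos (Im z), exp (Re z) * sin (Im z))%R.

(** Principal logarithm; this formula for it holds only for [0 < Re w]. *)
Definition Clog_right (w : C) : C := (ln (Cmod w), atan (Im w / Re w))%R.

Definition analytic_at (f : C -> C) (z0 : C) : Prop :=
  exists (c : nat -> C) (r : R), (0 < r)%R /\
    forall z : C, (Cmod (z - z0) < r)%R ->
      is_pseries (K := C_AbsRing) (V := C_NormedModule) c (z - z0) (f z).

(** Integrals of complex functions of a real variable; [C] is seen here as
    the real normed module [R * R], its canonical structure being over [C]. *)
Definition is_CInt_gen (f : R -> C) (Fa Fb : (R -> Prop) -> Prop) (l : C) : Prop :=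
  is_RInt_gen (V := prod_NormedModule R_AbsRing R_NormedModule R_NormedModule)
    f Fa Fb l.

Definition CInt_gen (f : R -> C) (Fa Fb : (R -> Prop) -> Prop) : C :=
  (RInt_gen (fun t => Re (f t)) Fa Fb, RInt_gen (fun t => Im (f t)) Fa Fb).

(** Euler's integral, meaningful for [0 < Re a]. *)
Definition Gamma (a : C) : C :=
  CInt_gen (fun t : R => Cexp ((a - 1) * RtoC (ln t)) * Cexp (- RtoC t))
    (at_right 0) (Rbar_locally p_infty).

Definition digamma (a : C) : C := C_derive Gamma a / Gamma a.

Definition euler_gamma : C := - digamma 1.

Definition is_log_Gamma (logGamma : C -> C) : Prop :=
  (forall a : C, (0 < Re a)%R -> analytic_at logGamma a) /\
  (forall a : C, (0 < Re a)%R -> Cexp (logGamma a) = Gamma a) /\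
  (forall x : R, (0 < x)%R -> Im (logGamma (RtoC x)) = 0%R).

(** [zeta s a] is the Hurwitz zeta function, continued to all [s <> 1];
    its values at [s = 1] or at [a] with [Re a <= 0] are unconstrained. *)
Definition is_hurwitz_zeta (zeta : C -> C -> C) : Prop :=
  forall a : C, (0 < Re a)%R ->
    (forall s : C, (1 < Re s)%R ->
       is_series (K := C_AbsRing) (V := C_NormedModule)
         (fun n : nat => Cexp (- s * Clog_right (RtoC (INR n) + a))) (zeta s a)) /\
    (forall s : C, s <> 1 -> analytic_at (fun s' => zeta s' a) s).

(** [g(0,a)], the derivative being taken in [s]. *)
Definition g0 (zeta : C -> C -> C) (a : C) : C :=
  C_derive (fun s => zeta s a) 0 + digamma 1 * zeta 0 a.

(** [is_hankel_int f eps J]: the integral of [f z (Log z)] along the Hankel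
    contour exists and equals [J].  Since [Log] takes different values on the
    two sides of the cut, the value [Log z = ln |z| + i arg z] is passed to
    [f] as a second argument. *)
Definition is_hankel_int (f : C -> C -> C) (eps : R) (J : C) : Prop :=
  exists Jminus Jeps Jplus : C,
    is_CInt_gen (fun x : R => f (RtoC x) (ln (Rabs x), - PI)%R)
      (Rbar_locally m_infty) (at_point (- eps)%R) Jminus /\
    is_CInt_gen
      (fun theta : R =>
         let z := RtoC eps * Cexp (Ci * RtoC theta) in
         f z (ln eps, theta) * (Ci * z))
      (at_point (- PI)%R) (at_point PI) Jeps /\
    is_CInt_gen (fun x : R => f (RtoC x) (ln (Rabs x), PI))
      (at_point (- eps)%R) (Rbar_locally m_infty) Jplus /\
    J = Jminus + Jeps + Jplus.

Definition hankel_integrand (a z logz : C) : C :=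
  / z * Cexp (a * z) * logz / (1 - Cexp z).

(* Main.v *)
(** Let [S_N(a)] be Stirling's approximation of [log Gamma(a + N)] minus [sum_(n < N) log (a + n)].
    By the trapezoid rule [S_(N+1) - S_N = O(N^-2)] locally uniformly, so [S_N] tends to an
    analytic [S] by Weierstrass's theorem.  On [(0, 1)] it is [log Gamma] by log-convexity
    (the constant comes from Wallis's product), hence on [Re a > 0] by the identity theorem.

    Zeta: completing the partial sums of the zeta series by the first Euler-Maclaurin terms gives
    functions of [s] analytic off [1] and converging on [Re s > -1/2], whose value at [0] is
    [1/2 - a] and whose derivative at [0] is exactly [S_N(a) - log sqrt(2 pi)].  The identity
    theorem along a segment from [2 + i] to [0] identifies the limit with the given zeta.

    Contour integral: it does not depend on the radius, and letting the radius [e] tend to [0] it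
    becomes, up to [2 pi i], the limit of
    [int_e^oo exp(- a t) / (t (1 - exp(- t))) dt - 1/e + (1/2 - a) ln e].
    Telescoping in [a] reduces this to exponential integrals, computed by Frullani's argument,
    with the same sums as in [S_N(a)] and a Binet remainder [O(1 / N)].  Euler's constant enters
    through the analogous telescoping for [int_e^oo exp(- t) / (1 - exp(- t)) dt], which produces
    [S_N'(1)], and [S'(1) = psi(1)]. *)
Require Import Defs.
From Stdlib Require Import Reals Lra Lia Factorial.
From Coquelicot Require Import Coquelicot.
Open Scope R_scope.

(** [g0 zeta a] and the contour integral are each compared with [log_Gamma_lim a], the limit of
    [stirling N a], never with each other. The contour integral involves two limits at once: the
    cut-off [e] tends to [0], and the number [N] of telescoping steps tends to infinity. The Binet
    remainder is bounded by [M / Re b] uniformly in [e], and this permits the exchange. A second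
    obstacle is that each exponential integral diverges like [- ln e], with a constant not known at
    that stage. The limits are therefore taken relative to [exp_int e 1 + ln e]. The coefficients of
    this quantity add up to [1 / 2 - a], which is where the term in Euler's constant comes from; its
    limit is then found separately. Euler's integral is evaluated at positive reals only; elsewhere
    [Gamma] is handled as the exponential of the given [logGamma], which also provides its
    derivative at [1]. The complex analysis is confined to discs and segments, and to maps with a
    continuous derivative, because Cauchy's formula is obtained by differentiating under the
    integral sign. *)

Ltac C_eq := match goal with |- @eq _ ?x ?y => change (@eq C x y) end.

(** Equations produced by the algebraic structures may be typed in a carrier that is only
    convertible to [C]; [C_eq] retypes them so that [ring] and [field] recognise the field. *)
Ltac Cring := cbv beta; try C_eq; ring.

Ltac Cfield := cbv beta; try C_eq; field.

(** * Modulus, real and imaginary parts *)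

Lemma Ceq (z w : C) : Re z = Re w -> Im z = Im w -> z = w.
Proof. destruct z, w; unfold Re, Im; simpl; intros -> ->; reflexivity. Qed.

Lemma Cmod_Im (z : C) : Rabs (Im z) <= Cmod z.
Proof. eapply Rle_trans; [apply Rmax_r | apply Rmax_Cmod]. Qed.

Lemma Cmod_le_sum (z : C) : Cmod z <= Rabs (Re z) + Rabs (Im z).
Proof.
  destruct z as [x y].
  replace (x, y)%R with (RtoC x + Ci * RtoC y)%C.
  2:{ apply Ceq; simpl; ring. }
  eapply Rle_trans; [apply Cmod_triangle |].
  rewrite Cmod_mult, Cmod_Ci, !Cmod_R. unfold Re, Im; simpl.
  replace (x + (0 * y - 1 * 0)) with x by ring.
  replace (0 + (0 * 0 + 1 * y)) with y by ring. lra.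
Qed.

Lemma Cmod_sub_comm (z w : C) : Cmod (z - w) = Cmod (w - z).
Proof. rewrite <- Cmod_opp. f_equal. ring. Qed.

Lemma Cmod_sub_le (z w : C) : Cmod (z - w) <= Cmod z + Cmod w.
Proof. unfold Cminus. eapply Rle_trans; [apply Cmod_triangle |]. rewrite Cmod_opp. lra. Qed.

Lemma Cmod_ge_sub (z w : C) : Cmod z - Cmod w <= Cmod (z - w).
Proof.
  pose proof (Cmod_triangle (z - w) w) as H.
  replace (z - w + w)%C with z in H by ring. lra.
Qed.

Lemma Cmod_sqr (z : C) : (Cmod z * Cmod z = Re z * Re z + Im z * Im z)%R.
Proof. pose proof (Cmod2_alt z). simpl in H. lra. Qed.

Lemma Re_pos_neq_0 (z : C) : 0 < Re z -> z <> RtoC 0.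
Proof. intros H ->. simpl in H. lra. Qed.

(** * Continuity of complex-valued maps *)

Lemma continuous_pairC {T : UniformSpace} (f : T -> C) (x : T) :
  continuous (fun t => Re (f t)) x -> continuous (fun t => Im (f t)) x ->
  @continuous T C_UniformSpace f x.
Proof.
  intros H1 H2.
  apply filterlim_locally; intros e.
  pose proof (proj1 (filterlim_locally _ _) H1 e) as L1.
  pose proof (proj1 (filterlim_locally _ _) H2 e) as L2.
  generalize (filter_and _ _ L1 L2). apply filter_imp.
  intros y [A B]. split; assumption.
Qed.

Lemma continuous_Re {T : UniformSpace} (f : T -> C) (x : T) :
  @continuous T C_UniformSpace f x -> continuous (fun t => Re (f t)) x.
Proof.
  intros H. apply filterlim_locally; intros e.
  generalize (proj1 (filterlim_locally _ _) H e). apply filter_imp.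
  intros y [A B]. exact A.
Qed.

Lemma continuous_Im {T : UniformSpace} (f : T -> C) (x : T) :
  @continuous T C_UniformSpace f x -> continuous (fun t => Im (f t)) x.
Proof.
  intros H. apply filterlim_locally; intros e.
  generalize (proj1 (filterlim_locally _ _) H e). apply filter_imp.
  intros y [A B]. exact B.
Qed.

Lemma continuous_Cplus {T : UniformSpace} (f g : T -> C) (x : T) :
  @continuous T C_UniformSpace f x -> @continuous T C_UniformSpace g x ->
  @continuous T C_UniformSpace (fun t => f t + g t)%C x.
Proof.
  intros H1 H2. apply continuous_pairC.
  - apply (continuous_ext (fun t => plus (Re (f t)) (Re (g t)))); [reflexivity |].
    apply @continuous_plus; apply continuous_Re; assumption.
  - apply (continuous_ext (fun t => plus (Im (f t)) (Im (g t)))); [reflexivity |].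
    apply @continuous_plus; apply continuous_Im; assumption.
Qed.

Lemma continuous_Cmult {T : UniformSpace} (f g : T -> C) (x : T) :
  @continuous T C_UniformSpace f x -> @continuous T C_UniformSpace g x ->
  @continuous T C_UniformSpace (fun t => f t * g t)%C x.
Proof.
  intros H1 H2.
  pose proof (continuous_Re _ _ H1) as F1. pose proof (continuous_Im _ _ H1) as F2.
  pose proof (continuous_Re _ _ H2) as G1. pose proof (continuous_Im _ _ H2) as G2.
  apply continuous_pairC.
  - exact (@continuous_minus T R_AbsRing R_NormedModule _ _ x
      (@continuous_mult T R_AbsRing _ _ x F1 G1) (@continuous_mult T R_AbsRing _ _ x F2 G2)).
  - exact (@continuous_plus T R_AbsRing R_NormedModule _ _ x
      (@continuous_mult T R_AbsRing _ _ x F1 G2) (@continuous_mult T R_AbsRing _ _ x F2 G1)).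
Qed.

Lemma continuous_Cconst {T : UniformSpace} (c : C) (x : T) :
  @continuous T C_UniformSpace (fun _ => c) x.
Proof. apply continuous_const. Qed.

Lemma continuous_Cinv {T : UniformSpace} (f : T -> C) (x : T) :
  @continuous T C_UniformSpace f x -> f x <> RtoC 0 ->
  @continuous T C_UniformSpace (fun t => / f t)%C x.
Proof.
  intros H Hn.
  pose proof (continuous_Re _ _ H) as F1. pose proof (continuous_Im _ _ H) as F2.
  assert (D : (Re (f x) * Re (f x) + Im (f x) * Im (f x) <> 0)%R).
  { rewrite <- Cmod_sqr. apply Cmod_gt_0 in Hn. nra. }
  assert (Hd : continuous (fun t => (/ (Re (f t) * Re (f t) + Im (f t) * Im (f t)))%R) x).
  { apply (continuous_comp (fun t => (Re (f t) * Re (f t) + Im (f t) * Im (f t))%R) Rinv).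
    - exact (@continuous_plus T R_AbsRing R_NormedModule _ _ x
        (@continuous_mult T R_AbsRing _ _ x F1 F1) (@continuous_mult T R_AbsRing _ _ x F2 F2)).
    - apply continuous_Rinv. exact D. }
  apply continuous_pairC.
  - apply (continuous_ext (fun t => mult (Re (f t)) (/ (Re (f t) * Re (f t) + Im (f t) * Im (f t)))%R)).
    + intros t. unfold mult; simpl. unfold Rdiv. do 2 f_equal. unfold Re, Im. ring.
    + apply @continuous_mult; [apply continuous_Re |]; assumption.
  - apply (continuous_ext (fun t => mult (opp (Im (f t))) (/ (Re (f t) * Re (f t) + Im (f t) * Im (f t)))%R)).
    + intros t. unfold mult; simpl. unfold opp; simpl. unfold Rdiv. do 2 f_equal. unfold Re, Im. ring.
    + apply @continuous_mult; [|assumption]. apply (@continuous_opp T R_AbsRing R_NormedModule).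
      apply continuous_Im; assumption.
Qed.

Lemma continuous_RtoC {T : UniformSpace} (f : T -> R) (x : T) :
  continuous f x -> @continuous T C_UniformSpace (fun t => RtoC (f t)) x.
Proof.
  intros H. apply continuous_pairC; [exact H | apply continuous_const].
Qed.

Lemma continuous_Copp {T : UniformSpace} (f : T -> C) (x : T) :
  @continuous T C_UniformSpace f x -> @continuous T C_UniformSpace (fun t => - f t)%C x.
Proof.
  intros H. apply (continuous_ext (fun t => - (1) * f t)%C); [intros; Cring |].
  apply continuous_Cmult; [apply continuous_Cconst | exact H].
Qed.

Lemma continuous_Cminus {T : UniformSpace} (f g : T -> C) (x : T) :
  @continuous T C_UniformSpace f x -> @continuous T C_UniformSpace g x ->
  @continuous T C_UniformSpace (fun t => f t - g t)%C x.
Proof. intros H1 H2. apply continuous_Cplus; [exact H1 | apply continuous_Copp, H2]. Qed.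

Lemma continuous_Cid x : @continuous C_UniformSpace C_UniformSpace (fun z => z) x.
Proof. apply continuous_id. Qed.

Lemma continuous_RtoC_id x : @continuous R_UniformSpace C_UniformSpace (fun t => RtoC t) x.
Proof. apply continuous_RtoC, continuous_id. Qed.

Lemma RtoC_neq_0 t : t <> 0 -> RtoC t <> RtoC 0.
Proof. intros H Q. apply H, RtoC_inj, Q. Qed.

Lemma Cmod_sub_diag z : Cmod (z - z) = 0.
Proof. rewrite <- Cmod_0. f_equal. ring. Qed.

Lemma Cmod_half : Cmod (1 / 2) = 1 / 2.
Proof.
  replace (1 / 2)%C with (RtoC (1 / 2)) by (rewrite RtoC_div by lra; reflexivity).
  rewrite Cmod_R, Rabs_pos_eq; lra.
Qed.

Create HintDb ccont.
#[global] Hint Resolve continuous_Cconst continuous_Cid continuous_RtoC_id continuous_Cplus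
  continuous_Cminus continuous_Cmult continuous_Copp continuous_Cinv : ccont.

Ltac Ccont := auto 20 with ccont.

Notation ccont := (@continuous C_UniformSpace C_UniformSpace).

Lemma continuous_Ccomp {T : UniformSpace} (f : T -> C) (g : C -> C) (x : T) :
  @continuous T C_UniformSpace f x -> ccont g (f x) ->
  @continuous T C_UniformSpace (fun t => g (f t)) x.
Proof. intros H1 H2. exact (continuous_comp f g x H1 H2). Qed.

(** The balls of [C_UniformSpace] are squares, being those of the product [R * R]; the halves
    [e / 2] and [d / 2] pay for the passage between squares and discs. *)
Lemma ccont_eps (f : C -> C) (z : C) :
  ccont f z <->
  forall e : R, 0 < e -> exists d : R, 0 < d /\
    forall w : C, Cmod (w - z) < d -> Cmod (f w - f z) < e.
Proof.
  split.
  - intros H e He.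
    assert (He2 : 0 < e / 2) by lra.
    destruct (proj1 (filterlim_locally _ _) H (mkposreal _ He2)) as [d Hd].
    exists d. split; [apply cond_pos |]. intros w Hw.
    assert (B : ball (f z) (e / 2) (f w)).
    { apply Hd. split; simpl.
      - eapply Rle_lt_trans; [| exact Hw]. apply (re_le_Cmod (w - z)).
      - eapply Rle_lt_trans; [| exact Hw]. apply (Cmod_Im (w - z)). }
    destruct B as [B1 B2].
    eapply Rle_lt_trans; [apply Cmod_le_sum |].
    change (Rabs (Re (f w - f z)) < e / 2) in B1.
    change (Rabs (Im (f w - f z)) < e / 2) in B2. lra.
  - intros H. apply filterlim_locally. intros e.
    destruct (H e (cond_pos e)) as [d [Hd Hw]].
    assert (Hd2 : 0 < d / 2) by lra.
    exists (mkposreal _ Hd2). intros w [B1 B2].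
    assert (L : Cmod (f w - f z) < e).
    { apply Hw. eapply Rle_lt_trans; [apply Cmod_le_sum |].
      change (Rabs (Re (w - z)) < d / 2) in B1.
      change (Rabs (Im (w - z)) < d / 2) in B2. lra. }
    split; simpl; eapply Rle_lt_trans; [| exact L | | exact L].
    + apply (re_le_Cmod (f w - f z)).
    + apply (Cmod_Im (f w - f z)).
Qed.

(** * Complex derivatives *)

(** Caratheodory's form of the complex derivative. *)
Definition cderiv (f : C -> C) (z l : C) : Prop :=
  exists q : C -> C, ccont q z /\ q z = l /\
    forall w : C, (f w = f z + q w * (w - z))%C.

Lemma cderiv_cont f z l : cderiv f z l -> ccont f z.
Proof.
  intros [q [Hq [_ H]]].
  apply (continuous_ext (fun w => f z + q w * (w + - z))%C); [intros w; symmetry; apply H |].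
  apply continuous_Cplus; [apply continuous_Cconst |].
  apply continuous_Cmult; [exact Hq |].
  apply continuous_Cplus; [apply continuous_id | apply continuous_Cconst].
Qed.

Lemma cderiv_const c z : cderiv (fun _ => c) z 0.
Proof.
  exists (fun _ => 0%C). split; [apply continuous_Cconst |]. split; [reflexivity |]. intros; ring.
Qed.

Lemma cderiv_id z : cderiv (fun w => w) z 1.
Proof.
  exists (fun _ => 1%C). split; [apply continuous_Cconst |]. split; [reflexivity |]. intros; ring.
Qed.

Lemma cderiv_plus f g z l m :
  cderiv f z l -> cderiv g z m -> cderiv (fun w => f w + g w)%C z (l + m)%C.
Proof.
  intros [p [Hp [P1 P2]]] [q [Hq [Q1 Q2]]].
  exists (fun w => p w + q w)%C. split; [apply continuous_Cplus; assumption |].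
  split; [congruence |]. intros w. rewrite (P2 w), (Q2 w). ring.
Qed.

Lemma cderiv_mult f g z l m :
  cderiv f z l -> cderiv g z m -> cderiv (fun w => f w * g w)%C z (l * g z + f z * m)%C.
Proof.
  intros Hf Hg. pose proof (cderiv_cont _ _ _ Hg) as Cg.
  destruct Hf as [p [Hp [P1 P2]]]. destruct Hg as [q [Hq [Q1 Q2]]].
  exists (fun w => p w * g w + f z * q w)%C. split.
  - apply continuous_Cplus; apply continuous_Cmult; try assumption. apply continuous_Cconst.
  - split; [congruence |]. intros w. rewrite (P2 w). rewrite (Q2 w). ring.
Qed.

(** In Caratheodory's form the two slopes simply multiply, with no case distinction on
    [g w = g z]. *)
Lemma cderiv_comp f g z l m :
  cderiv f (g z) l -> cderiv g z m -> cderiv (fun w => f (g w)) z (l * m)%C.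
Proof.
  intros Hf Hg. pose proof (cderiv_cont _ _ _ Hg) as Cg.
  destruct Hf as [p [Hp [P1 P2]]]. destruct Hg as [q [Hq [Q1 Q2]]].
  exists (fun w => p (g w) * q w)%C. split.
  - apply continuous_Cmult; [| assumption]. apply continuous_Ccomp; assumption.
  - split; [congruence |]. intros w. rewrite (P2 (g w)). rewrite (Q2 w) at 2. ring.
Qed.

Lemma cderiv_eq f z l m : cderiv f z l -> l = m -> cderiv f z m.
Proof. intros H <-. exact H. Qed.

Lemma cderiv_ext f g z l : (forall w, f w = g w) -> cderiv f z l -> cderiv g z l.
Proof.
  intros E [q [H1 [H2 H3]]]. exists q. repeat split; try assumption.
  intros w. rewrite <- !E. apply H3.
Qed.

Lemma cderiv_eps (f : C -> C) (z l : C) :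
  (forall e : R, 0 < e -> exists d : R, 0 < d /\
    forall w : C, Cmod (w - z) < d -> Cmod (f w - f z - l * (w - z)) <= e * Cmod (w - z)) ->
  cderiv f z l.
Proof.
  intros H.
  exists (fun w => if Ceq_dec w z then l else (f w - f z) / (w - z))%C.
  split; [| split].
  - apply ccont_eps. intros e He.
    destruct (H (e / 2)) as [d [Hd Hw]]; [lra |].
    exists d; split; [exact Hd |]. intros w Hwd.
    destruct (Ceq_dec z z) as [_ | n]; [| congruence].
    destruct (Ceq_dec w z) as [-> | n].
    + replace (l - l)%C with (RtoC 0) by ring. rewrite Cmod_0. exact He.
    + assert (N : (w - z)%C <> RtoC 0) by (apply Cminus_eq_contra; exact n).
      replace ((f w - f z) / (w - z) - l)%C with ((f w - f z - l * (w - z)) / (w - z))%C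
        by (field; exact N).
      rewrite Cmod_div by exact N. pose proof (proj1 (Cmod_gt_0 _) N) as P.
      apply Rle_lt_trans with (e / 2); [| lra].
      apply Rle_div_l; [exact P |]. apply Hw. exact Hwd.
  - destruct (Ceq_dec z z); congruence.
  - intros w. destruct (Ceq_dec w z) as [-> | n]; [ring |].
    field. apply Cminus_eq_contra; exact n.
Qed.

Lemma cderiv_to_eps (f : C -> C) (z l : C) :
  cderiv f z l ->
  forall e : R, 0 < e -> exists d : R, 0 < d /\
    forall w : C, Cmod (w - z) < d -> Cmod (f w - f z - l * (w - z)) <= e * Cmod (w - z).
Proof.
  intros [q [H1 [H2 H3]]] e He.
  destruct (proj1 (ccont_eps _ _) H1 e He) as [d [Hd Hw]].
  exists d; split; [exact Hd |]. intros w W.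
  rewrite (H3 w). rewrite <- H2.
  replace (f z + q w * (w - z) - f z - q z * (w - z))%C with ((q w - q z) * (w - z))%C by ring.
  rewrite Cmod_mult. apply Rmult_le_compat_r; [apply Cmod_ge_0 |].
  left. apply Hw, W.
Qed.

Lemma cderiv_ext_loc f g z l d :
  0 < d -> (forall w, Cmod (w - z) < d -> f w = g w) -> cderiv f z l -> cderiv g z l.
Proof.
  intros Hd E H. apply cderiv_eps. intros e He.
  destruct (cderiv_to_eps _ _ _ H e He) as [d' [Hd' Hw]].
  exists (Rmin d d'). split; [apply Rmin_pos; assumption |]. intros w W.
  pose proof (Rmin_l d d'). pose proof (Rmin_r d d').
  rewrite <- (E w) by lra. rewrite <- (E z).
  - apply Hw. lra.
  - replace (z - z)%C with (RtoC 0) by ring. rewrite Cmod_0. exact Hd.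
Qed.

Lemma cderiv_inv f z l :
  cderiv f z l -> f z <> RtoC 0 -> cderiv (fun w => / f w)%C z (- l / (f z * f z))%C.
Proof.
  intros H N.
  assert (Hi : cderiv Cinv (f z) (- / (f z * f z))%C).
  { pose proof (proj1 (Cmod_gt_0 _) N) as P.
    (* Caratheodory's identity is required at every [w], including [0], where [/ w] is a mere
       default value. The value at [0] is replaced by one that fits the slope [- / (f z * f z)];
       this is a change at distance [Cmod (f z)], hence invisible to the derivative. *)
    apply cderiv_ext_loc with (d := Cmod (f z)) (f := fun w => if Ceq_dec w 0 then (/ f z - / (f z * f z) * (w - f z) * 1)%C  else (/ w)%C).
    - exact P.
    - intros w W. destruct (Ceq_dec w 0) as [-> | n]; [| reflexivity].
      exfalso. replace (0 - f z)%C with (- f z)%C in W by ring. rewrite Cmod_opp in W. lra.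
    - exists (fun w => if Ceq_dec w 0 then - / (f z * f z) else - / (w * f z))%C.
      split; [| split].
      + apply (continuous_ext_loc _ (fun w => - (1) * / (w * f z))%C).
        * assert (P2 : 0 < Cmod (f z) / 2) by lra.
          apply locally_C. exists (mkposreal _ P2). intros w W.
          change (Cmod (w - f z) < Cmod (f z) / 2) in W.
          destruct (Ceq_dec w 0) as [-> | n].
          { exfalso. replace (0 - f z)%C with (- f z)%C in W by ring. rewrite Cmod_opp in W. lra. }
          C_eq. field. split; [exact N | exact n].
        * apply continuous_Cmult; [apply continuous_Cconst |].
          apply continuous_Cinv.
          -- apply continuous_Cmult; [apply continuous_id | apply continuous_Cconst].
          -- apply Cmult_neq_0; exact N.
      + destruct (Ceq_dec (f z) 0); [contradiction | reflexivity].
      + intros w. destruct (Ceq_dec (f z) 0); [contradiction |].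
        destruct (Ceq_dec w 0) as [-> | n1]; field; [assumption | split; assumption]. }
  eapply cderiv_eq; [apply (cderiv_comp Cinv f); eassumption |]. field. exact N.
Qed.

Lemma cderiv_opp f z l : cderiv f z l -> cderiv (fun w => - f w)%C z (- l)%C.
Proof.
  intros H. apply (cderiv_ext (fun w => - (1) * f w)%C); [intros; C_eq; ring |].
  eapply cderiv_eq; [apply cderiv_mult; [apply cderiv_const | exact H] |]. cbv beta. ring.
Qed.

Lemma cderiv_minus f g z l m :
  cderiv f z l -> cderiv g z m -> cderiv (fun w => f w - g w)%C z (l - m)%C.
Proof. intros H1 H2. apply cderiv_plus; [assumption | apply cderiv_opp; assumption]. Qed.

Lemma cderiv_scal c f z l : cderiv f z l -> cderiv (fun w => c * f w)%C z (c * l)%C.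
Proof.
  intros H. eapply cderiv_eq; [apply cderiv_mult; [apply cderiv_const | exact H] |]. cbv beta. ring.
Qed.

Lemma cderiv_unique f z l m : cderiv f z l -> cderiv f z m -> l = m.
Proof.
  intros Hl Hm.
  apply Ceq_minus. apply Cmod_eq_0.
  destruct (Rle_lt_or_eq_dec 0 (Cmod (l - m)) (Cmod_ge_0 _)) as [P | E]; [| congruence].
  exfalso.
  destruct (cderiv_to_eps _ _ _ Hl (Cmod (l - m) / 4)) as [d1 [D1 W1]]; [lra |].
  destruct (cderiv_to_eps _ _ _ Hm (Cmod (l - m) / 4)) as [d2 [D2 W2]]; [lra |].
  pose proof (Rmin_pos _ _ D1 D2) as D. set (d := (Rmin d1 d2 / 2)%R) in *.
  pose proof (Rmin_l d1 d2). pose proof (Rmin_r d1 d2).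
  assert (E : (z + RtoC d - z)%C = RtoC d) by ring.
  specialize (W1 (z + RtoC d)%C). specialize (W2 (z + RtoC d)%C).
  rewrite E, Cmod_R, Rabs_pos_eq in W1, W2 by (unfold d; lra).
  assert (Hd1 : d < d1) by (unfold d; lra). assert (Hd2 : d < d2) by (unfold d; lra).
  specialize (W1 Hd1). specialize (W2 Hd2).
  set (A := (f (z + RtoC d) - f z)%C) in *.
  assert (T : Cmod (l - m) * d <= Cmod (A - l * RtoC d) + Cmod (A - m * RtoC d)).
  { replace (Cmod (l - m) * d) with (Cmod ((A - m * RtoC d) - (A - l * RtoC d))).
    - eapply Rle_trans; [apply Cmod_sub_le |]. lra.
    - replace (A - m * RtoC d - (A - l * RtoC d))%C with ((l - m) * RtoC d)%C by ring.
      rewrite Cmod_mult, Cmod_R, Rabs_pos_eq; [reflexivity | unfold d; lra]. }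
  assert (0 < d) by (unfold d; lra). nra.
Qed.

Lemma cderiv_C_derive f z l : cderiv f z l -> C_derive f z = l.
Proof.
  intros [q [H1 [H2 H3]]]. apply is_C_lim_unique.
  apply (filterlim_ext_loc q).
  - exists (mkposreal 1 Rlt_0_1). intros w _ n.
    change (q w = ((f w - f z) / (w - z))%C :> C). rewrite (H3 w). field.
    apply Cminus_eq_contra; exact n.
  - rewrite <- H2. intros P HP.
    destruct (H1 P HP) as [d Hd].
    exists d. intros w W _. apply Hd, W.
Qed.

(** * Complex functions of a real variable *)

(** Componentwise, so that the real theory of derivatives and integrals applies to each part. *)
Definition rderiv (f : R -> C) (t : R) (l : C) : Prop :=
  is_derive (fun s => Re (f s)) t (Re l) /\ is_derive (fun s => Im (f s)) t (Im l).

Lemma rderiv_eq f t l m : rderiv f t l -> l = m -> rderiv f t m.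
Proof. intros H <-. exact H. Qed.

Lemma rderiv_ext f g t l : (forall s, f s = g s) -> rderiv f t l -> rderiv g t l.
Proof.
  intros E [H1 H2]. split.
  - eapply is_derive_ext; [| exact H1]. intros s. cbv beta. rewrite E. reflexivity.
  - eapply is_derive_ext; [| exact H2]. intros s. cbv beta. rewrite E. reflexivity.
Qed.

Lemma is_derive_real_eps (f : R -> R) (t l : R) :
  (forall e : R, 0 < e -> exists d : R, 0 < d /\
    forall s, Rabs (s - t) < d -> Rabs (f s - f t - l * (s - t)) <= e * Rabs (s - t)) ->
  is_derive f t l.
Proof.
  intros H. apply is_derive_Reals. intros e He.
  destruct (H (e / 2)) as [d [Hd W]]; [lra |].
  exists (mkposreal d Hd). intros h Hh Hhd. simpl in Hhd.
  specialize (W (t + h)). replace (t + h - t) with h in W by ring.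
  specialize (W Hhd).
  replace ((f (t + h) - f t) / h - l) with ((f (t + h) - f t - l * h) / h) by (field; exact Hh).
  unfold Rdiv. rewrite Rabs_mult, Rabs_inv.
  pose proof (Rabs_pos_lt _ Hh).
  apply Rle_lt_trans with (e / 2); [| lra].
  apply Rle_div_l; [lra |]. exact W.
Qed.

Lemma rderiv_eps (f : R -> C) (t : R) (l : C) :
  (forall e : R, 0 < e -> exists d : R, 0 < d /\
    forall s, Rabs (s - t) < d ->
      Cmod (f s - f t - l * RtoC (s - t)) <= e * Rabs (s - t)) ->
  rderiv f t l.
Proof.
  intros H. split; apply is_derive_real_eps; intros e He;
    destruct (H e He) as [d [Hd W]]; exists d; (split; [exact Hd |]); intros s Hs;
    (eapply Rle_trans; [| apply W, Hs]).
  - eapply Rle_trans; [| apply re_le_Cmod]. right. f_equal. unfold Re, Im, RtoC; simpl. ring.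
  - eapply Rle_trans; [| apply Cmod_Im]. right. f_equal. unfold Re, Im, RtoC; simpl. ring.
Qed.

Lemma cderiv_line (f : C -> C) (t : R) (l : C) :
  cderiv f (RtoC t) l -> rderiv (fun s => f (RtoC s)) t l.
Proof.
  intros H. apply rderiv_eps. intros e He.
  destruct (cderiv_to_eps _ _ _ H e He) as [d [Hd W]].
  exists d; split; [exact Hd |]. intros s Hs.
  specialize (W (RtoC s)). rewrite <- RtoC_minus, Cmod_R in W. exact (W Hs).
Qed.

Lemma ccont_line (f : C -> C) (t : R) :
  ccont f (RtoC t) -> @continuous R_UniformSpace C_UniformSpace (fun s => f (RtoC s)) t.
Proof.
  intros H. apply (continuous_Ccomp RtoC); [| exact H].
  apply continuous_RtoC, continuous_id.
Qed.

Lemma Re_conj_mult_le (u v : C) : (Re u * Re v + Im u * Im v <= Cmod u * Cmod v)%R.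
Proof.
  pose proof (re_le_Cmod (Cconj u * v)) as H.
  rewrite Cmod_mult, Cmod_conj in H.
  unfold Cconj, Re, Im in *. simpl in H.
  pose proof (Rle_abs (fst u * fst v - - snd u * snd v)). lra.
Qed.

(** The mean value theorem fails for complex values; it is applied to the real inner product of [f]
    with the fixed vector [u = f b - f a], whose increment is [Cmod u] squared. *)
Lemma MVT_C (f f' : R -> C) (a b K : R) :
  a <= b -> (forall t, a <= t <= b -> rderiv f t (f' t)) ->
  (forall t, a <= t <= b -> Cmod (f' t) <= K) ->
  Cmod (f b - f a) <= K * (b - a).
Proof.
  intros Hab Hd HK.
  set (u := (f b - f a)%C).
  set (g := fun t => (Re u * Re (f t) + Im u * Im (f t))%R).
  assert (Dg : forall t, a <= t <= b -> is_derive g t (Re u * Re (f' t) + Im u * Im (f' t))%R).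
  { intros t Ht. destruct (Hd t Ht) as [D1 D2].
    exact (is_derive_plus _ _ _ _ _ (is_derive_scal _ _ (Re u) _ D1) (is_derive_scal _ _ (Im u) _ D2)). }
  destruct (MVT_gen g a b (fun t => Re u * Re (f' t) + Im u * Im (f' t))%R) as [c [Hc E]].
  - rewrite Rmin_left, Rmax_right by exact Hab. intros x Hx. apply Dg. lra.
  - rewrite Rmin_left, Rmax_right by exact Hab. intros x Hx.
    apply derivable_continuous_pt. eexists. apply is_derive_Reals. apply Dg. exact Hx.
  - rewrite Rmin_left, Rmax_right in Hc by exact Hab.
    pose proof (Re_conj_mult_le u (f' c)) as L. pose proof (HK c Hc) as L2.
    assert (E2 : (Cmod u * Cmod u = (Re u * Re (f' c) + Im u * Im (f' c)) * (b - a))%R).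
    { rewrite <- E, Cmod_sqr. unfold g, u, Re, Im. simpl. ring. }
    pose proof (Cmod_ge_0 u) as P.
    destruct (Rle_lt_or_eq_dec 0 (Cmod u) P) as [Q | Q].
    + apply Rmult_le_reg_l with (Cmod u); [exact Q |]. rewrite E2.
      apply Rle_trans with (Cmod u * Cmod (f' c) * (b - a))%R.
      * apply Rmult_le_compat_r; lra.
      * rewrite <- Rmult_assoc. apply Rmult_le_compat_r; [lra |].
        apply Rmult_le_compat_l; lra.
    + rewrite <- Q. apply Rmult_le_pos; [| lra].
      eapply Rle_trans; [apply (Cmod_ge_0 (f' c)) | exact L2].
Qed.

(** * The exponential *)

Lemma exp_le x y : x <= y -> exp x <= exp y.
Proof. intros [H | ->]; [left; apply exp_increasing, H | lra]. Qed.

Lemma Cmod_Cexp z : Cmod (Cexp z) = exp (Re z).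
Proof.
  unfold Cexp, Cmod. simpl.
  replace (exp (Re z) * cos (Im z) * (exp (Re z) * cos (Im z) * 1) +
    exp (Re z) * sin (Im z) * (exp (Re z) * sin (Im z) * 1))%R
    with (exp (Re z) * exp (Re z) * ((sin (Im z))² + (cos (Im z))²))%R by (unfold Rsqr; ring).
  rewrite sin2_cos2, Rmult_1_r. apply sqrt_square. left. apply exp_pos.
Qed.

Lemma Cexp_plus z w : Cexp (z + w) = (Cexp z * Cexp w)%C.
Proof.
  unfold Cexp. rewrite re_plus, im_plus, exp_plus, cos_plus, sin_plus.
  apply Ceq; simpl; ring.
Qed.

Lemma Cexp_RtoC x : Cexp (RtoC x) = RtoC (exp x).
Proof. unfold Cexp. simpl. rewrite cos_0, sin_0. apply Ceq; simpl; ring. Qed.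

Lemma Cexp_0 : Cexp 0 = RtoC 1.
Proof. rewrite Cexp_RtoC, exp_0. reflexivity. Qed.

Lemma Cexp_neq_0 z : Cexp z <> RtoC 0.
Proof. apply Cmod_gt_0. rewrite Cmod_Cexp. apply exp_pos. Qed.

Lemma Cexp_opp z : Cexp (- z) = (/ Cexp z)%C.
Proof.
  pose proof (Cexp_neq_0 z) as N.
  assert (E : (Cexp (- z) * Cexp z = 1)%C).
  { rewrite <- Cexp_plus. replace (- z + z)%C with (RtoC 0) by ring. apply Cexp_0. }
  rewrite <- (Cmult_1_l (/ Cexp z)%C), <- E. field. exact N.
Qed.

Lemma Cexp_line_rderiv (w : C) (t : R) :
  rderiv (fun s => Cexp (RtoC s * w)) t (w * Cexp (RtoC t * w))%C.
Proof.
  destruct w as [x y]. split; unfold Cexp, Re, Im; simpl; auto_derive; auto; unfold Rminus; ring.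
Qed.

Lemma rderiv_minus f g t l m :
  rderiv f t l -> rderiv g t m -> rderiv (fun s => f s - g s)%C t (l - m)%C.
Proof.
  intros [F1 F2] [G1 G2]. split.
  - exact (is_derive_minus _ _ _ _ _ F1 G1).
  - exact (is_derive_minus _ _ _ _ _ F2 G2).
Qed.

Lemma exp_Re_line_le (w : C) (t : R) :
  0 <= t <= 1 -> exp (Re (RtoC t * w)) <= Rmax 1 (exp (Re w)).
Proof.
  intros Ht. rewrite re_scal_l.
  destruct (Rle_dec (Re w) 0) as [H | H].
  - eapply Rle_trans; [| apply Rmax_l]. rewrite <- exp_0. 
    destruct (Req_dec (t * Re w) 0) as [-> | n]; [lra |]. left; apply exp_increasing. nra.
  - eapply Rle_trans; [| apply Rmax_r].
    destruct (Req_dec (t * Re w) (Re w)) as [-> | n]; [lra |]. left; apply exp_increasing. nra.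
Qed.

Lemma Rmax_exp_line (w : C) (t : R) :
  0 <= t <= 1 -> Rmax 1 (exp (Re (RtoC t * w))) <= Rmax 1 (exp (Re w)).
Proof. intros Ht. apply Rmax_lub; [apply Rmax_l | apply exp_Re_line_le, Ht]. Qed.

Lemma Cexp_sub_1_le (w : C) : Cmod (Cexp w - 1) <= Cmod w * Rmax 1 (exp (Re w)).
Proof.
  pose proof (MVT_C (fun s => Cexp (RtoC s * w)) (fun t => w * Cexp (RtoC t * w))%C 0 1
    (Cmod w * Rmax 1 (exp (Re w))) ltac:(lra)) as H.
  cbv beta in H. rewrite Cmult_1_l, Cmult_0_l, Cexp_0 in H.
  eapply Rle_trans; [apply H | lra].
  - intros t Ht. apply Cexp_line_rderiv.
  - intros t Ht. rewrite Cmod_mult, Cmod_Cexp.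
    apply Rmult_le_compat_l; [apply Cmod_ge_0 |]. apply exp_Re_line_le, Ht.
Qed.

Lemma rderiv_poly (p : R -> C) (t : R) (x0 y0 x1 y1 x2 y2 : R) :
  (forall s, p s = (x0 + s * x1 + s * s * x2, y0 + s * y1 + s * s * y2)%R) ->
  rderiv p t (x1 + 2 * t * x2, y1 + 2 * t * y2)%R.
Proof.
  intros E. apply (rderiv_ext (fun s => (x0 + s * x1 + s * s * x2, y0 + s * y1 + s * s * y2)%R)).
  - intros s. symmetry. apply E.
  - split; simpl; auto_derive; auto; ring.
Qed.

Lemma Rmax_exp_pos x : 0 < Rmax 1 (exp x).
Proof. eapply Rlt_le_trans; [| apply Rmax_l]. lra. Qed.

(** Along [t * w] a Taylor remainder has derivative [w] times the preceding remainder, so each use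
    of [MVT_C] gains one factor [Cmod w]. The factorials are given up. *)
Lemma Cexp_taylor1_le (w : C) :
  Cmod (Cexp w - 1 - w) <= Cmod w * Cmod w * Rmax 1 (exp (Re w)).
Proof.
  pose proof (MVT_C (fun s => Cexp (RtoC s * w) - RtoC s * w)%C
    (fun t => w * Cexp (RtoC t * w) - w)%C 0 1
    (Cmod w * Cmod w * Rmax 1 (exp (Re w))) ltac:(lra)) as H.
  cbv beta in H. rewrite Cmult_1_l, Cmult_0_l, Cexp_0 in H.
  replace (Cexp w - 1 - w)%C with (Cexp w - w - (1 - 0))%C by ring.
  eapply Rle_trans; [apply H | lra].
  - intros t Ht. apply rderiv_minus; [apply Cexp_line_rderiv |].
    eapply rderiv_eq; [apply (rderiv_poly _ _ 0 0 (Re w) (Im w) 0 0) |].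
    + intros s. apply Ceq; unfold Re, Im; simpl; ring.
    + apply Ceq; unfold Re, Im; simpl; ring.
  - intros t Ht. replace (w * Cexp (RtoC t * w) - w)%C with (w * (Cexp (RtoC t * w) - 1))%C by ring.
    rewrite Cmod_mult, Rmult_assoc.
    apply Rmult_le_compat_l; [apply Cmod_ge_0 |].
    eapply Rle_trans; [apply Cexp_sub_1_le |].
    rewrite Cmod_mult, Cmod_R, Rabs_pos_eq by lra.
    pose proof (Rmax_exp_line w t Ht). pose proof (Rmax_exp_pos (Re w)).
    pose proof (Rmax_exp_pos (Re (RtoC t * w))). pose proof (Cmod_ge_0 w).
    apply Rmult_le_compat; nra.
Qed.

Lemma Cexp_taylor2_le (w : C) :
  Cmod (Cexp w - 1 - w - w * w / 2) <= Cmod w * Cmod w * Cmod w * Rmax 1 (exp (Re w)).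
Proof.
  pose proof (MVT_C (fun s => Cexp (RtoC s * w) - (RtoC s * w + RtoC s * w * (RtoC s * w) / 2))%C
    (fun t => w * Cexp (RtoC t * w) - (w + RtoC t * w * w))%C 0 1
    (Cmod w * Cmod w * Cmod w * Rmax 1 (exp (Re w))) ltac:(lra)) as H.
  cbv beta in H. rewrite !Cmult_1_l, !Cmult_0_l, Cexp_0 in H.
  replace (Cexp w - 1 - w - w * w / 2)%C with (Cexp w - (w + w * w / 2) - (1 - (0 + 0 / 2)))%C
    by field.
  eapply Rle_trans; [apply H | lra].
  - intros t Ht. apply rderiv_minus; [apply Cexp_line_rderiv |].
    eapply rderiv_eq; [apply (rderiv_poly _ _ 0 0 (Re w) (Im w) (Re (w * w) / 2) (Im (w * w) / 2)) |].
    + intros s. apply Ceq; unfold Re, Im; simpl; field.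
    + apply Ceq; unfold Re, Im; simpl; field.
  - intros t Ht.
    replace (w * Cexp (RtoC t * w) - (w + RtoC t * w * w))%C
      with (w * (Cexp (RtoC t * w) - 1 - RtoC t * w))%C by ring.
    rewrite Cmod_mult, !Rmult_assoc.
    apply Rmult_le_compat_l; [apply Cmod_ge_0 |].
    eapply Rle_trans; [apply Cexp_taylor1_le |].
    rewrite Cmod_mult, Cmod_R, Rabs_pos_eq by lra.
    pose proof (Rmax_exp_line w t Ht). pose proof (Rmax_exp_pos (Re w)).
    pose proof (Rmax_exp_pos (Re (RtoC t * w))). pose proof (Cmod_ge_0 w).
    rewrite <- (Rmult_assoc (Cmod w) (Cmod w)).
    assert (0 <= t * Cmod w) by (apply Rmult_le_pos; lra).
    assert (t * Cmod w <= Cmod w) by nra.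
    apply Rmult_le_compat; try nra.
Qed.

Lemma cderiv_Cexp z : cderiv Cexp z (Cexp z).
Proof.
  apply cderiv_eps. intros e He.
  set (K := (Cmod (Cexp z) * exp 1)%R).
  assert (HK : 0 < K).
  { unfold K. rewrite Cmod_Cexp. apply Rmult_lt_0_compat; apply exp_pos. }
  exists (Rmin 1 (e / K)). split; [apply Rmin_pos; [lra | apply Rdiv_lt_0_compat; assumption] |].
  intros w W. set (h := (w - z)%C) in *.
  assert (H1 : Cmod h < 1) by (eapply Rlt_le_trans; [exact W | apply Rmin_l]).
  assert (H2 : Cmod h < e / K) by (eapply Rlt_le_trans; [exact W | apply Rmin_r]).
  replace (Cexp w - Cexp z - Cexp z * h)%C with (Cexp z * (Cexp h - 1 - h))%C.
  2:{ replace w with (z + h)%C by (unfold h; ring). rewrite Cexp_plus. ring. }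
  rewrite Cmod_mult.
  apply Rle_trans with (Cmod (Cexp z) * (Cmod h * Cmod h * exp 1))%R.
  - apply Rmult_le_compat_l; [apply Cmod_ge_0 |].
    eapply Rle_trans; [apply Cexp_taylor1_le |].
    apply Rmult_le_compat_l; [apply Rmult_le_pos; apply Cmod_ge_0 |].
    assert (E1 : forall x, x <= 1 -> exp x <= exp 1).
    { intros x Hx. destruct (Req_dec x 1) as [-> | n]; [lra |]. left; apply exp_increasing; lra. }
    apply Rmax_lub.
    + rewrite <- exp_0 at 1. apply E1. lra.
    + apply E1. pose proof (Rle_abs (Re h)). pose proof (re_le_Cmod h). lra.
  - apply Rlt_div_r in H2; [| exact HK]. unfold K in H2. pose proof (Cmod_ge_0 h). nra.
Qed.

Lemma ccont_Cexp z : ccont Cexp z.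
Proof. eapply cderiv_cont, cderiv_Cexp. Qed.

(** * The logarithm on the right half-plane *)

Lemma Cexp_Clog_right z : 0 < Re z -> Cexp (Clog_right z) = z.
Proof.
  intros Hx. destruct z as [x y]. unfold Re in Hx; simpl in Hx.
  assert (P : 0 < Cmod (x, y)).
  { apply Cmod_gt_0. intros E. injection E. intros. lra. }
  unfold Cexp, Clog_right. simpl.
  rewrite exp_ln by exact P. rewrite cos_atan, sin_atan. unfold Re, Im; simpl fst; simpl snd.
  assert (Q : sqrt (1 + (y / x)²) = Cmod (x, y) / x).
  { rewrite <- (sqrt_square (Cmod (x, y) / x)).
    - f_equal. pose proof (Cmod_sqr (x, y)) as S. unfold Re, Im in S; simpl in S.
      replace (Cmod (x, y) / x * (Cmod (x, y) / x))%R with (Cmod (x, y) * Cmod (x, y) / (x * x))%R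
        by (field; lra).
      rewrite S. unfold Rsqr. field. lra.
    - left. apply Rdiv_lt_0_compat; assumption. }
  rewrite Q. apply Ceq; simpl; field; lra.
Qed.

Lemma Clog_right_RtoC x : 0 < x -> Clog_right (RtoC x) = RtoC (ln x).
Proof.
  intros H. unfold Clog_right. rewrite Cmod_R, Rabs_pos_eq by lra. simpl.
  apply Ceq; simpl; [reflexivity |]. replace (0 / x) with 0 by (field; lra). apply atan_0.
Qed.

Lemma continuous_Cmod {T : UniformSpace} (f : T -> C) (x : T) :
  @continuous T C_UniformSpace f x -> continuous (fun t => Cmod (f t)) x.
Proof.
  intros H. apply (continuous_comp f Cmod); [exact H |].
  apply filterlim_locally. intros e.
  destruct (proj1 (ccont_eps (fun w => w) (f x)) (continuous_id _) e (cond_pos e)) as [d [Hd W]].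
  assert (Hd2 : 0 < d / 2) by lra.
  exists (mkposreal _ Hd2). intros w [B1 B2].
  assert (L : Cmod (w - f x) < e).
  { apply W. eapply Rle_lt_trans; [apply Cmod_le_sum |].
    change (Rabs (Re (w - f x)) < d / 2) in B1.
    change (Rabs (Im (w - f x)) < d / 2) in B2. lra. }
  change (Rabs (Cmod w - Cmod (f x)) < e).
  pose proof (Cmod_ge_sub w (f x)). pose proof (Cmod_ge_sub (f x) w).
  rewrite (Cmod_sub_comm (f x) w) in *. apply Rabs_def1; lra.
Qed.

Lemma ccont_Clog_right z : 0 < Re z -> ccont Clog_right z.
Proof.
  intros Hz. apply continuous_pairC; unfold Clog_right; simpl.
  - apply (continuous_comp Cmod ln).
    + apply (continuous_Cmod (fun w => w)), continuous_id.
    + apply continuous_ln. apply Cmod_gt_0, Re_pos_neq_0, Hz.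
  - apply (continuous_comp (fun w : C => Im w / Re w)%R atan); [| apply continuous_atan].
    pose proof (continuous_Re (T := C_UniformSpace) (fun w => w) z (continuous_id _)) as H1.
    pose proof (continuous_Im (T := C_UniformSpace) (fun w => w) z (continuous_id _)) as H2.
    assert (H3 : @continuous C_UniformSpace R_UniformSpace (fun w => (/ Re w)%R) z).
    { apply (continuous_comp (fun w : C => Re w) Rinv); [exact H1 |].
      apply continuous_Rinv. lra. }
    exact (@continuous_mult C_UniformSpace R_AbsRing _ _ z H2 H3).
Qed.

Lemma Re_near (z w : C) (d : R) : Cmod (w - z) < d -> Re z - d < Re w < Re z + d.
Proof.
  intros H. pose proof (re_le_Cmod (w - z)) as L.
  assert (E : Re (w - z) = Re w - Re z) by (unfold Re; simpl; ring).
  rewrite E in L. assert (Q : Rabs (Re w - Re z) < d) by lra.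
  apply Rabs_def2 in Q. lra.
Qed.

(** Derivative of an inverse function: the Caratheodory slope of [Cexp] is taken at [Clog_right w]
    and inverted. It cannot vanish for [w <> z], because [Cexp (Clog_right w) = w] for [w] near
    [z]. *)
Lemma cderiv_Clog_right z : 0 < Re z -> cderiv Clog_right z (/ z)%C.
Proof.
  intros Hz.
  destruct (cderiv_Cexp (Clog_right z)) as [q [Hq [Q1 Q2]]].
  rewrite Cexp_Clog_right in Q1 by exact Hz.
  pose proof (ccont_Clog_right z Hz) as CL.
  set (p := fun w => (/ q (Clog_right w))%C).
  assert (Cp : ccont p z).
  { apply continuous_Cinv.
    - apply continuous_Ccomp; [exact CL | exact Hq].
    - rewrite Q1. apply Re_pos_neq_0, Hz. }
  assert (Pz : p z = (/ z)%C) by (unfold p; rewrite Q1; reflexivity).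
  apply (cderiv_ext_loc (fun w => Clog_right z + p w * (w - z))%C) with (d := Re z).
  - exact Hz.
  - intros w W. apply Re_near in W.
    specialize (Q2 (Clog_right w)). rewrite !Cexp_Clog_right in Q2 by lra.
    destruct (Ceq_dec w z) as [-> | n]; [ring |].
    assert (N : q (Clog_right w) <> RtoC 0).
    { intros E. apply n. rewrite Q2, E. ring. }
    assert (E : (w - z = q (Clog_right w) * (Clog_right w - Clog_right z))%C).
    { transitivity (z + q (Clog_right w) * (Clog_right w - Clog_right z) - z)%C.
      - rewrite <- Q2. reflexivity.
      - ring. }
    rewrite E. unfold p. field. exact N.
  - exists p. split; [exact Cp |]. split; [exact Pz |]. intros w. ring.
Qed.

(** * Integrals of complex functions of a real variable *)

Notation is_cint := (@is_RInt C_R_NormedModule).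
Notation ex_cint := (@ex_RInt C_R_NormedModule).
Notation cint := (@RInt C_R_CompleteNormedModule).
Notation rcont := (@continuous R_UniformSpace C_UniformSpace).

Lemma norm_Cmod (z : C) : @norm R_AbsRing C_R_NormedModule z = Cmod z.
Proof.
  change (sqrt (Rabs (fst z) ^ 2 + Rabs (snd z) ^ 2) = Cmod z).
  unfold Cmod. rewrite !pow2_abs. reflexivity.
Qed.

Lemma is_cint_unique f a b l : is_cint f a b l -> cint f a b = l.
Proof. apply (@is_RInt_unique C_R_CompleteNormedModule). Qed.

Lemma cint_correct f a b : ex_cint f a b -> is_cint f a b (cint f a b).
Proof. apply (@RInt_correct C_R_CompleteNormedModule). Qed.

Lemma ex_cint_cont f a b :
  (forall t, Rmin a b <= t <= Rmax a b -> rcont f t) -> ex_cint f a b.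
Proof. apply (@ex_RInt_continuous C_R_CompleteNormedModule). Qed.

Lemma is_cint_Re f a b l : is_cint f a b l -> is_RInt (fun t => Re (f t)) a b (Re l).
Proof. apply (is_RInt_fct_extend_fst (U := R_NormedModule) (V := R_NormedModule)). Qed.

Lemma is_cint_Im f a b l : is_cint f a b l -> is_RInt (fun t => Im (f t)) a b (Im l).
Proof. apply (is_RInt_fct_extend_snd (U := R_NormedModule) (V := R_NormedModule)). Qed.

Lemma is_cint_pair f a b (l : C) :
  is_RInt (fun t => Re (f t)) a b (Re l) -> is_RInt (fun t => Im (f t)) a b (Im l) ->
  is_cint f a b l.
Proof.
  intros H1 H2. destruct l as [x y].
  apply (is_RInt_fct_extend_pair (U := R_NormedModule) (V := R_NormedModule)); assumption.
Qed.

Lemma is_cint_plus f g a b l m :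
  is_cint f a b l -> is_cint g a b m -> is_cint (fun t => f t + g t)%C a b (l + m)%C.
Proof. apply (@is_RInt_plus C_R_NormedModule). Qed.

Lemma is_cint_minus f g a b l m :
  is_cint f a b l -> is_cint g a b m -> is_cint (fun t => f t - g t)%C a b (l - m)%C.
Proof. apply (@is_RInt_minus C_R_NormedModule). Qed.

(** The module structure is over [R], so a complex factor is not one of its scalars; real and
    imaginary parts are recombined by hand. *)
Lemma is_cint_scal c f a b l :
  is_cint f a b l -> is_cint (fun t => c * f t)%C a b (c * l)%C.
Proof.
  intros H. pose proof (is_cint_Re _ _ _ _ H) as H1. pose proof (is_cint_Im _ _ _ _ H) as H2.
  apply is_cint_pair.
  - exact (is_RInt_minus _ _ _ _ _ _ (is_RInt_scal _ _ _ (Re c) _ H1) (is_RInt_scal _ _ _ (Im c) _ H2)).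
  - exact (is_RInt_plus _ _ _ _ _ _ (is_RInt_scal _ _ _ (Re c) _ H2) (is_RInt_scal _ _ _ (Im c) _ H1)).
Qed.

Lemma is_cint_ext f g a b l :
  (forall t, Rmin a b < t < Rmax a b -> f t = g t) -> is_cint f a b l -> is_cint g a b l.
Proof. apply (@is_RInt_ext C_R_NormedModule). Qed.

Lemma is_cint_const (c : C) a b : is_cint (fun _ => c) a b (RtoC (b - a) * c)%C.
Proof.
  rewrite <- scal_R_Cmult. apply (@is_RInt_const C_R_NormedModule).
Qed.

Lemma is_cint_Cmod_le f a b l M :
  a <= b -> (forall t, a <= t <= b -> Cmod (f t) <= M) -> is_cint f a b l ->
  Cmod l <= (b - a) * M.
Proof.
  intros Hab HM H. rewrite <- norm_Cmod.
  apply (@norm_RInt_le_const C_R_NormedModule f a b l M Hab); [| exact H].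
  intros t Ht. rewrite norm_Cmod. apply HM, Ht.
Qed.

Lemma ex_cint_bounded f a b :
  a <= b -> ex_cint f a b -> exists M, 0 < M /\ forall t, a <= t <= b -> Cmod (f t) <= M.
Proof.
  intros Hab H. destruct (ex_RInt_ub _ _ _ H) as [M HM].
  rewrite Rmin_left, Rmax_right in HM by exact Hab.
  exists (Rmax 1 M). split; [eapply Rlt_le_trans; [| apply Rmax_l]; lra |].
  intros t Ht. eapply Rle_trans; [| apply Rmax_r]. rewrite <- norm_Cmod. apply HM, Ht.
Qed.

Lemma is_cint_rderiv (F f : R -> C) a b :
  (forall t, Rmin a b <= t <= Rmax a b -> rderiv F t (f t)) ->
  (forall t, Rmin a b <= t <= Rmax a b -> rcont f t) ->
  is_cint f a b (F b - F a)%C.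
Proof.
  intros HF Hf. apply is_cint_pair.
  - apply (is_RInt_derive (fun t => Re (F t)) (fun t => Re (f t))).
    + intros t Ht. apply HF, Ht.
    + intros t Ht. apply continuous_Re, Hf, Ht.
  - apply (is_RInt_derive (fun t => Im (F t)) (fun t => Im (f t))).
    + intros t Ht. apply HF, Ht.
    + intros t Ht. apply continuous_Im, Hf, Ht.
Qed.

Lemma RInt_param_derive (F dF : R -> R -> R) (a b x d : R) :
  0 < d ->
  (forall u t, Rabs (u - x) < d -> is_derive (fun v => F v t) u (dF u t)) ->
  (forall t, @continuous (prod_UniformSpace R_UniformSpace R_UniformSpace) R_UniformSpace
     (fun p => dF (fst p) (snd p)) (x, t)) ->
  (forall u, Rabs (u - x) < d -> ex_RInt (F u) a b) ->
  is_derive (fun u => RInt (F u) a b) x (RInt (dF x) a b).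
Proof.
  intros Hd HF Hc He.
  assert (L : locally x (fun u => Rabs (u - x) < d)) by (exists (mkposreal d Hd); intros u Hu; exact Hu).
  rewrite (RInt_ext (dF x) (fun t => Derive (fun u => F u t) x)).
  2:{ intros t _. symmetry. apply is_derive_unique, HF.
      rewrite Rminus_diag. rewrite Rabs_R0. exact Hd. }
  apply (is_derive_RInt_param F).
  - generalize L. apply filter_imp. intros u Hu t _. eexists. apply HF, Hu.
  - intros t _. apply continuity_2d_pt_ext_loc with dF.
    + exists (mkposreal d Hd). intros u v Hu _. symmetry. apply is_derive_unique, HF, Hu.
    + apply continuity_2d_pt_filterlim. apply Hc.
  - generalize L. apply filter_imp. exact He.
Qed.

Lemma cint_param_derive (F dF : R -> R -> C) (a b x d : R) :
  0 < d ->
  (forall u t, Rabs (u - x) < d -> rderiv (fun v => F v t) u (dF u t)) ->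
  (forall t, @continuous (prod_UniformSpace R_UniformSpace R_UniformSpace) C_UniformSpace
     (fun p => dF (fst p) (snd p)) (x, t)) ->
  (forall u, Rabs (u - x) < d -> ex_cint (F u) a b) ->
  rderiv (fun u => cint (F u) a b) x (cint (dF x) a b).
Proof.
  intros Hd HF Hc He.
  assert (Ex : ex_cint (dF x) a b).
  { apply ex_cint_cont. intros t _.
    apply (continuous_comp (fun t => (x, t)) (fun p : R * R => dF (fst p) (snd p))); [| apply Hc].
    intros P [e HP]. exists e. intros s Hs. apply HP. split; [apply ball_center | exact Hs]. }
  assert (ERe : forall u, ex_cint (F u) a b -> RInt (fun t => Re (F u t)) a b = Re (cint (F u) a b)).
  { intros u Hu. apply is_RInt_unique, is_cint_Re, cint_correct, Hu. }
  assert (EIm : forall u, ex_cint (F u) a b -> RInt (fun t => Im (F u t)) a b = Im (cint (F u) a b)).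
  { intros u Hu. apply is_RInt_unique, is_cint_Im, cint_correct, Hu. }
  assert (L : locally x (fun u => ex_cint (F u) a b)).
  { exists (mkposreal d Hd). intros u Hu. apply He, Hu. }
  split.
  - replace (Re (cint (dF x) a b)) with (RInt (fun t => Re (dF x t)) a b)
      by (apply is_RInt_unique, is_cint_Re, cint_correct, Ex).
    apply (is_derive_ext_loc (fun u => RInt (fun t => Re (F u t)) a b)).
    + generalize L. apply filter_imp. exact ERe.
    + apply (RInt_param_derive (fun u t => Re (F u t)) (fun u t => Re (dF u t)) a b x d Hd).
      * intros u t Hu. apply HF, Hu.
      * intros t. apply continuous_Re, Hc.
      * intros u Hu. eexists. apply is_cint_Re, cint_correct, He, Hu.
  - replace (Im (cint (dF x) a b)) with (RInt (fun t => Im (dF x t)) a b)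
      by (apply is_RInt_unique, is_cint_Im, cint_correct, Ex).
    apply (is_derive_ext_loc (fun u => RInt (fun t => Im (F u t)) a b)).
    + generalize L. apply filter_imp. exact EIm.
    + apply (RInt_param_derive (fun u t => Im (F u t)) (fun u t => Im (dF u t)) a b x d Hd).
      * intros u t Hu. apply HF, Hu.
      * intros t. apply continuous_Im, Hc.
      * intros u Hu. eexists. apply is_cint_Im, cint_correct, He, Hu.
Qed.

(** * Sequences and partial sums *)

Definition clim (u : nat -> C) (l : C) : Prop := is_lim_seq (fun n => Cmod (u n - l)) 0.

Lemma is_lim_seq_0_le (u v : nat -> R) :
  (forall n, 0 <= u n <= v n) -> is_lim_seq v 0 -> is_lim_seq u 0.
Proof.
  intros H Hv. apply (is_lim_seq_le_le (fun _ => 0) u v); [exact H | apply is_lim_seq_const | exact Hv].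
Qed.

Lemma clim_le (u : nat -> C) (l : C) (v : nat -> R) :
  (forall n, Cmod (u n - l) <= v n) -> is_lim_seq v 0 -> clim u l.
Proof.
  intros H. apply is_lim_seq_0_le. intros n. split; [apply Cmod_ge_0 | apply H].
Qed.

Lemma clim_const c : clim (fun _ => c) c.
Proof.
  apply clim_le with (fun _ => 0); [| apply is_lim_seq_const].
  intros _. rewrite Cmod_sub_diag. lra.
Qed.

Lemma clim_ext u v l : (forall n, u n = v n) -> clim u l -> clim v l.
Proof.
  intros E H. unfold clim. eapply is_lim_seq_ext; [| exact H]. intros n. cbv beta. rewrite E. reflexivity.
Qed.

Lemma is_lim_seq_plus0 (u v : nat -> R) :
  is_lim_seq u 0 -> is_lim_seq v 0 -> is_lim_seq (fun n => u n + v n) 0.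
Proof.
  intros H1 H2. replace (Finite 0) with (Finite (0 + 0)) by (f_equal; ring).
  apply is_lim_seq_plus'; assumption.
Qed.

Lemma is_lim_seq_scal0 (c : R) (u : nat -> R) :
  is_lim_seq u 0 -> is_lim_seq (fun n => c * u n) 0.
Proof.
  intros H. replace (Finite 0) with (Rbar_mult c 0) by (simpl; f_equal; ring).
  apply is_lim_seq_scal_l. exact H.
Qed.

Lemma clim_plus u v l m : clim u l -> clim v m -> clim (fun n => u n + v n)%C (l + m)%C.
Proof.
  intros H1 H2. eapply clim_le; [| exact (is_lim_seq_plus0 _ _ H1 H2)].
  intros n. replace (u n + v n - (l + m))%C with ((u n - l) + (v n - m))%C by ring.
  apply Cmod_triangle.
Qed.

Lemma clim_scal c u l : clim u l -> clim (fun n => c * u n)%C (c * l)%C.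
Proof.
  intros H1. eapply clim_le; [| exact (is_lim_seq_scal0 (Cmod c) _ H1)].
  intros n. cbv beta. replace (c * u n - c * l)%C with (c * (u n - l))%C by ring.
  rewrite Cmod_mult. lra.
Qed.

Lemma clim_minus u v l m : clim u l -> clim v m -> clim (fun n => u n - v n)%C (l - m)%C.
Proof.
  intros H1 H2. replace (l - m)%C with (l + - (1) * m)%C by ring.
  apply (clim_ext (fun n => u n + - (1) * v n)%C); [intros n; ring |].
  apply clim_plus; [exact H1 | apply clim_scal, H2].
Qed.

Lemma is_lim_seq_const_0 (x : R) : is_lim_seq (fun _ => x) 0 -> x = 0.
Proof.
  intros H. pose proof (is_lim_seq_unique _ _ H) as E. rewrite Lim_seq_const in E. injection E. auto.
Qed.

Lemma clim_unique u l m : clim u l -> clim u m -> l = m.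
Proof.
  intros H1 H2. pose proof (clim_minus _ _ _ _ H1 H2) as H.
  unfold clim in H. apply Ceq_minus. apply Cmod_eq_0.
  apply is_lim_seq_const_0. eapply is_lim_seq_ext; [| exact H].
  intros n. cbv beta. rewrite <- (Cmod_opp (l - m)). f_equal. ring.
Qed.

Lemma clim_incr u l : clim u l -> clim (fun n => u (S n)) l.
Proof. intros H. apply (is_lim_seq_incr_1 (fun n => Cmod (u n - l))) in H. exact H. Qed.

Lemma clim_bound u l M :
  clim u l -> (forall n, Cmod (u n) <= M) -> Cmod l <= M.
Proof.
  intros H HM.
  assert (L : is_lim_seq (fun n => M + Cmod (u n - l)) (M + 0)).
  { apply is_lim_seq_plus'; [apply is_lim_seq_const | exact H]. }
  pose proof (is_lim_seq_le (fun _ => Cmod l) (fun n => M + Cmod (u n - l)) (Cmod l) (M + 0)) as Q.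
  simpl in Q. rewrite Rplus_0_r in Q. apply Q; [| apply is_lim_seq_const |].
  - intros n. pose proof (Cmod_ge_sub l (u n)). rewrite Cmod_sub_comm in H0.
    pose proof (HM n). lra.
  - rewrite Rplus_0_r in L. exact L.
Qed.

Lemma clim_RtoC (u : nat -> R) (l : R) : is_lim_seq u l -> clim (fun n => RtoC (u n)) (RtoC l).
Proof.
  intros H. apply is_lim_seq_spec. intros e.
  apply is_lim_seq_spec in H. destruct (H e) as [N HN]. exists N. intros n Hn. specialize (HN n Hn).
  rewrite <- RtoC_minus, Cmod_R, Rminus_0_r, Rabs_Rabsolu. exact HN.
Qed.

Lemma clim_Re u l : clim u l -> is_lim_seq (fun n => Re (u n)) (Re l).
Proof.
  intros H. apply is_lim_seq_spec. intros e.
  apply is_lim_seq_spec in H. destruct (H e) as [N HN]. exists N. intros n Hn. specialize (HN n Hn).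
  rewrite Rminus_0_r, Rabs_pos_eq in HN by apply Cmod_ge_0.
  eapply Rle_lt_trans; [| exact HN]. replace (Re (u n) - Re l) with (Re (u n - l)).
  - apply re_le_Cmod.
  - unfold Re; simpl; ring.
Qed.

(** Built on the total function [Lim_seq], so that a limit depending on parameters becomes a
    function of them; it is meaningful through [clim_of_correct]. *)
Definition clim_of (u : nat -> C) : C :=
  (real (Lim_seq (fun n => Re (u n))), real (Lim_seq (fun n => Im (u n)))).

Lemma clim_Im u l : clim u l -> is_lim_seq (fun n => Im (u n)) (Im l).
Proof.
  intros H. apply (clim_scal (- Ci)%C) in H. apply clim_Re in H.
  replace (Im l) with (Re (- Ci * l)) by (unfold Re, Im; simpl; Cring).
  eapply is_lim_seq_ext; [| exact H]. intros n. unfold Re, Im; simpl; Cring.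
Qed.

Lemma clim_of_correct u l : clim u l -> clim_of u = l.
Proof.
  intros H. unfold clim_of.
  rewrite (is_lim_seq_unique _ _ (clim_Re _ _ H)), (is_lim_seq_unique _ _ (clim_Im _ _ H)).
  destruct l. reflexivity.
Qed.

Fixpoint csum (f : nat -> C) (n : nat) : C :=
  match n with O => RtoC 0 | S k => (csum f k + f k)%C end.

Lemma csum_ext f g n : (forall k, (k < n)%nat -> f k = g k) -> csum f n = csum g n.
Proof.
  induction n as [| n IH]; intros H; simpl; [reflexivity |].
  rewrite IH, H; auto with arith.
Qed.

Lemma sum_n_csum (f : nat -> C) n : @sum_n C_AbelianMonoid f n = csum f (S n).
Proof.
  induction n as [| n IH].
  - rewrite sum_O. simpl. rewrite Cplus_0_l. reflexivity.
  - rewrite sum_Sn, IH. reflexivity.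
Qed.

Lemma is_series_clim (f : nat -> C) l :
  @is_series C_AbsRing C_NormedModule f l <-> clim (csum f) l.
Proof.
  split; intros H.
  - unfold clim. apply is_lim_seq_incr_1. apply is_lim_seq_spec. intros e.
    assert (He2 : 0 < e / 2) by (pose proof (cond_pos e); lra).
    destruct (proj1 (filterlim_locally _ _) H (mkposreal _ He2)) as [N HN].
    exists N. intros n Hn. specialize (HN n Hn). rewrite sum_n_csum in HN. destruct HN as [B1 B2].
    change (Rabs (Re (csum f (S n) - l)) < e / 2) in B1.
    change (Rabs (Im (csum f (S n) - l)) < e / 2) in B2.
    rewrite Rminus_0_r, Rabs_pos_eq by apply Cmod_ge_0.
    pose proof (Cmod_le_sum (csum f (S n) - l)). lra.
  - apply filterlim_locally. intros e.
    unfold clim in H. apply is_lim_seq_incr_1 in H. apply is_lim_seq_spec in H.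
    destruct (H e) as [N HN]. exists N. intros n Hn. specialize (HN n Hn).
    rewrite Rminus_0_r, Rabs_pos_eq in HN by apply Cmod_ge_0.
    rewrite sum_n_csum. split; simpl; (eapply Rle_lt_trans; [| exact HN]).
    + apply (re_le_Cmod (csum f (S n) - l)).
    + apply (Cmod_Im (csum f (S n) - l)).
Qed.

Lemma Cpow_pow_n (z : C) k : @pow_n C_Ring z k = (z ^ k)%C.
Proof. induction k as [| k IH]; simpl; [reflexivity |]. rewrite <- IH. reflexivity. Qed.

Lemma is_pseries_clim (c : nat -> C) (z l : C) :
  @is_pseries C_AbsRing C_NormedModule c z l <-> clim (csum (fun k => c k * z ^ k)%C) l.
Proof.
  unfold is_pseries. rewrite is_series_clim.
  split; intros H; (eapply clim_ext; [| exact H]); intros n; apply csum_ext; intros k _;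
    rewrite <- Cpow_pow_n; [| symmetry]; apply Cmult_comm.
Qed.

(** * Power series *)

Definition sums_to (c : nat -> C) (z0 : C) (r : R) (f : C -> C) : Prop :=
  forall z : C, Cmod (z - z0) < r -> clim (csum (fun k => c k * (z - z0) ^ k)%C) (f z).

Lemma analytic_at_sums f z0 :
  analytic_at f z0 <-> exists c r, 0 < r /\ sums_to c z0 r f.
Proof.
  split; intros [c [r [Hr H]]]; exists c, r; (split; [exact Hr |]); intros z Hz.
  - apply is_pseries_clim, H, Hz.
  - apply is_pseries_clim, H, Hz.
Qed.

Lemma clim_bounded u l : clim u l -> exists M, 0 < M /\ forall n, Cmod (u n) <= M.
Proof.
  intros H. apply is_lim_seq_spec in H. destruct (H (mkposreal 1 Rlt_0_1)) as [N HN]. simpl in HN.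
  assert (Fin : forall N, exists M, 0 < M /\ forall n, (n < N)%nat -> Cmod (u n) <= M).
  { intros K. induction K as [| K [M [PM IH]]].
    - exists 1. split; [lra |]. intros; lia.
    - exists (Rmax M (Cmod (u K))). split; [eapply Rlt_le_trans; [exact PM | apply Rmax_l] |].
      intros n Hn. destruct (Nat.eq_dec n K) as [-> | ne]; [apply Rmax_r |].
      eapply Rle_trans; [apply IH; lia | apply Rmax_l]. }
  destruct (Fin N) as [M [PM HM]].
  exists (Rmax M (Cmod l + 1)). split; [eapply Rlt_le_trans; [exact PM | apply Rmax_l] |].
  intros n. destruct (Nat.lt_ge_cases n N) as [L | L].
  - eapply Rle_trans; [apply HM, L | apply Rmax_l].
  - eapply Rle_trans; [| apply Rmax_r].
    specialize (HN n L). rewrite Rminus_0_r, Rabs_pos_eq in HN by apply Cmod_ge_0.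
    pose proof (Cmod_ge_sub (u n) l). lra.
Qed.

Lemma csum_shift f n : csum f (S n) = (f O + csum (fun k => f (S k)) n)%C.
Proof.
  induction n as [| n IH]; [simpl; ring |].
  change (csum f (S (S n))) with (csum f (S n) + f (S n))%C. rewrite IH. simpl. ring.
Qed.

Lemma csum_scal c f n : csum (fun k => c * f k)%C n = (c * csum f n)%C.
Proof. induction n as [| n IH]; simpl; [ring | rewrite IH; ring]. Qed.

(** At distance [rho = r / 2] from the centre the series converges, and its terms are differences of
    bounded partial sums. *)
Lemma sums_to_coef_bound c z0 r f :
  0 < r -> sums_to c z0 r f -> exists K rho, 0 < K /\ 0 < rho /\ rho < r /\
    forall k, Cmod (c k) * rho ^ k <= K.
Proof.
  intros Hr H.
  assert (E : (z0 + RtoC (r / 2) - z0)%C = RtoC (r / 2)) by ring.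
  assert (L : clim (csum (fun k => c k * RtoC (r / 2) ^ k)%C) (f (z0 + RtoC (r / 2))%C)).
  { pose proof (H (z0 + RtoC (r / 2))%C) as L. rewrite E in L. apply L.
    rewrite Cmod_R, Rabs_pos_eq; lra. }
  destruct (clim_bounded _ _ L) as [M [PM HM]].
  exists (2 * M)%R, (r / 2). repeat split; try lra.
  intros k. replace (Cmod (c k) * (r / 2) ^ k) with (Cmod (c k * RtoC (r / 2) ^ k)).
  - replace (c k * RtoC (r / 2) ^ k)%C
      with (csum (fun k => c k * RtoC (r / 2) ^ k) (S k) - csum (fun k => c k * RtoC (r / 2) ^ k) k)%C
      by (simpl; ring).
    eapply Rle_trans; [apply Cmod_sub_le |]. pose proof (HM k). pose proof (HM (S k)). lra.
  - rewrite Cmod_mult, Cmod_pow, Cmod_R, (Rabs_pos_eq (r / 2)) by lra. reflexivity.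
Qed.

Lemma sums_to_center c z0 r f : 0 < r -> sums_to c z0 r f -> f z0 = c O.
Proof.
  intros Hr H.
  assert (L : clim (csum (fun k => c k * (z0 - z0) ^ k)%C) (f z0)).
  { apply H. rewrite Cmod_sub_diag. exact Hr. }
  apply clim_incr in L. eapply clim_unique; [exact L |].
  apply (clim_ext (fun _ => c O)); [| apply clim_const].
  intros n. rewrite csum_shift.
  rewrite (csum_ext _ (fun _ => (RtoC 0 * RtoC 0)%C)).
  - rewrite csum_scal. simpl. ring.
  - intros k _. simpl. ring.
Qed.

Lemma sums_to_ccont c z0 r f : 0 < r -> sums_to c z0 r f -> ccont f z0.
Proof.
  intros Hr H. destruct (sums_to_coef_bound _ _ _ _ Hr H) as [K [rho [PK [Pr [Lr HK]]]]].
  apply ccont_eps. intros e He.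
  (* For [x = Cmod (z - z0) <= rho / 2] the term of order [k] is at most [K (x / rho)^k], so the
     terms after the first sum to at most [2 K x / rho]; the second bound makes this less than
     [e / 2]. *)
  exists (Rmin (rho / 2) (e * rho / (4 * K))).
  split.
  { apply Rmin_pos; [lra |]. apply Rdiv_lt_0_compat; nra. }
  intros z Hz.
  assert (H1 : Cmod (z - z0) < rho / 2) by (eapply Rlt_le_trans; [exact Hz | apply Rmin_l]).
  assert (H2 : Cmod (z - z0) < e * rho / (4 * K)) by (eapply Rlt_le_trans; [exact Hz | apply Rmin_r]).
  rewrite (sums_to_center _ _ _ _ Hr H).
  set (x := Cmod (z - z0)) in *. assert (Px : 0 <= x) by apply Cmod_ge_0.
  apply Rle_lt_trans with (2 * K * x / rho).
  2:{ apply Rlt_div_r in H2; [| lra]. apply Rlt_div_l; [exact Pr |]. nra. }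
  assert (L : clim (csum (fun k => c k * (z - z0) ^ k)%C) (f z)) by (apply H; unfold x in *; lra).
  apply clim_incr in L.
  pose proof (clim_minus _ _ _ _ L (clim_const (c O))) as L2.
  apply (clim_bound _ _ _ L2). intros n. rewrite csum_shift.
  replace (c O * (z - z0) ^ O + csum (fun k => c (S k) * (z - z0) ^ S k) n - c O)%C
    with (csum (fun k => c (S k) * (z - z0) ^ S k) n)%C by (simpl; ring).
  apply Rle_trans with (2 * K * x / rho * (1 - (1 / 2) ^ n)).
  - induction n as [| n IH].
    + simpl. rewrite Cmod_0. lra.
    + simpl csum. eapply Rle_trans; [apply Cmod_triangle |].
      apply Rle_trans with (2 * K * x / rho * (1 - (1 / 2) ^ n) + K * (x / rho) * (1 / 2) ^ n).
      2:{ right. simpl. field. lra. }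
      apply Rplus_le_compat; [exact IH |].
      change ((z - z0) * (z - z0) ^ n)%C with ((z - z0) ^ S n)%C.
      rewrite Cmod_mult, Cmod_pow. fold x.
      assert (E : x ^ S n = rho ^ S n * ((x / rho) * (x / rho) ^ n)).
      { replace (x ^ S n) with ((rho * (x / rho)) ^ S n) by (f_equal; field; lra).
        rewrite Rpow_mult_distr. reflexivity. }
      rewrite E, <- Rmult_assoc.
      rewrite <- (Rmult_assoc _ (x / rho)).
      assert (Q : 0 <= x / rho <= 1 / 2).
      { split; [apply Rdiv_le_0_compat; lra |]. apply Rle_div_l; lra. }
      apply Rmult_le_compat.
      * apply Rmult_le_pos; [| lra]. apply Rmult_le_pos; [apply Cmod_ge_0 |]. apply pow_le; lra.
      * apply pow_le; lra.
      * apply Rmult_le_compat_r; [lra |]. apply HK.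
      * apply pow_incr. exact Q.
  - assert (0 <= (1 / 2) ^ n) by (apply pow_le; lra).
    assert (0 <= 2 * K * x / rho).
    { apply Rdiv_le_0_compat; [| exact Pr]. nra. }
    nra.
Qed.

(** The shifted series is summed by the difference quotient of [f], completed by [c 1] at [z0]. This
    quotient is at once the Caratheodory slope and the tool for removing a zero at [z0]. *)
Lemma sums_to_shift c z0 r f :
  0 < r -> sums_to c z0 r f ->
  exists g, sums_to (fun k => c (S k)) z0 r g /\ forall z, (f z = c O + g z * (z - z0))%C.
Proof.
  intros Hr H.
  exists (fun z => if Ceq_dec z z0 then c 1%nat else ((f z - c O) / (z - z0))%C). split.
  - intros z Hz. destruct (Ceq_dec z z0) as [-> | n].
    + replace (z0 - z0)%C with (RtoC 0) by ring.
      assert (L : clim (fun _ : nat => c 1%nat) (c 1%nat)) by apply clim_const.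
      unfold clim. apply is_lim_seq_incr_1. eapply is_lim_seq_ext; [| exact L].
      intros n. cbv beta. rewrite csum_shift.
      rewrite (csum_ext _ (fun _ => (RtoC 0 * RtoC 0)%C)); [rewrite csum_scal |].
      * f_equal. simpl. ring.
      * intros k _. simpl. ring.
    + assert (N : (z - z0)%C <> RtoC 0) by (apply Cminus_eq_contra; exact n).
      pose proof (clim_incr _ _ (H z Hz)) as L.
      pose proof (clim_minus _ _ _ _ L (clim_const (c O))) as L2. clear L. rename L2 into L.
      apply (clim_scal (/ (z - z0))%C) in L.
      replace ((f z - c O) / (z - z0))%C with (/ (z - z0) * (f z - c O))%C by (field; exact N).
      eapply clim_ext; [| exact L]. intros m. cbv beta. rewrite csum_shift.
      replace (c O * (z - z0) ^ O + csum (fun k => c (S k) * (z - z0) ^ S k) m - c O)%C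
        with (csum (fun k => c (S k) * (z - z0) ^ S k) m)%C by (simpl; ring).
      rewrite <- csum_scal. apply csum_ext. intros k _. simpl. field. exact N.
  - intros z. destruct (Ceq_dec z z0) as [-> | n].
    + rewrite (sums_to_center _ _ _ _ Hr H). ring.
    + field. apply Cminus_eq_contra; exact n.
Qed.

Lemma sums_to_cderiv c z0 r f : 0 < r -> sums_to c z0 r f -> cderiv f z0 (c 1%nat).
Proof.
  intros Hr H. destruct (sums_to_shift _ _ _ _ Hr H) as [g [Hg E]].
  exists g. split; [eapply sums_to_ccont; eassumption |]. split.
  - apply (sums_to_center _ _ _ _ Hr Hg).
  - intros w. rewrite (sums_to_center _ _ _ _ Hr H). apply E.
Qed.

Lemma analytic_at_minus f g z0 :
  analytic_at f z0 -> analytic_at g z0 -> analytic_at (fun z => f z - g z)%C z0.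
Proof.
  rewrite !analytic_at_sums. intros [c [r [Hr H]]] [d [s [Hs K]]].
  exists (fun k => c k - d k)%C, (Rmin r s). split; [apply Rmin_pos; assumption |].
  intros z Hz.
  pose proof (Rmin_l r s). pose proof (Rmin_r r s).
  assert (L : clim (fun n => csum (fun k => c k * (z - z0) ^ k) n - csum (fun k => d k * (z - z0) ^ k) n)%C
    (f z - g z)%C).
  { apply clim_minus; [apply H | apply K]; lra. }
  eapply clim_ext; [| exact L]. intros n. cbv beta.
  induction n as [| n IH]; simpl; [ring |]. rewrite <- IH. ring.
Qed.

(** * The identity theorem along a segment *)

Definition zero_near (h : C -> C) (z0 : C) : Prop :=
  exists d, 0 < d /\ forall z, Cmod (z - z0) < d -> h z = RtoC 0.

Definition zeros_cluster (h : C -> C) (z0 : C) : Prop :=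
  forall e, 0 < e -> exists z, z <> z0 /\ Cmod (z - z0) < e /\ h z = RtoC 0.

Lemma cluster_zero f z0 : ccont f z0 -> zeros_cluster f z0 -> f z0 = RtoC 0.
Proof.
  intros H A. apply Cmod_eq_0.
  destruct (Rle_lt_or_eq_dec 0 (Cmod (f z0)) (Cmod_ge_0 _)) as [P | E]; [exfalso | congruence].
  destruct (proj1 (ccont_eps _ _) H _ P) as [d [Hd W]].
  destruct (A d Hd) as [z [_ [Hz Z]]]. specialize (W z Hz). rewrite Z in W.
  replace (0 - f z0)%C with (- f z0)%C in W by ring. rewrite Cmod_opp in W. lra.
Qed.

(** Induction over all series at once: continuity gives [c 0 = 0], and after division by [z - z0]
    the quotient has the same zeros off [z0]. *)
Lemma sums_to_coef_zero c z0 r f m :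
  0 < r -> sums_to c z0 r f -> zeros_cluster f z0 -> c m = RtoC 0.
Proof.
  intros Hr. revert c f. induction m as [| m IH]; intros c f H A;
    pose proof (cluster_zero f z0 (sums_to_ccont _ _ _ _ Hr H) A) as C0;
    rewrite (sums_to_center _ _ _ _ Hr H) in C0; [exact C0 |].
  destruct (sums_to_shift _ _ _ _ Hr H) as [g [Hg E]].
  apply (IH (fun k => c (S k)) g Hg).
  intros e He. destruct (A e He) as [z [nz [Hz Z]]].
  exists z. repeat split; try assumption.
  specialize (E z). rewrite Z, C0 in E.
  assert (N : (z - z0)%C <> RtoC 0) by (apply Cminus_eq_contra; exact nz).
  replace (g z) with ((0 + g z * (z - z0)) / (z - z0))%C by (field; exact N).
  rewrite <- E. field. exact N.
Qed.

Lemma isolated_zeros h z0 : analytic_at h z0 -> zeros_cluster h z0 -> zero_near h z0.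
Proof.
  rewrite analytic_at_sums. intros [c [r [Hr H]]] A.
  exists r. split; [exact Hr |]. intros z Hz.
  apply (clim_unique (csum (fun k => c k * (z - z0) ^ k)%C)); [apply H, Hz |].
  apply (clim_ext (fun _ => RtoC 0)); [| apply clim_const].
  intros n. rewrite (csum_ext _ (fun _ => (RtoC 0 * RtoC 0)%C)); [rewrite csum_scal; ring |].
  intros k _. rewrite (sums_to_coef_zero _ _ _ _ k Hr H A). ring.
Qed.

(** Let [T] be the supremum of the parameters up to which [h] vanishes near the segment. Points just
    below [T] make zeros cluster at [p T], so [h] vanishes on a disc around [p T]; for [T < 1] this
    disc would reach beyond [T]. *)
Lemma identity_segment (h : C -> C) (z1 z2 : C) :
  (forall t, 0 <= t <= 1 -> analytic_at h (z1 + RtoC t * (z2 - z1))%C) ->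
  zero_near h z1 -> zero_near h z2.
Proof.
  intros HA H1.
  destruct (Ceq_dec z2 z1) as [-> | Hne]; [exact H1 |].
  set (p := fun t => (z1 + RtoC t * (z2 - z1))%C) in *.
  assert (Pd : 0 < Cmod (z2 - z1)) by (apply Cmod_gt_0, Cminus_eq_contra, Hne).
  set (D := Cmod (z2 - z1)) in *.
  assert (Dist : forall s t, Cmod (p s - p t) = Rabs (s - t) * D).
  { intros s t. unfold p, D. rewrite <- Cmod_R, <- Cmod_mult. f_equal.
    rewrite RtoC_minus. ring. }
  set (E := fun t => 0 <= t <= 1 /\ forall s, 0 <= s <= t -> zero_near h (p s)).
  assert (E0 : E 0).
  { split; [lra |]. intros s Hs. replace s with 0 by lra. unfold p.
    replace (z1 + RtoC 0 * (z2 - z1))%C with z1 by ring. exact H1. }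
  destruct (completeness E) as [T [UT LT]].
  - exists 1. intros t [Ht _]. lra.
  - exists 0. exact E0.
  - assert (T0 : 0 <= T) by (apply UT, E0).
    assert (T1 : T <= 1) by (apply LT; intros t [Ht _]; lra).
    assert (Below : forall s, 0 <= s < T -> zero_near h (p s)).
    { intros s Hs. destruct (Classical_Prop.classic (exists t, E t /\ s < t)) as [[t [Et L]] | N].
      - apply Et. lra.
      - exfalso. assert (T <= s); [| lra]. apply LT. intros t Et.
        destruct (Rle_lt_dec t s) as [L | L]; [exact L |]. exfalso. apply N. exists t. tauto. }
    assert (AtT : zero_near h (p T)).
    { destruct (Req_dec T 0) as [-> | nT]; [apply E0; lra |].
      apply isolated_zeros; [apply HA; lra |].
      intros e He.
      set (s := Rmax 0 (T - e / (2 * D))).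
      assert (P2 : 0 < e / (2 * D)) by (apply Rdiv_lt_0_compat; lra).
      assert (Hs : 0 <= s < T).
      { unfold s. split; [apply Rmax_l |]. apply Rmax_lub_lt; lra. }
      assert (Hs2 : T - s <= e / (2 * D)).
      { unfold s. pose proof (Rmax_r 0 (T - e / (2 * D))). lra. }
      exists (p s). split; [| split].
      - intros Q. pose proof (Dist s T) as DD. rewrite Q in DD.
        replace (p T - p T)%C with (RtoC 0) in DD by ring. rewrite Cmod_0 in DD.
        assert (Rabs (s - T) > 0) by (apply Rabs_pos_lt; lra). nra.
      - rewrite Dist, Rabs_left by lra.
        apply Rle_lt_trans with (e / (2 * D) * D); [apply Rmult_le_compat_r; lra |].
        replace (e / (2 * D) * D) with (e / 2) by (field; lra). lra.
      - destruct (Below s Hs) as [d [Hd W]]. apply W.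
        rewrite Cmod_sub_diag. exact Hd. }
    destruct (Rle_lt_or_eq_dec T 1 T1) as [L | ->].
    2:{ unfold p in AtT. replace (z1 + RtoC 1 * (z2 - z1))%C with z2 in AtT by ring. exact AtT. }
    exfalso. destruct AtT as [d [Hd W]].
    set (t := Rmin 1 (T + d / (2 * D))).
    assert (P2 : 0 < d / (2 * D)) by (apply Rdiv_lt_0_compat; lra).
    assert (Ht : T < t) by (unfold t; apply Rmin_glb_lt; lra).
    assert (Et : E t).
    { split; [split; [lra | apply Rmin_l] |]. intros s Hs.
      destruct (Rlt_le_dec s T) as [L2 | L2]; [apply Below; lra |].
      exists (d / 2). split; [lra |]. intros z Hz. apply W.
      replace (z - p T)%C with ((z - p s) + (p s - p T))%C by ring.
      eapply Rle_lt_trans; [apply Cmod_triangle |]. rewrite Dist, Rabs_pos_eq by lra.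
      assert (s - T <= d / (2 * D)).
      { pose proof (Rmin_r 1 (T + d / (2 * D))). fold t in H. lra. }
      assert ((s - T) * D <= d / (2 * D) * D) by (apply Rmult_le_compat_r; lra).
      replace (d / (2 * D) * D) with (d / 2) in H0 by (field; lra). lra. }
    pose proof (UT t Et). lra.
Qed.

(** * Cauchy's formula on a circle and Weierstrass's theorem *)

Definition circ (r : R) (t : R) : C := (RtoC r * Cexp (Ci * RtoC t))%C.

Lemma Re_Ci_mult t : Re (Ci * RtoC t) = 0.
Proof. unfold Re; simpl; ring. Qed.

Lemma Cmod_circ r t : 0 < r -> Cmod (circ r t) = r.
Proof.
  intros Hr. unfold circ. rewrite Cmod_mult, Cmod_R, Cmod_Cexp, Re_Ci_mult, exp_0.
  rewrite Rabs_pos_eq; lra.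
Qed.

Lemma circ_neq_0 r t : 0 < r -> circ r t <> RtoC 0.
Proof. intros Hr. apply Cmod_gt_0. rewrite Cmod_circ; assumption. Qed.

Lemma cderiv_circ r w :
  cderiv (fun w => RtoC r * Cexp (Ci * w))%C w (Ci * (RtoC r * Cexp (Ci * w)))%C.
Proof.
  eapply cderiv_eq.
  - apply cderiv_scal, (cderiv_comp Cexp); [apply cderiv_Cexp | apply cderiv_scal, cderiv_id].
  - ring.
Qed.

Lemma circ_PI r : circ r PI = (- RtoC r)%C.
Proof.
  unfold circ, Cexp. apply Ceq; unfold Re, Im; simpl;
  replace (0 * PI - 1 * 0) with 0 by ring; replace (0 * 0 + 1 * PI) with PI by ring;
  rewrite exp_0, cos_PI, sin_PI; ring.
Qed.

Lemma circ_mPI r : circ r (- PI) = (- RtoC r)%C.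
Proof.
  unfold circ, Cexp. apply Ceq; unfold Re, Im; simpl;
  replace (0 * - PI - 1 * 0) with 0 by ring; replace (0 * 0 + 1 * - PI) with (- PI) by ring;
  rewrite exp_0, cos_neg, sin_neg, cos_PI, sin_PI; ring.
Qed.

Lemma rcont_circ r t : rcont (circ r) t.
Proof.
  apply (ccont_line (fun w => RtoC r * Cexp (Ci * w))%C). eapply cderiv_cont, cderiv_circ.
Qed.

#[global] Hint Resolve rcont_circ : ccont.

Lemma circ_sub_neq_0 r zeta t : 0 < r -> Cmod zeta < r -> (circ r t - zeta)%C <> RtoC 0.
Proof.
  intros Hr Hz. apply Cmod_gt_0. pose proof (Cmod_ge_sub (circ r t) zeta) as H.
  rewrite Cmod_circ in H by exact Hr. lra.
Qed.

Lemma rcont_kernel r zeta t : 0 < r -> Cmod zeta < r -> rcont (fun t => circ r t / (circ r t - zeta))%C t.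
Proof.
  intros Hr Hz. pose proof (circ_sub_neq_0 r zeta t Hr Hz).
  apply continuous_Cmult; [| apply continuous_Cinv]; Ccont.
Qed.

Lemma add_sub_cancel (z w : C) : (z + w - z = w)%C.
Proof. ring. Qed.

(** The continuity of [f'] is what differentiation under the integral sign asks for in
    [cauchy_const]. *)
Definition holo (D : C -> Prop) (f : C -> C) : Prop :=
  exists f' : C -> C, forall z, D z -> cderiv f z (f' z) /\ ccont f' z.

Definition Cdisc (z0 : C) (r : R) (z : C) : Prop := Cmod (z - z0) < r.

Lemma holo_cont D f z : holo D f -> D z -> ccont f z.
Proof. intros [f' H] Hz. eapply cderiv_cont, H, Hz. Qed.

(** The parameter [u] may leave [[0, 1]] by the margin [eta = (R0 - r) / (4 r)], so that the
    integral in [cauchy_const] has two-sided derivatives at [u = 0] and [u = 1]. The bound holds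
    because [(1 + 2 eta) r < R0]. *)
Lemma circle_arc_disc r R0 (zeta om : C) (u : R) :
  0 < r -> r < R0 -> Cmod zeta < r -> Cmod om = r ->
  - ((R0 - r) / (4 * r)) < u < 1 + (R0 - r) / (4 * r) ->
  Cmod (zeta + RtoC u * (om - zeta)) < R0.
Proof.
  intros Hr HR Hz Ho Hu.
  set (eta := (R0 - r) / (4 * r)) in *.
  assert (E : eta * r = (R0 - r) / 4) by (unfold eta; field; lra).
  assert (P : 0 < eta) by (apply Rdiv_lt_0_compat; lra).
  replace (zeta + RtoC u * (om - zeta))%C with (RtoC (1 - u) * zeta + RtoC u * om)%C
    by (rewrite RtoC_minus; ring).
  eapply Rle_lt_trans; [apply Cmod_triangle |].
  rewrite !Cmod_mult, !Cmod_R, Ho.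
  assert (Rabs (1 - u) * Cmod zeta <= Rabs (1 - u) * r).
  { apply Rmult_le_compat_l; [apply Rabs_pos | lra]. }
  assert (Rabs (1 - u) + Rabs u < 1 + 2 * eta).
  { unfold Rabs. destruct (Rcase_abs (1 - u)), (Rcase_abs u); lra. }
  nra.
Qed.

(** The integral of [f (z + u (w - z)) / (w - z)] over the circle has zero derivative in [u];
    compare [u = 1] and [u = 0]. *)
Lemma cauchy_const (f : C -> C) (z0 zeta : C) (r R0 : R) :
  0 < r -> r < R0 -> holo (Cdisc z0 R0) f -> Cmod zeta < r ->
  cint (fun t => f (z0 + circ r t) * (circ r t / (circ r t - zeta)))%C (- PI) PI =
  cint (fun t => f (z0 + zeta) * (circ r t / (circ r t - zeta)))%C (- PI) PI.
Proof.
  intros Hr HR [f' Hf] Hz.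
  set (kap := fun t => (circ r t / (circ r t - zeta))%C).
  pose proof (fun t => circ_sub_neq_0 r zeta t Hr Hz) as N.
  set (p := fun u t => (z0 + zeta + RtoC u * (circ r t - zeta))%C).
  set (eta := (R0 - r) / (4 * r)).
  assert (Pe : 0 < eta) by (apply Rdiv_lt_0_compat; lra).
  assert (Pin : forall u t, - eta < u < 1 + eta -> Cdisc z0 R0 (p u t)).
  { intros u t Hu. unfold Cdisc, p.
    replace (z0 + zeta + RtoC u * (circ r t - zeta) - z0)%C
      with (zeta + RtoC u * (circ r t - zeta))%C by ring.
    apply circle_arc_disc with r; try assumption. apply Cmod_circ, Hr. }
  assert (Cp : forall u t, rcont (fun s => p u s) t) by (intros u t; unfold p; Ccont).
  set (F := fun u t => (f (p u t) * kap t)%C).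
  set (dF := fun u t => (f' (p u t) * circ r t)%C).
  assert (CF : forall u t, - eta < u < 1 + eta -> rcont (F u) t).
  { intros u t Hu. apply continuous_Cmult; [| apply rcont_kernel; assumption].
    apply (continuous_Ccomp (p u) f); [apply Cp |].
    eapply cderiv_cont, Hf, Pin, Hu. }
  assert (CdF : forall u t, - eta < u < 1 + eta -> rcont (dF u) t).
  { intros u t Hu. apply continuous_Cmult; [| apply rcont_circ].
    apply (continuous_Ccomp (p u) f'); [apply Cp |]. apply Hf, Pin, Hu. }
  assert (ZdF : forall u, 0 <= u <= 1 -> cint (dF u) (- PI) PI = RtoC 0).
  { intros u Hu. apply is_cint_unique.
    destruct (Req_dec u 0) as [-> | nu].
    (* At [u = 0] the primitive [f (p u t) / (u i)] of the other case breaks down; here [f'] is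
       taken at a fixed point, and only [circ r t] remains to be integrated. *)
    - set (G := fun t => (f' (z0 + zeta) * (- Ci) * circ r t)%C).
      replace (RtoC 0) with (G PI - G (- PI)%R)%C
        by (unfold G; rewrite circ_PI, circ_mPI; ring).
      apply is_cint_rderiv.
      + intros t _. unfold G, circ.
        eapply rderiv_eq; [apply (cderiv_line (fun w => f' (z0 + zeta) * (- Ci) * (RtoC r * Cexp (Ci * w))))%C;
          apply cderiv_scal, cderiv_circ |].
        unfold dF, p. replace (z0 + zeta + RtoC 0 * (circ r t - zeta))%C with (z0 + zeta)%C by ring.
        unfold circ. apply Ceq; simpl; ring.
      + intros t _. apply CdF. lra.
    - assert (nu2 : RtoC u <> RtoC 0) by (intros Q; apply nu, RtoC_inj, Q).
      set (G := fun t => (/ (RtoC u * Ci) * f (p u t))%C).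
      replace (RtoC 0) with (G PI - G (- PI)%R)%C.
      2:{ unfold G, p. rewrite circ_PI, circ_mPI. ring. }
      apply is_cint_rderiv.
      + intros t _.
        eapply rderiv_eq.
        { apply (cderiv_line (fun w => / (RtoC u * Ci) *
            f (z0 + zeta + RtoC u * (RtoC r * Cexp (Ci * w) - zeta)))%C).
          apply cderiv_scal. apply (cderiv_comp f).
          - apply Hf. apply (Pin u t). lra.
          - apply cderiv_plus; [apply cderiv_const |]. apply cderiv_scal.
            apply cderiv_minus; [apply cderiv_circ | apply cderiv_const]. }
        unfold dF, p, circ. field. split; [apply Ci_nz | exact nu2].
      + intros t _. apply CdF. lra. }
  assert (DM : forall u, 0 <= u <= 1 ->
    rderiv (fun u => cint (F u) (- PI) PI) u (RtoC 0)).
  { intros u Hu. rewrite <- (ZdF u Hu).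
    apply cint_param_derive with (d := eta); [exact Pe | | |].
    - intros v t Hv. apply Rabs_def2 in Hv. unfold F.
      eapply rderiv_eq.
      { apply (cderiv_line (fun w => f (z0 + zeta + w * (circ r t - zeta)) * kap t)%C).
        apply cderiv_mult; [| apply cderiv_const].
        apply (cderiv_comp f).
        - apply Hf. apply (Pin v t). lra.
        - apply cderiv_plus; [apply cderiv_const |].
          apply cderiv_mult; [apply cderiv_id | apply cderiv_const]. }
      unfold dF, kap, p. field. apply N.
    - intros t. unfold dF.
      assert (C2 : @continuous (prod_UniformSpace R_UniformSpace R_UniformSpace) C_UniformSpace
        (fun q => circ r (snd q)) (u, t)).
      { apply (continuous_comp snd (circ r)); [apply continuous_snd | apply rcont_circ]. }
      apply continuous_Cmult; [| exact C2].
      apply (continuous_Ccomp (fun q => p (fst q) (snd q)) f').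
      + unfold p. pose proof (continuous_RtoC fst (u, t) (continuous_fst u t)). Ccont.
      + apply Hf, Pin. simpl. lra.
    - intros v Hv. apply Rabs_def2 in Hv. apply ex_cint_cont. intros t _. apply CF. lra. }
  pose proof (MVT_C (fun u => cint (F u) (- PI) PI) (fun _ => RtoC 0) 0 1 0 ltac:(lra) DM) as Q.
  assert (Q2 : Cmod (cint (F 1) (- PI) PI - cint (F 0) (- PI) PI) <= 0).
  { eapply Rle_trans; [apply Q | lra]. intros. rewrite Cmod_0. lra. }
  assert (E : cint (F 1) (- PI) PI = cint (F 0) (- PI) PI).
  { apply Ceq_minus, Cmod_eq_0. apply Rle_antisym; [exact Q2 | apply Cmod_ge_0]. }
  transitivity (cint (F 1) (- PI) PI); [| rewrite E];
    apply (@RInt_ext C_R_CompleteNormedModule); intros t _; unfold F, p, kap.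
  - f_equal. f_equal. ring.
  - f_equal. f_equal. ring.
Qed.

Lemma csum_geom (x : C) n : (csum (fun k => x ^ k) n * (1 - x) = 1 - x ^ n)%C.
Proof.
  induction n as [| n IH]; simpl; [ring |].
  rewrite Cmult_plus_distr_r, IH. ring.
Qed.

Definition circ_coef (g : R -> C) (r : R) (k : nat) : C :=
  cint (fun t => g t * / circ r t ^ k)%C (- PI) PI.

Lemma rcont_circ_pow r k t : 0 < r -> rcont (fun s => / circ r s ^ k)%C t.
Proof.
  intros Hr. apply continuous_Cinv; [| apply Cpow_nz, circ_neq_0, Hr].
  induction k as [| k IH]; simpl; [apply continuous_Cconst |].
  apply continuous_Cmult; [apply rcont_circ | exact IH].
Qed.

Lemma circ_coef_is g r k :
  0 < r -> (forall t, rcont g t) ->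
  is_cint (fun t => g t * / circ r t ^ k)%C (- PI) PI (circ_coef g r k).
Proof.
  intros Hr Hg. apply cint_correct, ex_cint_cont. intros t _.
  apply continuous_Cmult; [apply Hg | apply rcont_circ_pow, Hr].
Qed.

Lemma is_lim_seq_geom0 q : 0 <= q < 1 -> is_lim_seq (fun n => q ^ n) 0.
Proof. intros H. apply is_lim_seq_geom. rewrite Rabs_pos_eq; lra. Qed.

(** With [w] on the circle, [w / (w - zeta)] is the geometric series in [zeta / w]. Its [n]-th
    remainder is exactly [w / (w - zeta) * (zeta / w)^n], so the error of termwise integration is at
    most a constant times [q ^ n]. *)
Lemma kernel_series (g : R -> C) (r : R) (zeta : C) :
  0 < r -> (forall t, rcont g t) -> Cmod zeta < r ->
  clim (csum (fun k => circ_coef g r k * zeta ^ k)%C)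
    (cint (fun t => g t * (circ r t / (circ r t - zeta)))%C (- PI) PI).
Proof.
  intros Hr Hg Hz. pose proof PI_RGT_0 as HPI.
  pose proof (fun t => circ_sub_neq_0 r zeta t Hr Hz) as N.
  set (I := cint (fun t => g t * (circ r t / (circ r t - zeta)))%C (- PI) PI).
  assert (HI : is_cint (fun t => g t * (circ r t / (circ r t - zeta)))%C (- PI) PI I).
  { apply cint_correct, ex_cint_cont. intros t _.
    apply continuous_Cmult; [apply Hg | apply rcont_kernel; assumption]. }
  destruct (ex_cint_bounded g (- PI) PI) as [M [PM HM]]; [lra | |].
  { apply ex_cint_cont. intros t _. apply Hg. }
  set (q := Cmod zeta / r).
  assert (Hq : 0 <= q < 1).
  { split; [apply Rdiv_le_0_compat; [apply Cmod_ge_0 | exact Hr] |]. apply Rlt_div_l; lra. }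
  assert (S : forall n, is_cint (fun t => g t * csum (fun k => (zeta / circ r t) ^ k) n)%C (- PI) PI
    (csum (fun k => circ_coef g r k * zeta ^ k)%C n)).
  { induction n as [| n IH].
    - simpl. apply (is_cint_ext (fun _ => RtoC 0)); [intros; C_eq; ring |].
      pose proof (is_cint_const (RtoC 0) (- PI) PI) as Q. rewrite Cmult_0_r in Q. exact Q.
    - simpl. apply (is_cint_ext (fun t => g t * csum (fun k => (zeta / circ r t) ^ k) n
        + zeta ^ n * (g t * / circ r t ^ n))%C).
      + intros t _. unfold Cdiv. rewrite Cpow_mult_l, Cpow_inv by apply circ_neq_0, Hr. C_eq. ring.
      + apply is_cint_plus; [exact IH |]. rewrite Cmult_comm. apply is_cint_scal, circ_coef_is; assumption. }
  apply clim_le with (fun n => (PI - - PI) * (M * (r / (r - Cmod zeta))) * q ^ n).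
  2:{ apply is_lim_seq_scal0, is_lim_seq_geom0, Hq. }
  intros n. rewrite Cmod_sub_comm, Rmult_assoc.
  refine (is_cint_Cmod_le _ _ _ _ _ _ _ (is_cint_minus _ _ _ _ _ _ HI (S n))); [lra |].
  intros t Ht. cbv beta.
  set (w := circ r t) in *. assert (Nw : w <> RtoC 0) by apply circ_neq_0, Hr.
  pose proof (N t) as Nt. fold w in Nt.
  replace (g t * (w / (w - zeta)) - g t * csum (fun k => (zeta / w) ^ k) n)%C
    with (g t * (w / (w - zeta)) * (zeta / w) ^ n)%C.
  - assert (Ew : Cmod w = r) by apply Cmod_circ, Hr.
    rewrite !Cmod_mult, Cmod_pow, !Cmod_div, Ew by assumption. fold q.
    apply Rmult_le_compat_r; [apply pow_le; lra |].
    apply Rmult_le_compat; [apply Cmod_ge_0 | | apply HM; lra |].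
    + apply Rdiv_le_0_compat; [lra |]. apply Cmod_gt_0, Nt.
    + pose proof (Cmod_ge_sub w zeta). rewrite Ew in H.
      unfold Rdiv. apply Rmult_le_compat_l; [lra |]. apply Rinv_le_contravar; lra.
  - pose proof (csum_geom (zeta / w) n) as G.
    assert (E1 : csum (fun k => (zeta / w) ^ k)%C n = ((1 - (zeta / w) ^ n) * (w / (w - zeta)))%C).
    { rewrite <- G. field. split; assumption. }
    rewrite E1. ring.
Qed.

Lemma circ_coef_one r k : 0 < r ->
  circ_coef (fun _ => RtoC 1) r k = match k with O => RtoC (2 * PI) | S _ => RtoC 0 end.
Proof.
  intros Hr. unfold circ_coef. apply is_cint_unique. destruct k as [| k].
  - apply (is_cint_ext (fun _ => RtoC 1)); [intros t _; simpl; C_eq; field |].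
    replace (RtoC (2 * PI)) with (RtoC (PI - - PI) * RtoC 1)%C
      by (rewrite <- RtoC_mult; f_equal; ring).
    apply is_cint_const.
  - set (m := S k).
    assert (Nm : RtoC (INR m) <> RtoC 0).
    { intros Q. apply RtoC_inj in Q. revert Q. apply not_0_INR. discriminate. }
    set (c := (/ (- (Ci * RtoC (INR m)) * RtoC r ^ m))%C).
    set (G := fun t : R => (c * Cexp (- (Ci * RtoC (INR m)) * RtoC t))%C).
    assert (Nr : (RtoC r ^ m)%C <> RtoC 0).
    { apply Cpow_nz. intros Q. apply RtoC_inj in Q. lra. }
    assert (Pw : forall t, (circ r t ^ m = RtoC r ^ m * Cexp (Ci * RtoC (INR m) * RtoC t))%C).
    { intros t. unfold circ. rewrite Cpow_mult_l. f_equal. clear.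
      induction m as [| m IH].
      - simpl. replace (Ci * RtoC 0 * RtoC t)%C with (RtoC 0) by ring. rewrite Cexp_0. reflexivity.
      - rewrite S_INR. simpl Cpow. rewrite IH, <- Cexp_plus. f_equal. rewrite RtoC_plus. ring. }
    (* Periodicity is read off from [circ]: the circle starts and ends at [- r], so the [m]-th
       powers at the two ends agree, and with them the exponentials. *)
    assert (E : (G PI - G (- PI)%R = RtoC 0)%C).
    { unfold G. enough (Q : (Cexp (- (Ci * RtoC (INR m)) * RtoC PI) = Cexp (- (Ci * RtoC (INR m)) * RtoC (- PI)))%C).
      { rewrite Q. ring. }
      replace (- (Ci * RtoC (INR m)) * RtoC PI)%C with (- (Ci * RtoC (INR m) * RtoC PI))%C by ring.
      replace (- (Ci * RtoC (INR m)) * RtoC (- PI))%C with (- (Ci * RtoC (INR m) * RtoC (- PI)))%C by ring.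
      rewrite !Cexp_opp. f_equal.
      apply (Ceq_minus _ _). pose proof (Pw PI) as P1. pose proof (Pw (- PI)) as P2.
      rewrite circ_PI in P1. rewrite circ_mPI in P2.
      assert (E0 : (RtoC r ^ m * (Cexp (Ci * RtoC (INR m) * RtoC PI) - Cexp (Ci * RtoC (INR m) * RtoC (- PI))) = 0)%C).
      { replace (RtoC 0) with ((- RtoC r) ^ m - (- RtoC r) ^ m)%C by ring.
        rewrite P1 at 1. rewrite P2. ring. }
      apply (f_equal (fun z => / (RtoC r ^ m) * z)%C) in E0. rewrite Cmult_0_r in E0.
      rewrite <- E0. field. exact Nr. }
    rewrite <- E. apply is_cint_rderiv.
    + intros t _.
      eapply rderiv_eq.
      { apply (cderiv_line (fun w => c * Cexp (- (Ci * RtoC (INR m)) * w))%C).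
        apply cderiv_scal, (cderiv_comp Cexp); [apply cderiv_Cexp | apply cderiv_scal, cderiv_id]. }
      rewrite Pw. replace (- (Ci * RtoC (INR m)) * RtoC t)%C with (- (Ci * RtoC (INR m) * RtoC t))%C by ring.
      rewrite Cexp_opp. unfold c. pose proof (Cexp_neq_0 (Ci * RtoC (INR m) * RtoC t)).
      field. repeat split; try assumption. apply Ci_nz.
    + intros t _. apply continuous_Cmult; [apply continuous_Cconst | apply rcont_circ_pow, Hr].
Qed.

(** This is [kernel_series] for the constant function [1], where only the coefficient of order [0]
    survives, whatever [zeta] is. *)
Lemma kernel_integral r zeta : 0 < r -> Cmod zeta < r ->
  is_cint (fun t => circ r t / (circ r t - zeta))%C (- PI) PI (RtoC (2 * PI)).
Proof.
  intros Hr Hz.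
  pose proof (kernel_series (fun _ => RtoC 1) r zeta Hr (fun t => continuous_Cconst _ t) Hz) as L.
  apply clim_incr in L.
  assert (E : cint (fun t => RtoC 1 * (circ r t / (circ r t - zeta)))%C (- PI) PI = RtoC (2 * PI)).
  { eapply clim_unique; [exact L |].
    apply (clim_ext (fun _ => RtoC (2 * PI))); [| apply clim_const].
    intros n. rewrite csum_shift. rewrite circ_coef_one by exact Hr.
    rewrite (csum_ext _ (fun _ => (RtoC 0 * RtoC 0)%C)); [rewrite csum_scal; simpl; ring |].
    intros k _. rewrite circ_coef_one by exact Hr. ring. }
  rewrite <- E. apply (is_cint_ext (fun t => RtoC 1 * (circ r t / (circ r t - zeta)))%C).
  - intros t _. C_eq. ring.
  - apply cint_correct, ex_cint_cont. intros t _.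
    apply continuous_Cmult; [apply continuous_Cconst | apply rcont_kernel; assumption].
Qed.

Definition cauchy_coef (f : C -> C) (z0 : C) (r : R) (k : nat) : C :=
  (/ RtoC (2 * PI) * circ_coef (fun t => f (z0 + circ r t)%C) r k)%C.

Lemma rcont_on_circle f z0 r R0 : 0 < r -> r < R0 -> holo (Cdisc z0 R0) f ->
  forall t, rcont (fun t => f (z0 + circ r t)%C) t.
Proof.
  intros Hr HR Hf t. apply (continuous_Ccomp (fun t => z0 + circ r t)%C f).
  - apply continuous_Cplus; [apply continuous_Cconst | apply rcont_circ].
  - eapply holo_cont; [exact Hf |]. unfold Cdisc.
    rewrite add_sub_cancel. rewrite Cmod_circ; lra.
Qed.

Lemma RtoC_2PI_neq_0 : RtoC (2 * PI) <> RtoC 0.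
Proof. intros Q. apply RtoC_inj in Q. pose proof PI_RGT_0. lra. Qed.

(** The same integral is computed in two ways: [kernel_series] expands it in powers, while
    [cauchy_const] replaces [f] on the circle by the value [f z] and [kernel_integral] evaluates the
    rest. *)
Lemma cauchy_series (f : C -> C) (z0 : C) (r R0 : R) :
  0 < r -> r < R0 -> holo (Cdisc z0 R0) f -> sums_to (cauchy_coef f z0 r) z0 r f.
Proof.
  intros Hr HR Hf z Hz.
  pose proof (kernel_series _ r (z - z0)%C Hr (rcont_on_circle _ _ _ _ Hr HR Hf) Hz) as L.
  cbv beta in L. rewrite (cauchy_const f z0 (z - z0)%C r R0 Hr HR Hf Hz) in L.
  replace (z0 + (z - z0))%C with z in L by ring.
  rewrite (is_cint_unique _ _ _ _ (is_cint_scal (f z) _ _ _ _ (kernel_integral r _ Hr Hz))) in L.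
  apply (clim_scal (/ RtoC (2 * PI))%C) in L.
  replace (/ RtoC (2 * PI) * (f z * RtoC (2 * PI)))%C with (f z) in L
    by (field; apply RtoC_2PI_neq_0).
  eapply clim_ext; [| exact L]. intros n. cbv beta.
  rewrite <- csum_scal. apply csum_ext. intros k _. unfold cauchy_coef. apply Cmult_assoc.
Qed.

(** Cauchy's estimate for [f - g]. Scaling by [r ^ k] makes the bound independent of [k], as
    Weierstrass's theorem requires. *)
Lemma cauchy_coef_diff f g z0 r R0 k b :
  0 < r -> r < R0 -> holo (Cdisc z0 R0) f -> holo (Cdisc z0 R0) g ->
  (forall z, Cdisc z0 R0 z -> Cmod (f z - g z) <= b) ->
  Cmod (cauchy_coef f z0 r k * RtoC r ^ k - cauchy_coef g z0 r k * RtoC r ^ k) <= b.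
Proof.
  intros Hr HR Hf Hg Hb. pose proof PI_RGT_0 as HPI.
  pose proof (circ_coef_is _ r k Hr (rcont_on_circle _ _ _ _ Hr HR Hf)) as I1.
  pose proof (circ_coef_is _ r k Hr (rcont_on_circle _ _ _ _ Hr HR Hg)) as I2.
  pose proof (is_cint_minus _ _ _ _ _ _ I1 I2) as I.
  apply (is_cint_Cmod_le _ (- PI) PI _ (b * / r ^ k) ltac:(lra)) in I.
  - unfold cauchy_coef.
    set (c1 := circ_coef (fun t => f (z0 + circ r t)%C) r k) in *.
    set (c2 := circ_coef (fun t => g (z0 + circ r t)%C) r k) in *.
    replace (/ RtoC (2 * PI) * c1 * RtoC r ^ k - / RtoC (2 * PI) * c2 * RtoC r ^ k)%C
      with (/ RtoC (2 * PI) * RtoC r ^ k * (c1 - c2))%C by ring.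
    rewrite !Cmod_mult, Cmod_inv, Cmod_pow, !Cmod_R by apply RtoC_2PI_neq_0.
    rewrite !Rabs_pos_eq by lra.
    assert (Pk : 0 < r ^ k) by (apply pow_lt; exact Hr).
    apply Rle_trans with (/ (2 * PI) * r ^ k * ((PI - - PI) * (b * / r ^ k))).
    + apply Rmult_le_compat_l; [| exact I]. apply Rmult_le_pos; [| lra].
      left. apply Rinv_0_lt_compat. lra.
    + right. field. split; lra.
  - intros t Ht. replace (f (z0 + circ r t) * / circ r t ^ k - g (z0 + circ r t) * / circ r t ^ k)%C
      with ((f (z0 + circ r t) - g (z0 + circ r t)) * / circ r t ^ k)%C by ring.
    rewrite Cmod_mult, Cmod_inv, Cmod_pow, Cmod_circ by (try apply Cpow_nz, circ_neq_0; exact Hr).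
    apply Rmult_le_compat_r.
    + left. apply Rinv_0_lt_compat, pow_lt, Hr.
    + apply Hb. unfold Cdisc. rewrite add_sub_cancel.
      rewrite Cmod_circ; lra.
Qed.

(** * Tails of series and sequences with summable steps *)

Definition tail (b : nat -> R) (n : nat) : R := Series (fun k => b (n + k)%nat).

Lemma tail_step b n : ex_series b -> tail b n = b n + tail b (S n).
Proof.
  intros H. unfold tail. rewrite Series_incr_1.
  - f_equal; [f_equal; lia |]. apply Series_ext. intros k. f_equal. lia.
  - apply (ex_series_incr_n b n). exact H.
Qed.

Lemma is_lim_seq_tail b : ex_series b -> is_lim_seq (tail b) 0.
Proof.
  intros H.
  assert (E : forall n, tail b (S n) = Series b - sum_n b n).
  { induction n as [| n IH].
    - rewrite sum_O. pose proof (tail_step b 0 H) as Q. unfold tail in Q at 1.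
      rewrite (Series_ext _ b) in Q by (intros; f_equal; lia). lra.
    - rewrite sum_Sn. pose proof (tail_step b (S n) H). unfold plus; simpl. lra. }
  apply is_lim_seq_incr_1. apply (is_lim_seq_ext (fun n => Series b - sum_n b n)).
  - intros n. symmetry. apply E.
  - replace (Finite 0) with (Finite (Series b - Series b)) by (f_equal; ring).
    apply is_lim_seq_minus'; [apply is_lim_seq_const |]. exact (Series_correct b H).
Qed.

Lemma tail_pos b n : ex_series b -> (forall k, 0 <= b k) -> 0 <= tail b n.
Proof.
  intros H P. pose proof (is_lim_seq_tail b H) as L.
  assert (D : forall j, tail b (n + j) <= tail b n).
  { induction j as [| j IH]; [rewrite Nat.add_0_r; lra |].
    replace (n + S j)%nat with (S (n + j)) by lia.
    pose proof (tail_step b (n + j) H). pose proof (P (n + j)%nat). lra. }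
  apply (is_lim_seq_incr_n (tail b) n) in L.
  pose proof (is_lim_seq_le (fun j => tail b (j + n)) (fun _ => tail b n) 0 (tail b n)) as Q.
  simpl in Q. apply Q; [| exact L | apply is_lim_seq_const].
  intros j. rewrite Nat.add_comm. apply D.
Qed.

(** The rate [tail b n] depends on [b] alone, so for a sequence of functions with a common majorant
    of the steps the convergence is uniform. *)
Lemma clim_summable_steps (u : nat -> C) (b : nat -> R) :
  ex_series b -> (forall n, Cmod (u (S n) - u n) <= b n) ->
  exists l, clim u l /\ forall n, Cmod (u n - l) <= tail b n.
Proof.
  intros Hb Hu.
  assert (Pb : forall k, 0 <= b k) by (intros k; eapply Rle_trans; [apply Cmod_ge_0 | apply Hu]).
  pose proof (is_lim_seq_tail b Hb) as T.
  assert (D : forall n j, Cmod (u (n + j)%nat - u n) <= tail b n - tail b (n + j)).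
  { intros n j. induction j as [| j IH].
    - rewrite Nat.add_0_r. replace (u n - u n)%C with (RtoC 0) by ring. rewrite Cmod_0. lra.
    - replace (n + S j)%nat with (S (n + j)) by lia.
      replace (u (S (n + j)) - u n)%C with ((u (S (n + j)) - u (n + j)%nat) + (u (n + j)%nat - u n))%C by ring.
      eapply Rle_trans; [apply Cmod_triangle |].
      pose proof (tail_step b (n + j) Hb). pose proof (Hu (n + j)%nat). lra. }
  assert (DD : forall n m, (n <= m)%nat -> Cmod (u m - u n) <= tail b n).
  { intros n m L. replace m with (n + (m - n))%nat by lia.
    eapply Rle_trans; [apply D |]. pose proof (tail_pos b (n + (m - n)) Hb Pb). lra. }
  assert (Cau : forall e : posreal, exists N, forall n m, (N <= n)%nat -> (N <= m)%nat -> Cmod (u n - u m) < e).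
  { intros e. apply is_lim_seq_spec in T.
    assert (He : 0 < e / 2) by (pose proof (cond_pos e); lra).
    destruct (T (mkposreal _ He)) as [N HN]. simpl in HN.
    exists N. intros n m Hn Hm. specialize (HN N (le_n _)).
    rewrite Rminus_0_r in HN. pose proof (Rle_abs (tail b N)).
    replace (u n - u m)%C with ((u n - u N) - (u m - u N))%C by ring.
    eapply Rle_lt_trans; [apply Cmod_sub_le |].
    pose proof (DD N n Hn). pose proof (DD N m Hm). lra. }
  assert (LRe : ex_finite_lim_seq (fun n => Re (u n))).
  { apply ex_lim_seq_cauchy_corr. intros e. destruct (Cau e) as [N HN]. exists N. intros n m Hn Hm.
    eapply Rle_lt_trans; [| apply (HN n m Hn Hm)].
    replace (Re (u n) - Re (u m)) with (Re (u n - u m)) by (unfold Re; simpl; ring). apply re_le_Cmod. }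
  assert (LIm : ex_finite_lim_seq (fun n => Im (u n))).
  { apply ex_lim_seq_cauchy_corr. intros e. destruct (Cau e) as [N HN]. exists N. intros n m Hn Hm.
    eapply Rle_lt_trans; [| apply (HN n m Hn Hm)].
    replace (Im (u n) - Im (u m)) with (Im (u n - u m)) by (unfold Im; simpl; ring). apply Cmod_Im. }
  destruct LRe as [x Hx]. destruct LIm as [y Hy].
  assert (L : clim u (x, y)).
  { pose proof (clim_plus _ _ _ _ (clim_RtoC _ _ Hx) (clim_scal Ci _ _ (clim_RtoC _ _ Hy))) as Q.
    replace (x, y) with (RtoC x + Ci * RtoC y)%C by (apply Ceq; simpl; ring).
    eapply clim_ext; [| exact Q]. intros n. apply Ceq; simpl; unfold Re, Im; ring. }
  exists (x, y). split; [exact L |]. intros n.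
  rewrite Cmod_sub_comm.
  assert (L2 : clim (fun j => u (j + n)%nat) (x, y)).
  { apply (is_lim_seq_incr_n (fun n => Cmod (u n - (x, y))) n). exact L. }
  apply (clim_bound _ _ _ (clim_minus _ _ _ _ L2 (clim_const (u n)))).
  intros j. apply DD. lia.
Qed.

Lemma is_lim_seq_0_lt (u : nat -> R) (e : R) :
  is_lim_seq u 0 -> 0 < e -> exists N, forall n, (N <= n)%nat -> u n < e.
Proof.
  intros H He. apply is_lim_seq_spec in H. destruct (H (mkposreal e He)) as [N HN]. simpl in HN.
  exists N. intros n Hn. specialize (HN n Hn). apply Rabs_def2 in HN. lra.
Qed.

(** The Taylor coefficients of [f n], scaled by [r ^ k], converge with error [tail b n] uniformly in
    [k]; hence the series of limits differs from that of [f n] by at most a geometric sum. The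
    derivative at [z0] is the coefficient of order [1], so the derivatives converge too. *)
Theorem weierstrass (f : nat -> C -> C) (F : C -> C) (b : nat -> R) (z0 : C) (R0 : R) :
  0 < R0 -> ex_series b ->
  (forall n, holo (Cdisc z0 R0) (f n)) ->
  (forall n z, Cdisc z0 R0 z -> Cmod (f (S n) z - f n z) <= b n) ->
  (forall z, Cdisc z0 R0 z -> clim (fun n => f n z) (F z)) ->
  analytic_at F z0 /\
  exists l, cderiv F z0 l /\ forall d, (forall n, cderiv (f n) z0 (d n)) -> clim d l.
Proof.
  intros HR Hb Hh Hs HF.
  assert (Pb : forall k, 0 <= b k).
  { intros k. eapply Rle_trans; [apply Cmod_ge_0 | apply (Hs k z0)]. unfold Cdisc.
    rewrite Cmod_sub_diag. exact HR. }
  set (r := R0 / 2). assert (Hr : 0 < r) by (unfold r; lra). assert (HrR : r < R0) by (unfold r; lra).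
  set (cn := fun n k => cauchy_coef (f n) z0 r k).
  assert (Nr : forall k, (RtoC r ^ k)%C <> RtoC 0).
  { intros k. apply Cpow_nz. intros Q. apply RtoC_inj in Q. lra. }
  set (L := fun k => clim_of (fun n => cn n k * RtoC r ^ k)%C).
  assert (HLk : forall k, clim (fun n => cn n k * RtoC r ^ k)%C (L k) /\
    forall n, Cmod (cn n k * RtoC r ^ k - L k) <= tail b n).
  { intros k. destruct (clim_summable_steps (fun n => cn n k * RtoC r ^ k)%C b Hb) as [l [H1 H2]].
    - intros n. apply (cauchy_coef_diff (f (S n)) (f n) z0 r R0 k); auto.
    - unfold L. rewrite (clim_of_correct _ _ H1). split; assumption. }
  set (c := fun k => (L k / RtoC r ^ k)%C).
  assert (HFn : forall z, Cdisc z0 R0 z -> forall n, Cmod (f n z - F z) <= tail b n).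
  { intros z Hz. destruct (clim_summable_steps (fun n => f n z) b Hb (fun n => Hs n z Hz)) as [l [H1 H2]].
    replace (F z) with l; [exact H2 |]. apply (clim_unique (fun n => f n z)); [exact H1 | apply HF, Hz]. }
  assert (S : sums_to c z0 r F).
  { intros z Hz. set (zeta := (z - z0)%C) in *. set (q := Cmod zeta / r).
    assert (Hq : 0 <= q < 1).
    { split; [apply Rdiv_le_0_compat; [apply Cmod_ge_0 | exact Hr] |]. apply Rlt_div_l; lra. }
    assert (Hc : forall n K, Cmod (csum (fun k => cn n k * zeta ^ k)%C K - csum (fun k => c k * zeta ^ k)%C K)
       <= tail b n / (1 - q) * (1 - q ^ K)).
    { intros n K. induction K as [| K IH].
      - simpl. rewrite Cmod_sub_diag. lra.
      - simpl csum.
        replace (csum (fun k => cn n k * zeta ^ k) K + cn n K * zeta ^ K -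
          (csum (fun k => c k * zeta ^ k) K + c K * zeta ^ K))%C with
          ((csum (fun k => cn n k * zeta ^ k) K - csum (fun k => c k * zeta ^ k) K)
           + (cn n K * RtoC r ^ K - L K) * (zeta ^ K / RtoC r ^ K))%C by (unfold c; field; apply Nr).
        eapply Rle_trans; [apply Cmod_triangle |].
        apply Rle_trans with (tail b n / (1 - q) * (1 - q ^ K) + tail b n * q ^ K).
        + apply Rplus_le_compat; [exact IH |].
          rewrite Cmod_mult, Cmod_div, !Cmod_pow, Cmod_R, (Rabs_pos_eq r) by (try apply Nr; lra).
          replace (Cmod zeta ^ K / r ^ K) with (q ^ K)
            by (unfold q, Rdiv; rewrite Rpow_mult_distr, pow_inv; reflexivity).
          apply Rmult_le_compat_r; [apply pow_le; lra | apply HLk].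
        + right. simpl. field. lra. }
    apply is_lim_seq_spec. intros e.
    assert (P1 : 0 < 1 + / (1 - q)).
    { assert (0 < / (1 - q)) by (apply Rinv_0_lt_compat; lra). lra. }
    (* One half of [e] pays for [f n z - F z] and for the exchange of coefficients, which together
       cost [tail b n * (1 + / (1 - q))]; the other half pays for truncating the series of [f n]. *)
    assert (He : 0 < e / 2 / (1 + / (1 - q))).
    { apply Rdiv_lt_0_compat; [pose proof (cond_pos e); lra | exact P1]. }
    destruct (is_lim_seq_0_lt _ _ (is_lim_seq_tail b Hb) He) as [n Hn].
    specialize (Hn n (le_n _)). apply Rlt_div_r in Hn; [| exact P1].
    pose proof (cauchy_series (f n) z0 r R0 Hr HrR (Hh n) z Hz) as Sn.
    destruct (is_lim_seq_0_lt _ (e / 2) Sn) as [K HK]; [pose proof (cond_pos e); lra |].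
    exists K. intros m Hm. specialize (HK m Hm). cbv beta in HK.
    rewrite Rminus_0_r, Rabs_pos_eq by apply Cmod_ge_0.
    fold zeta in HK.
    change (csum (fun k => cauchy_coef (f n) z0 r k * zeta ^ k)%C m)
      with (csum (fun k => cn n k * zeta ^ k)%C m) in HK.
    assert (Hz2 : Cdisc z0 R0 z) by (unfold Cdisc; fold zeta; lra).
    pose proof (HFn z Hz2 n) as A1. pose proof (Hc n m) as A2.
    set (X := csum (fun k => c k * zeta ^ k)%C m) in *.
    set (Y := csum (fun k => cn n k * zeta ^ k)%C m) in *.
    replace (X - F z)%C with ((Y - f n z) + (f n z - F z) - (Y - X))%C by ring.
    eapply Rle_lt_trans; [apply Cmod_sub_le |].
    pose proof (Cmod_triangle (Y - f n z) (f n z - F z)) as A3.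
    assert (A4 : tail b n / (1 - q) * (1 - q ^ m) <= tail b n * / (1 - q)).
    { assert (0 <= q ^ m) by (apply pow_le; lra).
      assert (0 <= tail b n / (1 - q)) by (apply Rdiv_le_0_compat; [apply tail_pos; assumption | lra]).
      unfold Rdiv in *. nra. }
    lra. }
  split; [apply analytic_at_sums; exists c, r; split; assumption |].
  exists (c 1%nat). split; [apply (sums_to_cderiv _ _ _ _ Hr S) |].
  intros d Hd.
  assert (E : forall n, d n = cn n 1%nat).
  { intros n. eapply cderiv_unique; [apply Hd |].
    apply (sums_to_cderiv _ _ _ _ Hr (cauchy_series (f n) z0 r R0 Hr HrR (Hh n))). }
  destruct (HLk 1%nat) as [H1 _]. apply (clim_scal (/ RtoC r ^ 1)%C) in H1.
  unfold c. replace (L 1%nat / RtoC r ^ 1)%C with (/ RtoC r ^ 1 * L 1%nat)%C by (unfold Cdiv; ring).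
  eapply clim_ext; [| exact H1]. intros n. cbv beta. rewrite E. simpl.
  field. intros Q. apply RtoC_inj in Q. lra.
Qed.

(** * Stirling's approximation of log Gamma *)

(** As a function of the right end [t], the error has derivative [p t / 2], and [p] has derivative
    [t * f3 t]; the mean value inequality is used twice. The sharp constant [1 / 12] is given up. *)
Lemma trapezoid_le (f0 f1 f2 f3 : C -> C) (M : R) :
  (forall t, 0 <= t <= 1 -> cderiv f0 (RtoC t) (f1 (RtoC t))) ->
  (forall t, 0 <= t <= 1 -> cderiv f1 (RtoC t) (f2 (RtoC t))) ->
  (forall t, 0 <= t <= 1 -> cderiv f2 (RtoC t) (f3 (RtoC t))) ->
  (forall t, 0 <= t <= 1 -> Cmod (f3 (RtoC t)) <= M) ->
  Cmod (f0 (RtoC 1) - f0 (RtoC 0) - (f1 (RtoC 0) + f1 (RtoC 1)) / 2) <= M.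
Proof.
  intros D0 D1 D2 H.
  assert (PM : 0 <= M) by (eapply Rle_trans; [apply Cmod_ge_0 | apply (H 0); lra]).
  set (p := fun w => (f1 (RtoC 0) - f1 w + w * f2 w)%C).
  assert (Hp : forall t, 0 <= t <= 1 -> Cmod (p (RtoC t)) <= M).
  { intros t Ht.
    pose proof (MVT_C (fun s => p (RtoC s)) (fun s => RtoC s * f3 (RtoC s))%C 0 t M ltac:(lra)) as Q.
    cbv beta in Q.
    replace (p (RtoC 0)) with (RtoC 0) in Q by (unfold p; Cring).
    replace (p (RtoC t) - 0)%C with (p (RtoC t)) in Q by Cring.
    apply Rle_trans with (M * (t - 0)); [| nra]. apply Q.
    - intros s Hs. apply cderiv_line. unfold p.
      eapply cderiv_eq.
      + apply cderiv_plus.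
        * apply cderiv_minus; [apply cderiv_const | apply D1; lra].
        * apply cderiv_mult; [apply cderiv_id | apply D2; lra].
      + Cring.
    - intros s Hs. rewrite Cmod_mult, Cmod_R, Rabs_pos_eq by lra.
      assert (L := H s ltac:(lra)). pose proof (Cmod_ge_0 (f3 (RtoC s))). nra. }
  set (g := fun w => (w * (f1 (RtoC 0) + f1 w) * (1 / 2) - (f0 w - f0 (RtoC 0)))%C).
  pose proof (MVT_C (fun s => g (RtoC s)) (fun s => p (RtoC s) * (1 / 2))%C 0 1 M ltac:(lra)) as Q.
  replace (f0 (RtoC 1) - f0 (RtoC 0) - (f1 (RtoC 0) + f1 (RtoC 1)) / 2)%C
    with (- (g (RtoC 1) - g (RtoC 0)))%C by (unfold g; Cfield).
  rewrite Cmod_opp. apply Rle_trans with (M * (1 - 0)); [| lra]. apply Q.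
  - intros s Hs. apply cderiv_line. unfold g.
    eapply cderiv_eq.
    + apply cderiv_minus.
      * apply cderiv_mult; [| apply cderiv_const].
        apply cderiv_mult; [apply cderiv_id |].
        apply cderiv_plus; [apply cderiv_const | apply D1; lra].
      * apply cderiv_minus; [apply D0; lra | apply cderiv_const].
    + unfold p. Cfield.
  - intros s Hs. rewrite Cmod_mult. replace (1 / 2)%C with (RtoC (1 / 2)).
    + rewrite Cmod_R, Rabs_pos_eq by lra. pose proof (Hp s Hs). pose proof (Cmod_ge_0 (p (RtoC s))). lra.
    + rewrite RtoC_div by lra. reflexivity.
Qed.

Lemma Re_shift (x : R) (a : C) : Re (RtoC x + a) = x + Re a.
Proof. rewrite re_plus, re_RtoC. reflexivity. Qed.

Lemma Re_le_Cmod (z : C) : Re z <= Cmod z.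
Proof. pose proof (re_le_Cmod z). pose proof (Rle_abs (Re z)). lra. Qed.

Lemma cderiv_Clog_comp f z l : cderiv f z l -> 0 < Re (f z) ->
  cderiv (fun w => Clog_right (f w)) z (l / f z)%C.
Proof.
  intros H P. eapply cderiv_eq; [apply (cderiv_comp Clog_right f); [apply cderiv_Clog_right, P | exact H] |].
  unfold Cdiv. Cring.
Qed.

Lemma cderiv_shift (w z : C) : cderiv (fun x => x + w)%C z 1.
Proof. eapply cderiv_eq; [apply cderiv_plus; [apply cderiv_id | apply cderiv_const] | Cring]. Qed.

Lemma cderiv_Cexp_comp f z l : cderiv f z l -> cderiv (fun w => Cexp (f w)) z (Cexp (f z) * l)%C.
Proof. intros H. apply (cderiv_comp Cexp f); [apply cderiv_Cexp | exact H]. Qed.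

(** Up to sign conventions this is the trapezoid error of the logarithm between [w] and [1 + w],
    with primitive [x log x - x], whose third derivative is [- 1 / x^2]. *)
Lemma log_trapezoid_le (w : C) (m : R) : 0 < m -> m <= Re w ->
  Cmod ((w + 1 / 2) * (Clog_right (1 + w) - Clog_right w) - 1) <= / (m * m).
Proof.
  intros Pm Hm.
  assert (P : forall t, 0 <= t <= 1 -> 0 < Re (RtoC t + w)) by (intros t Ht; rewrite Re_shift; lra).
  assert (NZ : forall t, 0 <= t <= 1 -> (RtoC t + w)%C <> RtoC 0)
    by (intros t Ht; apply Re_pos_neq_0, P, Ht).
  pose proof (trapezoid_le (fun x => (x + w) * Clog_right (x + w) - (x + w))%C
    (fun x => Clog_right (x + w)) (fun x => / (x + w))%C (fun x => - / ((x + w) * (x + w)))%C (/ (m * m))) as Q.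
  cbv beta in Q.
  replace ((w + 1 / 2) * (Clog_right (1 + w) - Clog_right w) - 1)%C with
    ((1 + w) * Clog_right (1 + w) - (1 + w) - ((0 + w) * Clog_right (0 + w) - (0 + w))
      - (Clog_right (0 + w) + Clog_right (1 + w)) / 2)%C.
  2:{ rewrite Cplus_0_l. Cfield. }
  apply Q.
  - intros t Ht. eapply cderiv_eq.
    + apply cderiv_minus; [| apply cderiv_shift].
      apply cderiv_mult; [apply cderiv_shift |].
      apply cderiv_Clog_comp; [apply cderiv_shift | apply P, Ht].
    + Cfield. apply NZ, Ht.
  - intros t Ht. eapply cderiv_eq.
    + apply cderiv_Clog_comp; [apply cderiv_shift | apply P, Ht].
    + Cfield. apply NZ, Ht.
  - intros t Ht. eapply cderiv_eq.
    + apply cderiv_inv; [apply cderiv_shift | apply NZ, Ht].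
    + Cfield. apply NZ, Ht.
  - intros t Ht. pose proof (NZ t Ht).
    rewrite Cmod_opp, Cmod_inv by (apply Cmult_neq_0; assumption). rewrite Cmod_mult.
    pose proof (Re_le_Cmod (RtoC t + w)). rewrite Re_shift in *.
    apply Rinv_le_contravar; nra.
Qed.

Definition shift (n : nat) (a : C) : C := (RtoC (INR n) + a)%C.

Definition log_shift (n : nat) (a : C) : C := Clog_right (shift n a).

Lemma shift_S n a : (shift (S n) a = 1 + shift n a)%C.
Proof. unfold shift. rewrite S_INR, RtoC_plus. Cring. Qed.

Lemma Re_shift_n n a : Re (shift n a) = INR n + Re a.
Proof. apply Re_shift. Qed.

Lemma Re_shift_pos n a : 0 < Re a -> 0 < Re (shift n a).
Proof. intros H. rewrite Re_shift_n. pose proof (pos_INR n). lra. Qed.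

Lemma shift_neq_0 n a : 0 < Re a -> shift n a <> RtoC 0.
Proof. intros H. apply Re_pos_neq_0, Re_shift_pos, H. Qed.

(** Its exponential is [sqrt (2 pi) (N + a)^(N + a - 1/2) e^(- N - a) / (a (a + 1) ... (a + N - 1))],
    Stirling's approximation of [Gamma (a + N)] divided by the factors of the functional equation. *)
Definition stirling (N : nat) (a : C) : C :=
  ((shift N a - 1 / 2) * log_shift N a - shift N a - csum (fun n => log_shift n a) N
    + RtoC (ln (sqrt (2 * PI))))%C.

Definition stirling' (N : nat) (a : C) : C :=
  (log_shift N a + (shift N a - 1 / 2) / shift N a - 1 - csum (fun n => / shift n a) N)%C.

Lemma stirling_step N a :
  (stirling (S N) a - stirling N a =
    (shift N a + 1 / 2) * (Clog_right (1 + shift N a) - Clog_right (shift N a)) - 1)%C.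
Proof.
  unfold stirling. simpl csum. unfold log_shift. rewrite shift_S. Cfield.
Qed.

Lemma cderiv_csum (f f' : nat -> C -> C) z N :
  (forall n, (n < N)%nat -> cderiv (f n) z (f' n z)) ->
  cderiv (fun w => csum (fun n => f n w) N) z (csum (fun n => f' n z) N).
Proof.
  induction N as [| N IH]; intros H; simpl.
  - apply cderiv_const.
  - apply cderiv_plus; [apply IH; auto with arith | apply H; auto].
Qed.

Lemma ccont_csum (f : nat -> C -> C) z N :
  (forall n, (n < N)%nat -> ccont (f n) z) -> ccont (fun w => csum (fun n => f n w) N) z.
Proof.
  induction N as [| N IH]; intros H; simpl.
  - apply continuous_Cconst.
  - apply continuous_Cplus; [apply IH; auto with arith | apply H; auto].
Qed.

Lemma cderiv_shift_n n z : cderiv (shift n) z 1.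
Proof. eapply cderiv_eq; [apply cderiv_plus; [apply cderiv_const | apply cderiv_id] | Cring]. Qed.

Lemma cderiv_log_shift n a : 0 < Re a -> cderiv (log_shift n) a (/ shift n a)%C.
Proof.
  intros H. eapply cderiv_eq.
  - apply cderiv_Clog_comp; [apply cderiv_shift_n | apply Re_shift_pos, H].
  - Cfield. apply shift_neq_0, H.
Qed.

Lemma cderiv_stirling N a : 0 < Re a -> cderiv (stirling N) a (stirling' N a).
Proof.
  intros H. unfold stirling. eapply cderiv_eq.
  - apply cderiv_plus; [| apply cderiv_const]. apply cderiv_minus.
    + apply cderiv_minus; [| apply cderiv_shift_n].
      apply cderiv_mult; [| apply cderiv_log_shift, H].
      apply cderiv_minus; [apply cderiv_shift_n | apply cderiv_const].
    + apply (cderiv_csum log_shift (fun n z => / shift n z)%C).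
      intros n _. apply cderiv_log_shift, H.
  - unfold stirling'. Cfield. apply shift_neq_0, H.
Qed.

Lemma ccont_inv_shift n a : 0 < Re a -> ccont (fun z => / shift n z)%C a.
Proof.
  intros H. apply continuous_Cinv; [eapply cderiv_cont, cderiv_shift_n | apply shift_neq_0, H].
Qed.

Lemma ccont_stirling' N a : 0 < Re a -> ccont (stirling' N) a.
Proof.
  intros H. unfold stirling'.
  pose proof (cderiv_cont _ _ _ (cderiv_shift_n N a)) as Cs.
  pose proof (cderiv_cont _ _ _ (cderiv_log_shift N a H)) as Cl.
  pose proof (ccont_inv_shift N a H) as Cin.
  pose proof (ccont_csum (fun n z => / shift n z)%C a N (fun n _ => ccont_inv_shift n a H)) as Csum.
  apply continuous_Cminus; [| exact Csum].
  apply continuous_Cminus; [apply continuous_Cplus; [exact Cl | apply continuous_Cmult] |]; Ccont.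
Qed.

(** A majorant common to both limits: the steps of [stirling] are of order [N^(-2)], but those of
    [hurwitz_em] on [Re s >= - 1/2] only of order [N^(-3/2)]. *)
Definition three_halves (m : R) (n : nat) : R := / ((INR n + m) * sqrt (INR n + m)).

Lemma three_halves_pos m n : 0 < m -> 0 < three_halves m n.
Proof.
  intros H. apply Rinv_0_lt_compat. pose proof (pos_INR n).
  apply Rmult_lt_0_compat; [lra | apply sqrt_lt_R0; lra].
Qed.

(** Comparison with a telescoping series: for [u = sqrt x] and [w = sqrt (x + 1)] one has
    [1 / u - 1 / w = 1 / (u w (u + w))] and [u (u + w) <= 2 w^2]. The step from [x] to [x + 1]
    majorises the term at [x + 1], hence the shift of the index by one. *)
Lemma ex_series_three_halves m : 0 < m -> ex_series (three_halves m).
Proof.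
  intros Hm. apply (ex_series_incr_n _ 1).
  set (v := fun n => 2 * (/ sqrt (INR n + m) - / sqrt (INR (S n) + m))).
  apply (ex_series_le (K := R_AbsRing) (V := R_CompleteNormedModule) _ v).
  - intros n. change (Rabs (three_halves m (1 + n)) <= v n).
    rewrite Rabs_pos_eq by (left; apply three_halves_pos, Hm).
    unfold three_halves, v. change (1 + n)%nat with (S n). rewrite S_INR.
    pose proof (pos_INR n). set (x := INR n + m). assert (Px : 0 < x) by (unfold x; lra).
    replace (INR n + 1 + m) with (x + 1) by (unfold x; Cring).
    set (u := sqrt x). set (w := sqrt (x + 1)).
    assert (Pu : 0 < u) by (apply sqrt_lt_R0; lra). assert (Pw : 0 < w) by (apply sqrt_lt_R0; lra).
    assert (U2 : u * u = x) by (apply sqrt_sqrt; lra).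
    assert (W2 : w * w = x + 1) by (apply sqrt_sqrt; lra).
    assert (Luw : u <= w) by (apply sqrt_le_1; lra).
    replace (/ u - / w) with (/ (u * w * (u + w))).
    2:{ assert (E : (w - u) * (u + w) = 1) by nra.
        apply Rmult_eq_reg_r with (u * w * (u + w)); [| nra].
        rewrite Rinv_l by nra. rewrite <- E at 1. Cfield. split; lra. }
    apply Rle_trans with (2 * / (2 * ((x + 1) * w))).
    + right. Cfield. split; lra.
    + apply Rmult_le_compat_l; [lra |]. apply Rinv_le_contravar.
      * apply Rmult_lt_0_compat; [nra | lra].
      * assert (u * (u + w) <= 2 * (w * w)) by nra. nra.
  - apply ex_series_scal_l with (c := 2) (a := fun n => / sqrt (INR n + m) - / sqrt (INR (S n) + m)).
    exists (/ sqrt (INR 0 + m)).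
    assert (E : forall n, sum_n (fun n => / sqrt (INR n + m) - / sqrt (INR (S n) + m)) n =
      / sqrt (INR 0 + m) - / sqrt (INR (S n) + m)).
    { induction n as [| n IH]; [rewrite sum_O; reflexivity |].
      rewrite sum_Sn, IH. unfold plus; simpl plus. cbv [AbelianMonoid.plus]. simpl. Cring. }
    change (is_lim_seq (sum_n (fun n => / sqrt (INR n + m) - / sqrt (INR (S n) + m)))
      (Finite (/ sqrt (INR 0 + m)))).
    apply (is_lim_seq_ext (fun n => / sqrt (INR 0 + m) - / sqrt (INR (S n) + m))); [intros; symmetry; apply E |].
    replace (Finite (/ sqrt (INR 0 + m))) with (Finite (/ sqrt (INR 0 + m) - 0)) by (f_equal; Cring).
    apply is_lim_seq_minus'; [apply is_lim_seq_const |].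
    apply (is_lim_seq_incr_1 (fun n => / sqrt (INR n + m))).
    replace (Finite 0) with (Rbar_inv p_infty) by reflexivity.
    apply is_lim_seq_inv; [| discriminate].
    apply (filterlim_comp _ _ _ (fun n => INR n + m) sqrt _ (Rbar_locally p_infty)); [| exact filterlim_sqrt_p].
    apply (is_lim_seq_plus INR (fun _ => m) p_infty m p_infty);
      [apply is_lim_seq_INR | apply is_lim_seq_const | reflexivity].
Qed.

Lemma inv_sqr_le_three_halves m n : 0 < m ->
  / ((INR n + m) * (INR n + m)) <= / sqrt m * three_halves m n.
Proof.
  intros Hm. unfold three_halves. pose proof (pos_INR n). set (x := INR n + m).
  assert (Hx : m <= x) by (unfold x; lra).
  assert (Pu : 0 < sqrt m) by (apply sqrt_lt_R0; lra).
  assert (Pw : 0 < sqrt x) by (apply sqrt_lt_R0; lra).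
  assert (L : sqrt m <= sqrt x) by (apply sqrt_le_1; lra).
  rewrite <- Rinv_mult. apply Rinv_le_contravar; [repeat apply Rmult_lt_0_compat; lra |].
  assert (E : sqrt x * sqrt x = x) by (apply sqrt_sqrt; lra).
  assert (sqrt m * sqrt x <= x) by nra. nra.
Qed.

Lemma stirling_step_le N a m : 0 < m -> m <= Re a ->
  Cmod (stirling (S N) a - stirling N a) <= / sqrt m * three_halves m N.
Proof.
  intros Pm Hm. rewrite stirling_step. pose proof (pos_INR N).
  eapply Rle_trans; [| apply inv_sqr_le_three_halves, Pm].
  apply log_trapezoid_le; [lra |]. rewrite Re_shift_n. lra.
Qed.

Definition log_Gamma_lim (a : C) : C := clim_of (fun N => stirling N a).

Lemma ex_series_stirling m : 0 < m -> ex_series (fun n => / sqrt m * three_halves m n).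
Proof.
  intros Hm. apply (ex_series_scal_l (/ sqrt m) (three_halves m)), ex_series_three_halves, Hm.
Qed.

Lemma clim_stirling a : 0 < Re a -> clim (fun N => stirling N a) (log_Gamma_lim a).
Proof.
  intros H.
  destruct (clim_summable_steps (fun N => stirling N a) _ (ex_series_stirling (Re a) H)) as [l [L _]].
  - intros n. apply stirling_step_le; lra.
  - unfold log_Gamma_lim. rewrite (clim_of_correct _ _ L). exact L.
Qed.

Lemma log_Gamma_lim_analytic a : 0 < Re a ->
  analytic_at log_Gamma_lim a /\
  exists l, cderiv log_Gamma_lim a l /\ clim (fun N => stirling' N a) l.
Proof.
  intros H. set (m := Re a / 2). assert (Hm : 0 < m) by (unfold m; lra).
  assert (Hd : forall z, Cdisc a m z -> m < Re z).
  { intros z Hz. apply Re_near in Hz. unfold m in *. lra. }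
  destruct (weierstrass stirling log_Gamma_lim _ a m Hm (ex_series_stirling m Hm)) as [A [l [L1 L2]]].
  - intros N. exists (stirling' N). intros z Hz. apply Hd in Hz.
    split; [apply cderiv_stirling | apply ccont_stirling']; lra.
  - intros N z Hz. apply Hd in Hz. apply stirling_step_le; lra.
  - intros z Hz. apply Hd in Hz. apply clim_stirling. lra.
  - split; [exact A |]. exists l. split; [exact L1 |]. apply L2. intros n. apply cderiv_stirling, H.
Qed.

(** * The Hurwitz zeta function near [s = 0] *)

(** Partial sums of the zeta series, completed by the first two Euler-Maclaurin terms. *)
Definition hurwitz_em (a : C) (N : nat) (s : C) : C :=
  (csum (fun n => Cexp (- s * log_shift n a)) N + 1 / 2 * Cexp (- s * log_shift N a)
    + Cexp ((1 - s) * log_shift N a) * / (s - 1))%C.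

Definition hurwitz_em' (a : C) (N : nat) (s : C) : C :=
  (csum (fun n => Cexp (- s * log_shift n a) * - log_shift n a) N
    + 1 / 2 * (Cexp (- s * log_shift N a) * - log_shift N a)
    + (Cexp ((1 - s) * log_shift N a) * - log_shift N a * / (s - 1)
       - Cexp ((1 - s) * log_shift N a) * / ((s - 1) * (s - 1))))%C.

Lemma cderiv_Cexp_lin c d s : cderiv (fun s => Cexp ((c - s) * d))%C s (Cexp ((c - s) * d) * - d)%C.
Proof.
  eapply cderiv_eq; [apply cderiv_Cexp_comp, cderiv_mult; [apply cderiv_minus; [apply cderiv_const | apply cderiv_id] | apply cderiv_const] |].
  Cring.
Qed.

Lemma cderiv_Cexp_opp d s : cderiv (fun s => Cexp (- s * d))%C s (Cexp (- s * d) * - d)%C.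
Proof.
  apply (cderiv_ext (fun s => Cexp ((0 - s) * d))%C).
  - intros w. f_equal. Cring.
  - eapply cderiv_eq; [apply cderiv_Cexp_lin |]. do 2 f_equal. Cring.
Qed.

Lemma cderiv_hurwitz_em a N s : s <> RtoC 1 -> cderiv (hurwitz_em a N) s (hurwitz_em' a N s).
Proof.
  intros Hs. assert (Ns : (s - 1)%C <> RtoC 0) by (apply Cminus_eq_contra, Hs).
  unfold hurwitz_em. eapply cderiv_eq.
  - apply cderiv_plus; [apply cderiv_plus |].
    + apply (cderiv_csum (fun n s => Cexp (- s * log_shift n a))%C
        (fun n s => Cexp (- s * log_shift n a) * - log_shift n a)%C).
      intros n _. apply cderiv_Cexp_opp.
    + apply cderiv_scal, cderiv_Cexp_opp.
    + apply cderiv_mult; [apply cderiv_Cexp_lin |].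
      apply cderiv_inv; [| exact Ns]. apply cderiv_minus; [apply cderiv_id | apply cderiv_const].
  - unfold hurwitz_em'. Cfield. exact Ns.
Qed.

Lemma ccont_hurwitz_em' a N s : s <> RtoC 1 -> ccont (hurwitz_em' a N) s.
Proof.
  intros Hs. assert (Ns : (s - 1)%C <> RtoC 0) by (apply Cminus_eq_contra, Hs).
  assert (C1 : ccont (fun s => Cexp ((1 - s) * log_shift N a))%C s)
    by (eapply cderiv_cont, cderiv_Cexp_lin).
  assert (C2 : forall n, ccont (fun s => Cexp (- s * log_shift n a))%C s)
    by (intros n; eapply cderiv_cont, cderiv_Cexp_opp).
  unfold hurwitz_em'.
  pose proof (Cmult_neq_0 _ _ Ns Ns).
  apply continuous_Cplus; [| Ccont]. apply continuous_Cplus; [| Ccont].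
  apply (ccont_csum (fun n s => Cexp (- s * log_shift n a) * - log_shift n a)%C).
  intros n _. Ccont.
Qed.

(** The argument is at most [PI / 2 <= 2] in modulus, so a power [w^u] has the size of [Cmod w] to
    the [Re u], up to a factor [exp (2 * Cmod u)]. *)
Lemma Re_mult_Clog_right (u w : C) :
  Re (u * Clog_right w) <= Re u * ln (Cmod w) + 2 * Cmod u.
Proof.
  unfold Clog_right. rewrite re_mult. unfold Re at 2, Im at 2. simpl.
  pose proof (atan_bound (Im w / Re w)). pose proof PI_4.
  pose proof (Cmod_Im u) as HI.
  set (t := atan (Im w / Re w)) in *.
  assert (Rabs t <= 2) by (apply Rabs_le; lra).
  assert (- (Im u * t) <= Cmod u * 2).
  { pose proof (Rle_abs (- (Im u * t))). rewrite Rabs_Ropp, Rabs_mult in H2.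
    pose proof (Rabs_pos (Im u)). pose proof (Rabs_pos t).
    assert (Rabs (Im u) * Rabs t <= Cmod u * 2) by (apply Rmult_le_compat; lra). lra. }
  change (snd u) with (Im u). lra.
Qed.

Lemma exp_half_ln x : 0 < x -> exp (1 / 2 * ln x) = sqrt x.
Proof.
  intros H.
  replace (1 / 2 * ln x) with (ln (sqrt x)); [apply exp_ln, sqrt_lt_R0, H |].
  rewrite <- (sqrt_sqrt x) at 2 by lra. rewrite ln_mult by (apply sqrt_lt_R0, H). lra.
Qed.

(** Besides [sqrt (Cmod w)] there is a factor [Cmod w] to the power [- (Re s + 1/2) <= 0], which is
    largest at [Cmod w = m]; this is the origin of [Rabs (ln m)]. *)
Lemma Cexp_opp_Clog_le (s w : C) (B m : R) :
  0 < m -> m <= Cmod w -> Cmod s <= B -> - (1 / 2) <= Re s ->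
  Cmod (Cexp (- s * Clog_right w)) <= exp (2 * B + (B + 1) * Rabs (ln m)) * sqrt (Cmod w).
Proof.
  intros Hm Hw HB Hs. rewrite Cmod_Cexp.
  assert (Pw : 0 < Cmod w) by lra.
  rewrite <- (exp_half_ln (Cmod w)) by exact Pw. rewrite <- exp_plus. apply exp_le.
  eapply Rle_trans; [apply Re_mult_Clog_right |].
  rewrite Cmod_opp. replace (Re (- s)) with (- Re s) by (unfold Re; simpl; ring).
  pose proof (ln_le m (Cmod w) Hm Hw) as L.
  pose proof (Re_le_Cmod s).
  assert (- (Re s + 1 / 2) * ln (Cmod w) <= (B + 1) * Rabs (ln m)).
  { apply Rle_trans with (- (Re s + 1 / 2) * ln m); [nra |].
    pose proof (Rle_abs (- ln m)). rewrite Rabs_Ropp in H0. pose proof (Rabs_pos (ln m)). nra. }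
  lra.
Qed.

(** The step is minus the trapezoid error of [x^(- s)] between [N + a] and [N + 1 + a]. The second
    derivative [s (s + 1) x^(- s - 2)] is bounded by [Cexp_opp_Clog_le]. *)
Lemma hurwitz_em_step_le a s N m B :
  0 < m -> m <= Re a -> Cmod s <= B -> - (1 / 2) <= Re s -> s <> RtoC 1 ->
  Cmod (hurwitz_em a (S N) s - hurwitz_em a N s) <=
    B * (B + 1) * exp (2 * B + (B + 1) * Rabs (ln m)) * three_halves m N.
Proof.
  intros Hm Ha HB Hs H1.
  assert (Ns : (1 - s)%C <> RtoC 0) by (apply Cminus_eq_contra; congruence).
  assert (Ns' : (s - 1)%C <> RtoC 0) by (apply Cminus_eq_contra; congruence).
  set (w := shift N a).
  pose proof (pos_INR N) as PN.
  assert (Rw : forall t, 0 <= t <= 1 -> INR N + m <= Re (RtoC t + w)).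
  { intros t Ht. rewrite Re_shift. unfold w. rewrite Re_shift_n. lra. }
  assert (P : forall t, 0 <= t <= 1 -> 0 < Re (RtoC t + w)) by (intros t Ht; pose proof (Rw t Ht); lra).
  assert (NZ : forall t, 0 <= t <= 1 -> (RtoC t + w)%C <> RtoC 0)
    by (intros t Ht; apply Re_pos_neq_0, P, Ht).
  set (K := exp (2 * B + (B + 1) * Rabs (ln m))).
  pose proof (trapezoid_le (fun x => Cexp ((1 - s) * Clog_right (x + w)) * / (1 - s))%C
    (fun x => Cexp (- s * Clog_right (x + w)))%C
    (fun x => - s * (Cexp (- s * Clog_right (x + w)) * / (x + w)))%C
    (fun x => s * (s + 1) * (Cexp (- s * Clog_right (x + w)) * / ((x + w) * (x + w))))%C
    (B * (B + 1) * K * three_halves m N)) as Q.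
  cbv beta in Q.
  replace (hurwitz_em a (S N) s - hurwitz_em a N s)%C with
    (- (Cexp ((1 - s) * Clog_right (1 + w)) * / (1 - s) - Cexp ((1 - s) * Clog_right (0 + w)) * / (1 - s) -
      (Cexp (- s * Clog_right (0 + w)) + Cexp (- s * Clog_right (1 + w))) / 2))%C.
  2:{ unfold hurwitz_em. simpl csum. unfold log_shift. rewrite shift_S. fold w. rewrite Cplus_0_l.
      field. split; assumption. }
  rewrite Cmod_opp. apply Q.
  - intros t Ht. eapply cderiv_eq.
    + apply cderiv_mult; [| apply cderiv_const].
      apply cderiv_Cexp_comp, cderiv_scal, cderiv_Clog_comp; [apply cderiv_shift | apply P, Ht].
    + cbv beta. replace ((1 - s) * Clog_right (RtoC t + w))%C
        with (Clog_right (RtoC t + w) + - s * Clog_right (RtoC t + w))%C by ring.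
      rewrite Cexp_plus, Cexp_Clog_right by apply P, Ht. Cfield. split; [exact Ns | apply NZ, Ht].
  - intros t Ht. eapply cderiv_eq.
    + apply cderiv_Cexp_comp, cderiv_scal, cderiv_Clog_comp; [apply cderiv_shift | apply P, Ht].
    + Cfield. apply NZ, Ht.
  - intros t Ht. eapply cderiv_eq.
    + apply cderiv_scal, cderiv_mult.
      * apply cderiv_Cexp_comp, cderiv_scal, cderiv_Clog_comp; [apply cderiv_shift | apply P, Ht].
      * apply cderiv_inv; [apply cderiv_shift | apply NZ, Ht].
    + Cfield. apply NZ, Ht.
  - intros t Ht. pose proof (NZ t Ht) as NZt. pose proof (Rw t Ht) as Rt.
    pose proof (Re_le_Cmod (RtoC t + w)) as RC.
    rewrite !Cmod_mult, Cmod_inv, Cmod_mult by (apply Cmult_neq_0; assumption).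
    set (x := Cmod (RtoC t + w)) in *.
    assert (E : Cmod (Cexp (- s * Clog_right (RtoC t + w))) <= K * sqrt x).
    { apply Cexp_opp_Clog_le; try assumption. fold x. lra. }
    assert (Px : 0 < x) by lra.
    assert (Psx : 0 < sqrt x) by (apply sqrt_lt_R0; lra).
    assert (S2 : sqrt x * sqrt x = x) by (apply sqrt_sqrt; lra).
    assert (E2 : sqrt x * / (x * x) <= three_halves m N).
    { unfold three_halves. replace (sqrt x * / (x * x)) with (/ (x * sqrt x)).
      - assert (sqrt (INR N + m) <= sqrt x) by (apply sqrt_le_1; lra).
        assert (0 < sqrt (INR N + m)) by (apply sqrt_lt_R0; lra).
        apply Rinv_le_contravar; [apply Rmult_lt_0_compat; lra |]. apply Rmult_le_compat; lra.
      - replace (x * x) with (x * (sqrt x * sqrt x)) by (rewrite S2; ring). field. lra. }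
    assert (E3 : Cmod (s + 1) <= B + 1).
    { eapply Rle_trans; [apply Cmod_triangle |]. rewrite Cmod_1. lra. }
    pose proof (Cmod_ge_0 s). pose proof (Cmod_ge_0 (s + 1)).
    assert (PK : 0 < K) by apply exp_pos.
    assert (Pi : 0 < / (x * x)) by (apply Rinv_0_lt_compat; nra).
    apply Rle_trans with (B * (B + 1) * (K * sqrt x * / (x * x))).
    + apply Rmult_le_compat.
      * apply Rmult_le_pos; assumption.
      * apply Rmult_le_pos; [apply Cmod_ge_0 | lra].
      * apply Rmult_le_compat; assumption.
      * apply Rmult_le_compat_r; [lra | exact E].
    + rewrite (Rmult_assoc (B * (B + 1))). apply Rmult_le_compat_l.
      * apply Rmult_le_pos; lra.
      * rewrite Rmult_assoc. apply Rmult_le_compat_l; lra.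
Qed.

Definition hurwitz_lim (a s : C) : C := clim_of (fun N => hurwitz_em a N s).

Lemma clim_hurwitz_em a s : 0 < Re a -> - (1 / 2) <= Re s -> s <> RtoC 1 ->
  clim (fun N => hurwitz_em a N s) (hurwitz_lim a s).
Proof.
  intros Ha Hs H1.
  destruct (clim_summable_steps (fun N => hurwitz_em a N s)
    (fun n => Cmod s * (Cmod s + 1) * exp (2 * Cmod s + (Cmod s + 1) * Rabs (ln (Re a))) * three_halves (Re a) n))
    as [l [L _]].
  - apply (ex_series_scal_l _ (three_halves (Re a))), ex_series_three_halves, Ha.
  - intros n. apply hurwitz_em_step_le; try assumption; lra.
  - unfold hurwitz_lim. rewrite (clim_of_correct _ _ L). exact L.
Qed.

Lemma hurwitz_lim_analytic a s : 0 < Re a -> 0 <= Re s -> s <> RtoC 1 ->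
  analytic_at (hurwitz_lim a) s /\
  exists l, cderiv (hurwitz_lim a) s l /\ clim (fun N => hurwitz_em' a N s) l.
Proof.
  intros Ha Hs H1.
  (* The disc stays in [Re z >= - 1/2], where the steps are summable, and misses the pole at [1]. *)
  set (r := Rmin (1 / 2) (Cmod (s - 1))).
  assert (Pr : 0 < r).
  { apply Rmin_pos; [lra |]. apply Cmod_gt_0, Cminus_eq_contra, H1. }
  assert (Hd : forall z, Cdisc s r z -> - (1 / 2) <= Re z /\ z <> RtoC 1 /\ Cmod z <= Cmod s + 1).
  { intros z Hz. unfold Cdisc in Hz.
    assert (L1 : r <= 1 / 2) by apply Rmin_l. assert (L2 : r <= Cmod (s - 1)) by apply Rmin_r.
    pose proof (Re_near _ _ _ Hz). split; [lra |]. split.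
    - intros ->. rewrite Cmod_sub_comm in Hz. lra.
    - pose proof (Cmod_ge_sub z s). lra. }
  set (B := Cmod s + 1) in *.
  destruct (weierstrass (hurwitz_em a) (hurwitz_lim a)
    (fun n => B * (B + 1) * exp (2 * B + (B + 1) * Rabs (ln (Re a))) * three_halves (Re a) n) s r Pr)
    as [A [l [L1 L2]]].
  - apply (ex_series_scal_l _ (three_halves (Re a))), ex_series_three_halves, Ha.
  - intros N. exists (hurwitz_em' a N). intros z Hz. destruct (Hd z Hz) as [_ [N1 _]].
    split; [apply cderiv_hurwitz_em, N1 | apply ccont_hurwitz_em', N1].
  - intros N z Hz. destruct (Hd z Hz) as [Z1 [Z2 Z3]]. apply hurwitz_em_step_le; try assumption; lra.
  - intros z Hz. destruct (Hd z Hz) as [Z1 [Z2 Z3]]. apply clim_hurwitz_em; assumption.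
  - split; [exact A |]. exists l. split; [exact L1 |]. apply L2. intros n. apply cderiv_hurwitz_em, H1.
Qed.

Lemma is_lim_seq_shift_p x : is_lim_seq (fun N => INR N + x) p_infty.
Proof.
  apply (is_lim_seq_plus INR (fun _ => x) p_infty x p_infty);
    [apply is_lim_seq_INR | apply is_lim_seq_const | reflexivity].
Qed.

Lemma clim_Cexp_log_shift_0 u a : 0 < Re a -> Re u < 0 ->
  clim (fun N => Cexp (u * log_shift N a)) 0.
Proof.
  intros Ha Hu.
  apply clim_le with (fun N => exp (2 * Cmod u) * exp (Re u * ln (INR N + Re a))).
  - intros N. replace (Cexp (u * log_shift N a) - 0)%C with (Cexp (u * log_shift N a)) by ring.
    rewrite Cmod_Cexp, <- exp_plus. apply exp_le.
    unfold log_shift. eapply Rle_trans; [apply Re_mult_Clog_right |].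
    pose proof (pos_INR N). pose proof (Re_le_Cmod (shift N a)) as L. rewrite Re_shift_n in L.
    pose proof (ln_le (INR N + Re a) _ ltac:(lra) L). nra.
  - apply is_lim_seq_scal0.
    assert (L : is_lim_seq (fun N => Re u * ln (INR N + Re a)) m_infty).
    { replace m_infty with (Rbar_mult (Re u) p_infty).
      - apply is_lim_seq_scal_l.
        apply (filterlim_comp _ _ _ (fun n => INR n + Re a) ln _ (Rbar_locally p_infty));
          [apply is_lim_seq_shift_p | exact is_lim_ln_p].
      - simpl. destruct (Rle_dec 0 (Re u)) as [h | h]; [exfalso; lra | reflexivity]. }
    apply (filterlim_comp _ _ _ (fun N => Re u * ln (INR N + Re a)) exp _ (Rbar_locally m_infty));
      [exact L | exact is_lim_exp_m].
Qed.

(** For [Re s > 1] both completing terms tend to [0], leaving the partial sums of the zeta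
    series. *)
Lemma hurwitz_lim_series a s l : 0 < Re a -> 1 < Re s ->
  clim (csum (fun n => Cexp (- s * Clog_right (RtoC (INR n) + a)))) l -> hurwitz_lim a s = l.
Proof.
  intros Ha Hs H.
  assert (H1 : s <> RtoC 1) by (intros ->; simpl in Hs; lra).
  apply (clim_unique (fun N => hurwitz_em a N s)).
  - apply clim_hurwitz_em; try assumption. lra.
  - replace l with (l + 1 / 2 * 0 + / (s - 1) * 0)%C by ring.
    apply (clim_ext (fun N => csum (fun n => Cexp (- s * log_shift n a)) N
      + 1 / 2 * Cexp (- s * log_shift N a) + / (s - 1) * Cexp ((1 - s) * log_shift N a))%C).
    { intros n. unfold hurwitz_em. ring. }
    apply clim_plus; [apply clim_plus; [exact H |] |]; apply clim_scal, clim_Cexp_log_shift_0; try assumption.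
    + replace (Re (- s)) with (- Re s) by (unfold Re; simpl; ring). lra.
    + replace (Re (1 - s)) with (1 - Re s) by (unfold Re; simpl; ring). lra.
Qed.

(** At [s = 0] the terms of the sum count to [N], which the completing terms [1/2] and [- (N + a)]
    cancel: the sequence is constant. *)
Lemma hurwitz_em_at_0 a N : 0 < Re a -> hurwitz_em a N 0 = (1 / 2 - a)%C.
Proof.
  intros Ha. unfold hurwitz_em.
  assert (E : forall n, Cexp (- 0 * log_shift n a) = RtoC 1).
  { intros n. replace (- 0 * log_shift n a)%C with (RtoC 0) by ring. apply Cexp_0. }
  rewrite E. replace ((1 - 0) * log_shift N a)%C with (log_shift N a) by ring.
  unfold log_shift at 2. rewrite Cexp_Clog_right by apply Re_shift_pos, Ha.
  assert (S : csum (fun n => Cexp (- 0 * log_shift n a)) N = RtoC (INR N)).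
  { induction N as [| N IH]; [reflexivity |]. simpl csum. rewrite IH, E, S_INR, RtoC_plus. reflexivity. }
  rewrite S. unfold shift. field.
Qed.

Lemma hurwitz_em'_at_0 a N : 0 < Re a ->
  hurwitz_em' a N 0 = (stirling N a - RtoC (ln (sqrt (2 * PI))))%C.
Proof.
  intros Ha. unfold hurwitz_em', stirling.
  assert (E : forall n, Cexp (- 0 * log_shift n a) = RtoC 1).
  { intros n. replace (- 0 * log_shift n a)%C with (RtoC 0) by ring. apply Cexp_0. }
  rewrite E. replace ((1 - 0) * log_shift N a)%C with (log_shift N a) by ring.
  replace (Cexp (log_shift N a)) with (shift N a)
    by (unfold log_shift; rewrite Cexp_Clog_right by apply Re_shift_pos, Ha; reflexivity).
  assert (S : csum (fun n => Cexp (- 0 * log_shift n a) * - log_shift n a)%C N =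
    (- csum (fun n => log_shift n a) N)%C).
  { induction N as [| N IH]; simpl; [ring |]. rewrite IH, E. ring. }
  rewrite S. field.
Qed.

(** The segment from [2 + i] to [0] avoids the pole at [1]. *)
Theorem hurwitz_zeta_at_0 (zeta : C -> C -> C) (a : C) :
  is_hurwitz_zeta zeta -> 0 < Re a ->
  zeta (RtoC 0) a = (1 / 2 - a)%C /\
  C_derive (fun s => zeta s a) 0 = (log_Gamma_lim a - RtoC (ln (sqrt (2 * PI))))%C.
Proof.
  intros Hz Ha. destruct (Hz a Ha) as [Hs Han].
  assert (Ne : forall t, 0 <= t <= 1 -> 0 <= Re ((2 + Ci) + RtoC t * (0 - (2 + Ci))) /\
    ((2 + Ci) + RtoC t * (0 - (2 + Ci)))%C <> RtoC 1).
  { intros t Ht. split; [unfold Re; simpl; lra |].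
    intros Q. pose proof (f_equal Re Q) as Q1. pose proof (f_equal Im Q) as Q2.
    unfold Re, Im in Q1, Q2. simpl in Q1, Q2. lra. }
  destruct (identity_segment (fun s => zeta s a - hurwitz_lim a s)%C (2 + Ci)%C 0) as [d [Hd Z]].
  - intros t Ht. destruct (Ne t Ht) as [N1 N2].
    apply analytic_at_minus; [apply Han, N2 |]. apply hurwitz_lim_analytic; assumption.
  - exists 1. split; [lra |]. intros z Hz1. apply Re_near in Hz1.
    assert (Re (2 + Ci) = 2) by (unfold Re; simpl; ring).
    rewrite (hurwitz_lim_series a z (zeta z a)); [ring | exact Ha | lra |].
    apply is_series_clim, Hs. lra.
  - assert (Eq : forall z, Cmod (z - 0) < d -> hurwitz_lim a z = zeta z a).
    { intros z Hz1. symmetry. apply Ceq_minus. apply Z, Hz1. }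
    assert (N0 : RtoC 0 <> RtoC 1) by (intros Q; apply RtoC_inj in Q; lra).
    split.
    + rewrite <- Eq.
      * apply (clim_unique (fun N => hurwitz_em a N 0)).
        -- apply clim_hurwitz_em; [exact Ha | simpl; lra | exact N0].
        -- apply (clim_ext (fun _ => (1 / 2 - a)%C)); [| apply clim_const].
           intros n. symmetry. apply hurwitz_em_at_0, Ha.
      * rewrite Cmod_sub_diag. exact Hd.
    + apply cderiv_C_derive.
      apply (cderiv_ext_loc (hurwitz_lim a) _ _ _ d Hd Eq).
      destruct (hurwitz_lim_analytic a 0 Ha) as [_ [l [L1 L2]]]; [simpl; lra | exact N0 |].
      replace (log_Gamma_lim a - RtoC (ln (sqrt (2 * PI))))%C with l; [exact L1 |].
      apply (clim_unique _ _ _ L2).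
      apply (clim_ext (fun N => stirling N a - RtoC (ln (sqrt (2 * PI))))%C).
      * intros n. symmetry. apply hurwitz_em'_at_0, Ha.
      * apply clim_minus; [apply clim_stirling, Ha | apply clim_const].
Qed.

(** * Wallis's product and Stirling's constant *)

Lemma is_RInt_primitive (F f : R -> R) a b l :
  (forall x, is_derive F x (f x)) -> (forall x, continuous f x) -> F b - F a = l ->
  is_RInt f a b l.
Proof.
  intros H1 H2 <-.
  apply (@is_RInt_derive R_CompleteNormedModule F f); intros x _; [apply H1 | apply H2].
Qed.

Definition wallis (n : nat) : R := RInt (fun x => sin x ^ n) 0 (PI / 2).

Lemma continuous_sin_pow n x : continuous (fun x => sin x ^ n) x.
Proof.
  apply (@ex_derive_continuous R_AbsRing R_NormedModule).
  auto_derive; auto.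
Qed.

Lemma ex_RInt_sin_pow n : ex_RInt (fun x => sin x ^ n) 0 (PI / 2).
Proof. apply (@ex_RInt_continuous R_CompleteNormedModule). intros; apply continuous_sin_pow. Qed.

Lemma wallis_0 : wallis 0 = PI / 2.
Proof.
  unfold wallis. simpl. rewrite RInt_const. unfold scal; simpl; unfold mult; simpl. lra.
Qed.

Lemma wallis_1 : wallis 1 = 1.
Proof.
  unfold wallis. apply is_RInt_unique.
  apply (is_RInt_primitive (fun x => - cos x)).
  - intros x. auto_derive; auto; ring.
  - intros x. apply continuous_sin_pow.
  - rewrite cos_PI2, cos_0. ring.
Qed.

Lemma wallis_SS n : (INR n + 2) * wallis (S (S n)) = (INR n + 1) * wallis n.
Proof.
  assert (H : is_RInt (fun x => (INR n + 2) * sin x ^ S (S n) - (INR n + 1) * sin x ^ n) 0 (PI / 2) 0).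
  { apply (is_RInt_primitive (fun x => - cos x * sin x ^ S n)).
    - intros x. auto_derive; auto.
      replace (match n with 0%nat => 1 | S _ => INR n + 1 end) with (INR n + 1) by (destruct n; simpl; ring).
      pose proof (sin2_cos2 x) as Q. unfold Rsqr in Q.
      assert (C : cos x * cos x = 1 - sin x * sin x) by lra.
      simpl. ring_simplify. replace (cos x ^ 2) with (1 - sin x * sin x) by (rewrite <- C; ring). ring.
    - intros x. apply (@ex_derive_continuous R_AbsRing R_NormedModule). auto_derive; auto.
    - rewrite cos_PI2, sin_0. simpl. ring. }
  pose proof (is_RInt_minus _ _ _ _ _ _
    (is_RInt_scal _ _ _ (INR n + 2) _ (RInt_correct _ _ _ (ex_RInt_sin_pow (S (S n)))))
    (is_RInt_scal _ _ _ (INR n + 1) _ (RInt_correct _ _ _ (ex_RInt_sin_pow n)))) as H2.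
  pose proof (is_RInt_unique _ _ _ _ H) as E1.
  pose proof (is_RInt_unique _ _ _ _ H2) as E2.
  change (RInt (fun x => (INR n + 2) * sin x ^ S (S n) - (INR n + 1) * sin x ^ n) 0 (PI / 2) =
    (INR n + 2) * wallis (S (S n)) - (INR n + 1) * wallis n) in E2.
  lra.
Qed.

Lemma wallis_pos n : 0 < wallis n.
Proof.
  pose proof PI_RGT_0. apply RInt_gt_0; [lra | |].
  - intros x Hx. apply pow_lt, sin_gt_0; lra.
  - intros x Hx. apply continuous_sin_pow.
Qed.

Lemma wallis_decr n : wallis (S n) <= wallis n.
Proof.
  pose proof PI_RGT_0. apply RInt_le; [lra | apply ex_RInt_sin_pow | apply ex_RInt_sin_pow |].
  intros x Hx. simpl. pose proof (SIN_bound x). assert (0 <= sin x) by (apply sin_ge_0; lra).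
  assert (0 <= sin x ^ n) by (apply pow_le; assumption). nra.
Qed.

(** By [wallis_SS] the left-hand side is the same for all [n]. *)
Lemma wallis_mul n : (INR n + 1) * (wallis n * wallis (S n)) = PI / 2.
Proof.
  induction n as [| n IH].
  - rewrite wallis_0, wallis_1. simpl. ring.
  - pose proof (wallis_SS n). rewrite S_INR. rewrite <- IH.
    transitivity (wallis (S n) * ((INR n + 2) * wallis (S (S n)))); [ring | rewrite H; ring].
Qed.

Lemma wallis_even N :
  wallis (2 * N) * (2 * 4 ^ N * (INR (fact N) * INR (fact N))) = PI * INR (fact (2 * N)).
Proof.
  induction N as [| N IH].
  - simpl. rewrite wallis_0. field.
  - replace (2 * S N)%nat with (S (S (2 * N))) by lia.
    pose proof (wallis_SS (2 * N)) as W. rewrite mult_INR in W. simpl (INR 2) in W.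
    change (fact (S (S (2 * N)))) with (S (S (2 * N)) * (S (2 * N) * fact (2 * N)))%nat.
    change (fact (S N)) with (S N * fact N)%nat.
    rewrite !mult_INR, !S_INR, mult_INR. simpl (INR 2).
    set (n := INR N) in *. set (f := INR (fact N)) in *. set (g := INR (fact (2 * N))) in *.
    assert (W2 : wallis (S (S (2 * N))) * (2 * (n + 1)) = (2 * n + 1) * wallis (2 * N)) by lra.
    replace (4 ^ S N) with (4 * 4 ^ N) by reflexivity.
    replace (wallis (S (S (2 * N))) * (2 * (4 * 4 ^ N) * ((n + 1) * f * ((n + 1) * f))))
      with (wallis (S (S (2 * N))) * (2 * (n + 1)) * (2 * (n + 1)) * (2 * 4 ^ N * (f * f))) by ring.
    rewrite W2.
    replace ((2 * n + 1) * wallis (2 * N) * (2 * (n + 1)) * (2 * 4 ^ N * (f * f)))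
      with ((2 * n + 1) * (2 * (n + 1)) * (wallis (2 * N) * (2 * 4 ^ N * (f * f)))) by ring.
    rewrite IH. ring.
Qed.

(** Monotonicity and [wallis_mul], taken at [2 N - 1] and at [2 N], squeeze the square of
    [wallis (2 * N)] between [PI / (2 (2 N + 1))] and [PI / (4 N)]. The factorials come from
    [wallis_even], and the gap [/ INR N] from the logarithm of [1 + 1 / (2 N)]. *)
Lemma ln_wallis N : (1 <= N)%nat ->
  ln PI <= 4 * ln (INR (fact N)) + 4 * INR N * ln 2 - 2 * ln (INR (fact (2 * N))) - ln (INR N)
    <= ln PI + / INR N.
Proof.
  intros HN. assert (PN : 1 <= INR N) by (apply (le_INR 1); exact HN).
  pose proof PI_RGT_0 as HPI.
  pose proof (wallis_pos (2 * N)) as PW.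
  assert (PF : forall n, 0 < INR (fact n)) by (intros; apply INR_fact_lt_0).
  pose proof (f_equal ln (wallis_even N)) as E.
  rewrite !ln_mult in E; try assumption; try (repeat apply Rmult_lt_0_compat; try apply pow_lt; try apply PF; lra).
  rewrite ln_pow in E by lra.
  replace (ln 4) with (2 * ln 2) in E
    by (replace 4 with (2 * 2) by ring; rewrite ln_mult by lra; ring).
  set (I := wallis (2 * N)) in *.
  assert (U : I * I <= PI / (4 * INR N)).
  { destruct N as [| M]; [lia |].
    pose proof (wallis_mul (S (2 * M))) as W. pose proof (wallis_decr (S (2 * M))) as D.
    assert (EI : I = wallis (S (S (2 * M)))) by (unfold I; f_equal; lia).
    rewrite <- EI in W, D. set (v := wallis (S (2 * M))) in *.
    rewrite S_INR, mult_INR in W. simpl (INR 2) in W. rewrite S_INR in PN |- *.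
    clearbody v. clear EI E. clearbody I. apply (Rle_div_r (I * I)); [lra |].
    assert (I * I <= v * I) by (apply Rmult_le_compat_r; lra).
    apply Rle_trans with (v * I * (4 * (INR M + 1))); [apply Rmult_le_compat_r; lra | lra]. }
  assert (L : PI / (2 * (2 * INR N + 1)) <= I * I).
  { pose proof (wallis_mul (2 * N)) as W. pose proof (wallis_decr (2 * N)) as D.
    fold I in W, D. rewrite mult_INR in W. simpl (INR 2) in W. set (v := wallis (S (2 * N))) in *.
    clearbody v. clear E. clearbody I. apply (Rle_div_l PI); [lra |].
    assert (I * v <= I * I) by (apply Rmult_le_compat_l; lra).
    apply Rle_trans with (I * v * (2 * (2 * INR N + 1))); [lra | apply Rmult_le_compat_r; lra]. }
  apply ln_le in U; [| nra]. apply ln_le in L; [| apply Rdiv_lt_0_compat; lra].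
  rewrite ln_mult in U, L by lra.
  rewrite ln_div in U, L by lra. rewrite !ln_mult in U by lra. rewrite !ln_mult in L by lra.
  replace (ln 4) with (2 * ln 2) in U
    by (replace 4 with (2 * 2) by ring; rewrite ln_mult by lra; ring).
  assert (L3 : ln (2 * INR N + 1) <= ln 2 + ln (INR N) + / INR N).
  { replace (2 * INR N + 1) with (2 * INR N * (1 + / (2 * INR N))) by (field; lra).
    assert (P : 0 < / (2 * INR N)) by (apply Rinv_0_lt_compat; lra).
    rewrite !ln_mult by lra.
    assert (ln (1 + / (2 * INR N)) <= / (2 * INR N)).
    { rewrite <- (ln_exp (/ (2 * INR N))) at 2. apply ln_le; [lra |]. apply exp_ineq1_le. }
    rewrite Rinv_mult in H, P. assert (0 < / INR N) by (apply Rinv_0_lt_compat; lra). 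
    rewrite Rinv_mult. lra. }
  split; lra.
Qed.

(** Logarithm of [M! / (M^(M + 1/2) e^(- M))], whose limit is Stirling's constant. *)
Definition stirling_defect (M : nat) : R := ln (INR (fact M)) - (INR M + 1 / 2) * ln (INR M) + INR M.

Fixpoint rsum (f : nat -> R) (n : nat) : R :=
  match n with O => 0 | S k => rsum f k + f k end.

Lemma csum_rsum (f : nat -> R) N : csum (fun n => RtoC (f n)) N = RtoC (rsum f N).
Proof. induction N as [| N IH]; simpl; [reflexivity |]. rewrite IH, RtoC_plus. reflexivity. Qed.

Lemma log_shift_real n x : 0 < x -> log_shift n (RtoC x) = RtoC (ln (INR n + x)).
Proof.
  intros H. unfold log_shift, shift. rewrite <- RtoC_plus.
  apply Clog_right_RtoC. pose proof (pos_INR n). lra.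
Qed.

Lemma stirling_real N x : 0 < x ->
  stirling N (RtoC x) = RtoC ((INR N + x - 1 / 2) * ln (INR N + x) - (INR N + x)
    - rsum (fun n => ln (INR n + x)) N + ln (sqrt (2 * PI))).
Proof.
  intros H. unfold stirling. rewrite log_shift_real by exact H.
  rewrite (csum_ext _ (fun n => RtoC (ln (INR n + x)))) by (intros; apply log_shift_real, H).
  rewrite csum_rsum. unfold shift. 
  rewrite RtoC_plus, !RtoC_minus, RtoC_mult, RtoC_minus, RtoC_plus, RtoC_div by lra. reflexivity.
Qed.

Lemma stirling_defect_spec N : stirling N 1 = RtoC (ln (sqrt (2 * PI)) - stirling_defect (S N)).
Proof.
  rewrite stirling_real by lra. f_equal.
  assert (E : rsum (fun n => ln (INR n + 1)) N = ln (INR (fact N))).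
  { induction N as [| N IH]; [simpl; rewrite ln_1; reflexivity |].
    simpl rsum. rewrite IH. change (fact (S N)) with (S N * fact N)%nat.
    rewrite mult_INR, ln_mult, S_INR; [ring | apply lt_0_INR; lia | apply INR_fact_lt_0]. }
  rewrite E. unfold stirling_defect. change (fact (S N)) with (S N * fact N)%nat.
  rewrite mult_INR, ln_mult, !S_INR; [field | apply lt_0_INR; lia | apply INR_fact_lt_0].
Qed.

Lemma is_lim_seq_inv_INR : is_lim_seq (fun n => / INR n) 0.
Proof.
  replace (Finite 0) with (Rbar_inv p_infty) by reflexivity.
  apply is_lim_seq_inv; [apply is_lim_seq_INR | discriminate].
Qed.

(** The defects converge because [stirling N 1] does. For their limit [d], [ln_wallis] yields
    [4 d - 2 d - ln 2 = ln PI], so [d] is [ln (sqrt (2 * PI))] and cancels the constant built into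
    [stirling]. *)
Lemma log_Gamma_lim_1 : log_Gamma_lim 1 = RtoC 0.
Proof.
  pose proof PI_RGT_0 as HPI.
  assert (H : 0 < Re 1) by (simpl; lra).
  pose proof (clim_stirling 1 H) as L. set (l := log_Gamma_lim 1) in *.
  assert (L1 : clim (fun N => RtoC (ln (sqrt (2 * PI)) - stirling_defect (S N))) l).
  { eapply clim_ext; [| exact L]. apply stirling_defect_spec. }
  set (c := ln (sqrt (2 * PI))) in *.
  assert (Hc : 2 * c = ln 2 + ln PI).
  { unfold c. rewrite <- ln_mult by lra.
    rewrite <- (sqrt_sqrt (2 * PI)) at 2 by lra.
    rewrite ln_mult by (apply sqrt_lt_R0; lra). ring. }
  assert (Dl : is_lim_seq (fun N => stirling_defect (S N)) (c - Re l)).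
  { pose proof (clim_Re _ _ L1) as Q.
    apply (is_lim_seq_ext (fun n => c - Re (RtoC (c - stirling_defect (S n))))).
    - intros n. simpl. ring.
    - apply is_lim_seq_minus'; [apply is_lim_seq_const | exact Q]. }
  apply (is_lim_seq_incr_1 stirling_defect) in Dl.
  set (d := c - Re l) in *.
  assert (D2 : is_lim_seq (fun N => stirling_defect (2 * N)) d).
  { apply (is_lim_seq_subseq stirling_defect); [| exact Dl].
    apply eventually_subseq. intros n. lia. }
  assert (W : is_lim_seq (fun N => 4 * stirling_defect N - 2 * stirling_defect (2 * N) - ln 2) (ln PI)).
  { apply (is_lim_seq_le_le_loc (fun _ => ln PI) _ (fun N => ln PI + / INR N)).
    - exists 1%nat. intros N HN. assert (PN : 1 <= INR N) by (apply (le_INR 1); exact HN).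
      pose proof (ln_wallis N HN) as Q. unfold stirling_defect.
      rewrite mult_INR. replace (INR 2) with 2 by (simpl; ring). rewrite ln_mult by lra. split; lra.
    - apply is_lim_seq_const.
    - replace (Finite (ln PI)) with (Finite (ln PI + 0)) by (f_equal; ring).
      apply is_lim_seq_plus'; [apply is_lim_seq_const | apply is_lim_seq_inv_INR]. }
  assert (W2 : is_lim_seq (fun N => 4 * stirling_defect N - 2 * stirling_defect (2 * N) - ln 2)
    (4 * d - 2 * d - ln 2)).
  { apply is_lim_seq_minus'; [| apply is_lim_seq_const].
    apply is_lim_seq_minus'.
    - apply (is_lim_seq_scal_l _ 4 d). exact Dl.
    - apply (is_lim_seq_scal_l _ 2 d). exact D2. }
  apply is_lim_seq_unique in W. apply is_lim_seq_unique in W2. rewrite W in W2.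
  injection W2 as E.
  assert (R0 : Re l = 0) by (unfold d in E; lra).
  assert (I0 : Im l = 0).
  { pose proof (is_lim_seq_unique _ _ (clim_Im _ _ L1)) as Q.
    rewrite (Lim_seq_ext _ (fun _ => 0)) in Q by (intros; reflexivity).
    rewrite Lim_seq_const in Q. injection Q. auto. }
  apply Ceq; assumption.
Qed.

(** * Euler's integral on the positive reals *)

(** Integrals of a nonnegative function grow with the interval, so the improper integral is their
    supremum. The set [D] of admissible lower ends covers both an end tending to [0], with all
    positive [d], and a fixed end, with the single point [e]. *)
Lemma ex_improper_pos (Fa : (R -> Prop) -> Prop) (D : R -> Prop) (g : R -> R) (B : R) :
  Filter Fa -> Fa D -> (exists d, D d) -> (forall d, D d -> Fa (fun a => a <= d /\ D a)) ->
  (forall d t, D d -> d <= t -> continuous g t) ->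
  (forall d t, D d -> d <= t -> 0 <= g t) ->
  (forall d X, D d -> d <= X -> RInt g d X <= B) ->
  exists l, is_RInt_gen g Fa (Rbar_locally p_infty) l /\ 0 <= l <= B.
Proof.
  intros FFa HD [d0 Hd0] Hbase Hc Hp HB.
  assert (Ex : forall d a b, D d -> d <= a -> a <= b -> ex_RInt g a b).
  { intros d a b Hd Ha Hab. apply (@ex_RInt_continuous R_CompleteNormedModule).
    rewrite Rmin_left, Rmax_right by exact Hab. intros z Hz. apply (Hc d); [exact Hd | lra]. }
  assert (Pos : forall d a b, D d -> d <= a -> a <= b -> 0 <= RInt g a b).
  { intros d a b Hd Ha Hab. apply RInt_ge_0; [exact Hab | apply (Ex d); assumption |].
    intros x Hx. apply (Hp d); [exact Hd | lra]. }
  destruct (completeness (fun y => exists d X, D d /\ d <= X /\ y = RInt g d X)) as [l [U L]].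
  - exists B. intros y [d [X [Hd [HX ->]]]]. apply HB; assumption.
  - exists (RInt g d0 d0), d0, d0. repeat split; [exact Hd0 | lra].
  - exists l. split.
    2:{ split.
        - apply Rle_trans with (RInt g d0 d0); [apply (Pos d0); [exact Hd0 | lra | lra] |].
          apply U. exists d0, d0. repeat split; [exact Hd0 | lra].
        - apply L. intros y [d [X [Hd [HX ->]]]]. apply HB; assumption. }
    intros P [e HP].
    assert (He : exists d X, D d /\ d <= X /\ l - e < RInt g d X).
    { destruct (Classical_Prop.classic (exists d X, D d /\ d <= X /\ l - e < RInt g d X)) as [Y | N]; [exact Y |].
      exfalso. assert (l <= l - e); [| pose proof (cond_pos e); lra].
      apply L. intros y [d [X [Hd [HX ->]]]].
      destruct (Rle_lt_dec (RInt g d X) (l - e)) as [Z | Z]; [exact Z |].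
      exfalso. apply N. exists d, X. auto. }
    destruct He as [d1 [X1 [Hd1 [HX1 HL]]]].
    apply (Filter_prod _ _ _ (fun a => a <= d1 /\ D a) (fun b => X1 < b)).
    + apply Hbase, Hd1.
    + exists X1. auto.
    + intros a b [Ha Da] Hb. simpl. exists (RInt g a b).
      split; [apply (@RInt_correct R_CompleteNormedModule), (Ex a); [exact Da | lra | lra] |].
      apply HP.
      assert (E1 : RInt g a b = RInt g a d1 + RInt g d1 X1 + RInt g X1 b).
      { rewrite <- (RInt_Chasles g a X1 b), <- (RInt_Chasles g a d1 X1);
          try (apply (Ex a); [exact Da | lra | lra]). reflexivity. }
      pose proof (Pos a a d1 Da ltac:(lra) Ha). pose proof (Pos a X1 b Da ltac:(lra) ltac:(lra)).
      assert (RInt g a b <= l).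
      { apply U. exists a, b. repeat split; [exact Da | lra]. }
      change (Rabs (RInt g a b - l) < e). apply Rabs_def1; [pose proof (cond_pos e); lra | lra].
Qed.

Definition gamma_integrand (x t : R) : R := exp ((x - 1) * ln t) * exp (- t).

Lemma continuous_gamma_integrand x t : 0 < t -> continuous (gamma_integrand x) t.
Proof.
  intros Ht. apply (@ex_derive_continuous R_AbsRing R_NormedModule).
  unfold gamma_integrand. auto_derive. exact Ht.
Qed.

Lemma gamma_integrand_pos x t : 0 < gamma_integrand x t.
Proof. apply Rmult_lt_0_compat; apply exp_pos. Qed.

Lemma ln_le_linear k y : 0 < k -> 0 < y -> k * ln y <= y + k * (ln k - 1).
Proof.
  intros Hk Hy. pose proof (exp_ineq1_le (ln (y / k))) as H.
  rewrite exp_ln in H by (apply Rdiv_lt_0_compat; assumption).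
  rewrite ln_div in H by assumption.
  apply (Rmult_le_compat_l k) in H; [| lra].
  replace (k * (y / k)) with y in H by (field; lra). lra.
Qed.

Lemma gamma_integral_bound x : 0 < x -> exists B, forall d X, 0 < d -> d <= X ->
  RInt (gamma_integrand x) d X <= B.
Proof.
  intros Hx.
  (* By [ln_le_linear] with [k = x + 1] and [y = 1 + t], the constant [C] bounds
     [(1 + t)^(x + 1) exp (- t)]. *)
  set (C := exp (1 + (x + 1) * (ln (x + 1) - 1))).
  (* [(t / (1 + t))^x / x], a bounded primitive of [t^(x-1) / (1 + t)^(x+1)]. *)
  set (U := fun t => C * (exp (x * (ln t - ln (1 + t))) / x)).
  set (u := fun t => C * (exp (x * (ln t - ln (1 + t))) * (/ t - / (1 + t)))).
  exists (C / x). intros d X Hd HX.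
  assert (PC : 0 < C) by apply exp_pos.
  assert (IU : is_RInt u d X (U X - U d)).
  { apply (is_RInt_derive U u); rewrite Rmin_left, Rmax_right by exact HX; intros t Ht.
    - unfold U, u. auto_derive; [repeat split; lra |]. unfold Rminus. field. lra.
    - apply (@ex_derive_continuous R_AbsRing R_NormedModule). unfold u. auto_derive. repeat split; lra. }
  apply Rle_trans with (U X - U d).
  - rewrite <- (is_RInt_unique _ _ _ _ IU).
    apply RInt_le; [exact HX | | eexists; exact IU |].
    + apply (@ex_RInt_continuous R_CompleteNormedModule).
      rewrite Rmin_left, Rmax_right by exact HX. intros z Hz. apply continuous_gamma_integrand. lra.
    + intros t Ht. unfold gamma_integrand, u.
      assert (Pt : 0 < t) by lra.
      replace (/ t - / (1 + t)) with (exp (- ln t) * exp (- ln (1 + t))).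
      2:{ rewrite !exp_Ropp, !exp_ln by lra. field. lra. }
      unfold C. rewrite <- !exp_plus. apply exp_le.
      pose proof (ln_le_linear (x + 1) (1 + t) ltac:(lra) ltac:(lra)). lra.
  - unfold U.
    assert (0 < exp (x * (ln d - ln (1 + d))) / x) by (apply Rdiv_lt_0_compat; [apply exp_pos | exact Hx]).
    assert (exp (x * (ln X - ln (1 + X))) <= 1).
    { apply Rle_trans with (exp 0); [apply exp_le | rewrite exp_0; lra]. pose proof (ln_le X (1 + X) ltac:(lra) ltac:(lra)).
      assert (0 <= x * (ln (1 + X) - ln X)) by (apply Rmult_le_pos; lra). lra. }
    assert (exp (x * (ln X - ln (1 + X))) / x <= 1 / x).
    { apply Rmult_le_compat_r; [left; apply Rinv_0_lt_compat, Hx | lra]. }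
    assert (C * (exp (x * (ln X - ln (1 + X))) / x) <= C * (1 / x)) by (apply Rmult_le_compat_l; lra).
    assert (0 < C * (exp (x * (ln d - ln (1 + d))) / x)) by (apply Rmult_lt_0_compat; lra).
    unfold Rdiv in *. lra.
Qed.

Notation is_RInt_gen_0_oo f l := (is_RInt_gen (f : R -> R) (at_right 0) (Rbar_locally p_infty) l).

Definition rgamma (x : R) : R := RInt_gen (gamma_integrand x) (at_right 0) (Rbar_locally p_infty).

Lemma at_right_0_lt e : 0 < e -> at_right 0 (fun a => 0 < a < e).
Proof.
  intros He. exists (mkposreal e He). intros y Hy Py. change (Rabs (y - 0) < e) in Hy.
  rewrite Rminus_0_r, Rabs_pos_eq in Hy; lra.
Qed.

Lemma rgamma_correct x : 0 < x -> is_RInt_gen_0_oo (gamma_integrand x) (rgamma x).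
Proof.
  intros Hx. destruct (gamma_integral_bound x Hx) as [B HB].
  destruct (ex_improper_pos (at_right 0) (fun d => 0 < d) (gamma_integrand x) B) as [l [Hl _]].
  - apply filter_filter'.
  - generalize (at_right_0_lt 1 Rlt_0_1). apply filter_imp. intros a Ha. lra.
  - exists 1. lra.
  - intros d Hd. generalize (at_right_0_lt d Hd). apply filter_imp. intros a Ha. lra.
  - intros d t Hd Ht. apply continuous_gamma_integrand. lra.
  - intros d t Hd Ht. left. apply gamma_integrand_pos.
  - exact HB.
  - unfold rgamma. rewrite (is_RInt_gen_unique (V := R_CompleteNormedModule) _ _ Hl). exact Hl.
Qed.

Lemma rgamma_unique x l : is_RInt_gen_0_oo (gamma_integrand x) l -> rgamma x = l.
Proof. intros H. exact (is_RInt_gen_unique (V := R_CompleteNormedModule) _ _ H). Qed.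

Lemma prod_0_oo (P : R -> R -> Prop) :
  (forall a b, 0 < a < 1 -> 1 < b -> P a b) ->
  filter_prod (at_right 0) (Rbar_locally p_infty) (fun ab => P (fst ab) (snd ab)).
Proof.
  intros H. apply (Filter_prod _ _ _ (fun a => 0 < a < 1) (fun b => 1 < b)).
  - apply at_right_0_lt, Rlt_0_1.
  - exists 1. auto.
  - intros a b Ha Hb. apply H; assumption.
Qed.

Lemma is_RInt_gen_0_oo_derive (f df : R -> R) la lb :
  (forall t, 0 < t -> is_derive f t (df t)) -> (forall t, 0 < t -> continuous df t) ->
  filterlim f (at_right 0) (locally la) -> filterlim f (Rbar_locally p_infty) (locally lb) ->
  is_RInt_gen_0_oo df (lb - la).
Proof.
  intros Hd Hc La Lb.
  assert (E : forall t, 0 < t -> Derive f t = df t) by (intros t Ht; apply is_derive_unique, Hd, Ht).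
  apply (is_RInt_gen_ext (Derive f)).
  - apply (prod_0_oo (fun a b => forall x, Rmin a b < x < Rmax a b -> Derive f x = df x)).
    intros a b Ha Hb x. rewrite Rmin_left, Rmax_right by lra. intros Hx. apply E. lra.
  - apply is_RInt_gen_Derive; try assumption.
    + apply (prod_0_oo (fun a b => forall x, Rmin a b <= x <= Rmax a b -> ex_derive f x)).
      intros a b Ha Hb x. rewrite Rmin_left, Rmax_right by lra. intros Hx. eexists. apply Hd. lra.
    + apply (prod_0_oo (fun a b => forall x, Rmin a b <= x <= Rmax a b -> continuous (Derive f) x)).
      intros a b Ha Hb x. rewrite Rmin_left, Rmax_right by lra. intros Hx.
      apply (continuous_ext_loc _ df); [| apply Hc; lra].
      assert (Px : 0 < x) by lra.
      exists (mkposreal x Px). intros y Hy. change (Rabs (y - x) < x) in Hy. apply Rabs_def2 in Hy.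
      symmetry. apply E. lra.
Qed.

Lemma filterlim_exp_m (F : (R -> Prop) -> Prop) (f : R -> R) : Filter F ->
  (forall M, F (fun t => f t < M)) -> filterlim (fun t => exp (f t)) F (locally 0).
Proof.
  intros FF H. apply (filterlim_comp _ _ _ f exp F (Rbar_locally m_infty)); [| exact is_lim_exp_m].
  intros P [M HM]. unfold filtermap. generalize (H M). apply filter_imp. intros t Ht. apply HM, Ht.
Qed.

Lemma rgamma_rec x : 0 < x -> rgamma (x + 1) = x * rgamma x.
Proof.
  intros Hx.
  assert (H : is_RInt_gen_0_oo (fun t => x * gamma_integrand x t - gamma_integrand (x + 1) t) (0 - 0)).
  { apply (is_RInt_gen_0_oo_derive (fun t => exp (x * ln t - t))).
    - intros t Ht. unfold gamma_integrand.
      replace ((x - 1) * ln t) with (x * ln t - ln t) by ring.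
      replace ((x + 1 - 1) * ln t) with (x * ln t) by ring.
      unfold Rminus. rewrite !exp_plus, (exp_Ropp (ln t)), exp_ln by exact Ht.
      auto_derive; [lra |]. rewrite exp_plus. field. lra.
    - intros t Ht. apply (@continuous_minus R_UniformSpace R_AbsRing R_NormedModule).
      + apply (@continuous_scal_r R_UniformSpace R_AbsRing R_NormedModule x (gamma_integrand x)).
        apply continuous_gamma_integrand, Ht.
      + apply continuous_gamma_integrand, Ht.
    - apply filterlim_exp_m; [typeclasses eauto |]. intros M.
      assert (L : at_right 0 (fun t => ln t < M / x)).
      { apply (is_lim_ln_0 (fun y => y < M / x)). exists (M / x). auto. }
      generalize (filter_and _ _ L (at_right_0_lt 1 Rlt_0_1)). apply filter_imp. intros t [H1 H2].
      apply Rlt_div_r in H1; [| exact Hx]. lra.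
    - apply filterlim_exp_m; [typeclasses eauto |]. intros M.
      (* [ln_le_linear] with [k = 2 x] gives [x ln t - t <= x (ln (2 x) - 1) - t / 2]; the threshold
         makes the right-hand side less than [M]. *)
      exists (Rmax 1 (2 * ((2 * x) * (ln (2 * x) - 1) / 2 - M))). intros t Ht.
      assert (H1 : 1 < t) by (eapply Rle_lt_trans; [apply Rmax_l | exact Ht]).
      assert (H2 : 2 * ((2 * x) * (ln (2 * x) - 1) / 2 - M) < t)
        by (eapply Rle_lt_trans; [apply Rmax_r | exact Ht]).
      pose proof (ln_le_linear (2 * x) t ltac:(lra) ltac:(lra)). lra. }
  pose proof (is_RInt_gen_minus _ _ _ _ (is_RInt_gen_scal _ x _ (rgamma_correct x Hx))
    (rgamma_correct (x + 1) ltac:(lra))) as H2.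
  pose proof (is_RInt_gen_unique (V := R_CompleteNormedModule) _ _ H) as E1.
  pose proof (is_RInt_gen_unique (V := R_CompleteNormedModule) _ _ H2) as E2.
  enough (Q : 0 - 0 = x * rgamma x - rgamma (x + 1)) by lra.
  etransitivity; [symmetry; exact E1 | exact E2].
Qed.

Lemma rgamma_1 : rgamma 1 = 1.
Proof.
  apply rgamma_unique.
  replace 1 with (- 0 - - exp (- 0)) at 2 by (rewrite Ropp_0, exp_0; ring).
  apply (is_RInt_gen_0_oo_derive (fun t => - exp (- t))).
  - intros t Ht. unfold gamma_integrand. replace ((1 - 1) * ln t) with 0 by ring.
    rewrite exp_0. auto_derive; [exact I | ring].
  - intros t Ht. apply continuous_gamma_integrand, Ht.
  - eapply filterlim_filter_le_1; [apply filter_le_within |].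
    apply (@ex_derive_continuous R_AbsRing R_NormedModule (fun t => - exp (- t))).
    auto_derive. exact I.
  - apply (filterlim_comp _ _ _ (fun t => exp (- t)) Ropp _ (locally 0)).
    + apply filterlim_exp_m; [typeclasses eauto |]. intros M. exists (- M). intros t Ht. lra.
    + apply (@filterlim_opp R_AbsRing R_NormedModule 0).
Qed.

(** Weighted inequality between arithmetic and geometric means. Two bounds from [exp y >= 1 + y],
    combined with the weights [s] and [1 - s], cancel the logarithm. *)
Lemma Young_pow (s u : R) : 0 <= s <= 1 -> 0 < u -> exp (s * ln u) <= 1 - s + s * u.
Proof.
  intros Hs Hu.
  assert (E1 : u = exp (s * ln u) * exp ((1 - s) * ln u)).
  { rewrite <- exp_plus. replace (s * ln u + (1 - s) * ln u) with (ln u) by ring.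
    rewrite exp_ln; lra. }
  assert (E2 : 1 = exp (s * ln u) * exp (- (s * ln u))).
  { rewrite <- exp_plus. rewrite Rplus_opp_r, exp_0. reflexivity. }
  set (v := exp (s * ln u)) in *. assert (Pv : 0 < v) by apply exp_pos.
  assert (L1 : v * (1 + (1 - s) * ln u) <= u).
  { rewrite E1 at 2. apply Rmult_le_compat_l; [lra | apply exp_ineq1_le]. }
  assert (L2 : v * (1 - s * ln u) <= 1).
  { rewrite E2 at 2. apply Rmult_le_compat_l; [lra |].
    pose proof (exp_ineq1_le (- (s * ln u))). lra. }
  apply (Rmult_le_compat_l s) in L1; [| lra].
  apply (Rmult_le_compat_l (1 - s)) in L2; [| lra]. lra.
Qed.

(** [Young_pow] at [t / x] bounds the integrand by a combination of those for [x] and [x + 1], and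
    [rgamma_rec] folds the two integrals into one. This is the form in which log-convexity
    enters. *)
Lemma rgamma_interp x s : 0 < x -> 0 <= s <= 1 -> rgamma (x + s) <= exp (s * ln x) * rgamma x.
Proof.
  intros Hx Hs. assert (Hx1 : 0 < x + 1) by lra. assert (Hxs : 0 < x + s) by lra.
  pose proof (is_RInt_gen_plus _ _ _ _
    (is_RInt_gen_scal _ (exp (s * ln x) * (1 - s)) _ (rgamma_correct x Hx))
    (is_RInt_gen_scal _ (exp (s * ln x) * (s / x)) _ (rgamma_correct (x + 1) Hx1))) as H2.
  pose proof (rgamma_correct (x + s) Hxs) as H1.
  apply Rle_trans with (norm (rgamma (x + s))); [apply Rle_abs |].
  eapply Rle_trans.
  { refine (RInt_gen_norm (V := R_CompleteNormedModule) (Fa := at_right 0) (Fb := Rbar_locally p_infty)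
      _ _ _ _ _ _ H1 H2).
    - apply (prod_0_oo (fun a b => a <= b)). intros; lra.
    - apply (prod_0_oo (fun a b => forall t, a <= t <= b -> Rabs (gamma_integrand (x + s) t) <=
        exp (s * ln x) * (1 - s) * gamma_integrand x t + exp (s * ln x) * (s / x) * gamma_integrand (x + 1) t)).
      intros a b Ha Hb t Ht.
      rewrite Rabs_pos_eq by (left; apply gamma_integrand_pos).
    assert (Pt : 0 < t) by lra.
    pose proof (Young_pow s (t / x) Hs ltac:(apply Rdiv_lt_0_compat; lra)) as Y.
    rewrite ln_div in Y by lra.
    unfold gamma_integrand.
    replace ((x + s - 1) * ln t) with (s * ln x + (s * (ln t - ln x) + (x - 1) * ln t)) by ring.
    replace ((x + 1 - 1) * ln t) with ((x - 1) * ln t + ln t) by ring.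
    rewrite !exp_plus, exp_ln by lra.
    set (A := exp (s * ln x)) in *. set (B := exp ((x - 1) * ln t)). set (D := exp (- t)).
    assert (PA : 0 < A) by apply exp_pos. assert (PB : 0 < B) by apply exp_pos.
    assert (PD : 0 < D) by apply exp_pos.
    replace (A * (1 - s) * (B * D) + A * (s / x) * (B * t * D))
      with (A * (B * D) * (1 - s + s * (t / x))) by (field; lra).
    replace (A * (exp (s * (ln t - ln x)) * B) * D) with (A * (B * D) * exp (s * (ln t - ln x))) by ring.
    apply Rmult_le_compat_l; [| exact Y]. left. repeat apply Rmult_lt_0_compat; assumption. }
  right. change (exp (s * ln x) * (1 - s) * rgamma x + exp (s * ln x) * (s / x) * rgamma (x + 1) =
      exp (s * ln x) * rgamma x).
    rewrite rgamma_rec by exact Hx. field. lra.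
Qed.

Lemma Gamma_real x : 0 < x -> Gamma (RtoC x) = RtoC (rgamma x).
Proof.
  intros Hx. unfold Gamma, CInt_gen.
  assert (E : forall t : R, (Cexp ((RtoC x - 1) * RtoC (ln t)) * Cexp (- RtoC t) = RtoC (gamma_integrand x t))%C).
  { intros t. rewrite <- RtoC_minus, <- RtoC_mult, <- RtoC_opp, !Cexp_RtoC, <- RtoC_mult. reflexivity. }
  assert (X : ex_RInt_gen (gamma_integrand x) (at_right 0) (Rbar_locally p_infty))
    by (eexists; apply rgamma_correct, Hx).
  (* The imaginary part is the improper integral of zero, evaluated as [0] times a convergent
     integral. *)
  pose proof (is_RInt_gen_scal _ 0 _ (rgamma_correct x Hx)) as H0.
  apply Ceq.
  - symmetry. apply (RInt_gen_ext_eq (V := R_CompleteNormedModule) (gamma_integrand x)); [| exact X].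
    intros t. cbv beta. rewrite E. reflexivity.
  - transitivity (RInt_gen (V := R_CompleteNormedModule) (fun t => scal 0 (gamma_integrand x t))
      (at_right 0) (Rbar_locally p_infty)).
    + symmetry. apply (RInt_gen_ext_eq (V := R_CompleteNormedModule)).
      * intros t. cbv beta. rewrite E. unfold scal; simpl; unfold mult; simpl. ring.
      * eexists. exact H0.
    + etransitivity; [exact (is_RInt_gen_unique (V := R_CompleteNormedModule) _ _ H0) |].
      unfold scal; simpl; unfold mult; simpl. ring.
Qed.

(** * Identification of log Gamma *)

(** By the recurrence, [stirling N y] is [l y] plus the error [E (N + y)] of Stirling's formula for
    [l]. The case [y = 1] and [log_Gamma_lim_1] show that [E] tends to [0] along the integers, and
    [Diff] carries this over to the integers shifted by [x]. *)
Lemma bohr_mollerup (l : R -> R) (x : R) :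
  0 < x < 1 ->
  l 1 = 0 ->
  (forall y, 0 < y -> l (y + 1) = ln y + l y) ->
  (forall y s, 0 < y -> 0 <= s <= 1 -> l (y + s) <= s * ln y + l y) ->
  log_Gamma_lim (RtoC x) = RtoC (l x).
Proof.
  intros Hx L1 Lrec Lint.
  set (c := ln (sqrt (2 * PI))).
  set (E := fun y => (y - 1 / 2) * ln y - y + c - l y).
  assert (HS : forall y N, 0 < y -> stirling N (RtoC y) = RtoC (l y + E (INR N + y))).
  { intros y N Hy. rewrite stirling_real by exact Hy. f_equal. unfold E, c.
    enough (Q : l (INR N + y) = l y + rsum (fun n => ln (INR n + y)) N) by (rewrite Q; ring).
    induction N as [| N IH]; [simpl; rewrite Rplus_0_l; ring |].
    rewrite S_INR. replace (INR N + 1 + y) with (INR N + y + 1) by ring.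
    pose proof (pos_INR N). rewrite Lrec, IH by lra. simpl. ring. }
  assert (E1 : is_lim_seq (fun N => E (INR N + 1)) 0).
  { assert (P1 : 0 < 1) by lra.
    pose proof (clim_stirling 1 P1) as Q. rewrite log_Gamma_lim_1 in Q.
    apply clim_Re in Q. eapply is_lim_seq_ext; [| exact Q].
    intros N. cbv beta. rewrite HS by lra. rewrite L1. simpl. ring. }
  (* The number [d] lies between [x / (y + x)] and [x / y]. The interpolation inequality is used
     twice, from [y] by [x] and from [y + x] by [1 - x], to enclose [l (y + x) - l y] from above and
     below. *)
  assert (Diff : forall y, 1 <= y -> Rabs (E (y + x) - E y) <= / y).
  { intros y Hy.
    set (d := ln (y + x) - ln y).
    assert (D1 : y * d <= x).
    { pose proof (exp_ineq1_le d) as Q. unfold d in Q. unfold Rminus in Q at 2.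
      rewrite exp_plus, exp_Ropp, !exp_ln in Q by lra. fold d in Q.
      apply (Rmult_le_compat_l y) in Q; [| lra].
      replace (y * ((y + x) * / y)) with (y + x) in Q by (field; lra). lra. }
    assert (D2 : x <= (y + x) * d).
    { pose proof (exp_ineq1_le (- d)) as Q. unfold d in Q at 2. rewrite Ropp_minus_distr in Q.
      unfold Rminus in Q. rewrite exp_plus, exp_Ropp, !exp_ln in Q by lra.
      apply (Rmult_le_compat_l (y + x)) in Q; [| lra].
      replace ((y + x) * (y * / (y + x))) with y in Q by (field; lra). lra. }
    assert (D0 : 0 <= d) by nra.
    assert (D3 : d <= / y).
    { apply Rmult_le_reg_l with y; [lra |]. rewrite Rinv_r by lra. lra. }
    pose proof (Lint y x ltac:(lra) ltac:(lra)) as U.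
    pose proof (Lint (y + x) (1 - x) ltac:(lra) ltac:(lra)) as Lo.
    replace (y + x + (1 - x)) with (y + 1) in Lo by ring. rewrite Lrec in Lo by lra.
    replace (ln (y + x)) with (ln y + d) in * by (unfold d; ring).
    assert (EE : E (y + x) - E y = x * ln y + (y + x - 1 / 2) * d - x - (l (y + x) - l y)).
    { unfold E. replace (ln (y + x)) with (ln y + d) by (unfold d; ring). ring. }
    rewrite EE. apply Rabs_le. clear EE.
    assert (x * d <= d) by nra. split; nra. }
  apply (clim_unique (fun N => stirling N (RtoC x))); [apply clim_stirling; simpl; lra |].
  apply (clim_ext (fun N => RtoC (l x + E (INR N + x)))); [intros N; symmetry; apply HS; lra |].
  apply clim_RtoC.
  replace (Finite (l x)) with (Finite (l x + 0)) by (f_equal; ring).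
  apply is_lim_seq_plus'; [apply is_lim_seq_const |].
  apply is_lim_seq_incr_1.
  apply (is_lim_seq_ext (fun N => (E (INR N + 1 + x) - E (INR N + 1)) + E (INR N + 1))).
  { intros N. rewrite S_INR. ring. }
  apply is_lim_seq_plus0; [| exact E1].
  apply is_lim_seq_abs_0.
  apply (is_lim_seq_0_le _ (fun N => / INR (S N))).
  - intros N. rewrite S_INR. pose proof (pos_INR N). split; [apply Rabs_pos | apply Diff; lra].
  - apply (is_lim_seq_incr_1 (fun n => / INR n)). apply is_lim_seq_inv_INR.
Qed.

Lemma log_Gamma_eq_real (logGamma : C -> C) (x : R) :
  is_log_Gamma logGamma -> 0 < x < 1 -> logGamma (RtoC x) = log_Gamma_lim (RtoC x).
Proof.
  intros [_ [Hexp Him]] Hx.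
  set (l := fun y => Re (logGamma (RtoC y))).
  assert (Hl : forall y, 0 < y -> logGamma (RtoC y) = RtoC (l y)).
  { intros y Hy. apply Ceq; simpl; [reflexivity | apply Him, Hy]. }
  assert (He : forall y, 0 < y -> exp (l y) = rgamma y).
  { intros y Hy. pose proof (Hexp (RtoC y) Hy) as Q.
    rewrite Gamma_real, Hl, Cexp_RtoC in Q by exact Hy. apply RtoC_inj, Q. }
  assert (Hln : forall y, 0 < y -> l y = ln (rgamma y)).
  { intros y Hy. rewrite <- He by exact Hy. symmetry. apply ln_exp. }
  (* Positivity of the Gamma integral is read off from its being the exponential of a real
     number. *)
  assert (Pos : forall y, 0 < y -> 0 < rgamma y).
  { intros y Hy. rewrite <- He by exact Hy. apply exp_pos. }
  rewrite Hl by lra. symmetry. apply bohr_mollerup.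
  - exact Hx.
  - rewrite Hln, rgamma_1 by lra. apply ln_1.
  - intros y Hy. rewrite !Hln, rgamma_rec by lra. apply ln_mult; [exact Hy | apply Pos, Hy].
  - intros y s Hy Hs. rewrite !Hln by lra.
    rewrite <- (ln_exp (s * ln y)). rewrite <- ln_mult; [| apply exp_pos | apply Pos, Hy].
    apply ln_le; [apply Pos; lra |]. apply rgamma_interp; assumption.
Qed.

(** The two functions agree on the real interval [(0, 1)], whose points cluster at [1 / 2], and the
    segment from [1 / 2] to [a] stays in the half-plane. *)
Theorem log_Gamma_eq (logGamma : C -> C) (a : C) :
  is_log_Gamma logGamma -> 0 < Re a -> logGamma a = log_Gamma_lim a.
Proof.
  intros H Ha. pose proof H as [Han _].
  assert (HA : forall z, 0 < Re z -> analytic_at (fun z => logGamma z - log_Gamma_lim z)%C z).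
  { intros z Hz. apply analytic_at_minus; [apply Han, Hz | apply log_Gamma_lim_analytic, Hz]. }
  destruct (identity_segment (fun z => logGamma z - log_Gamma_lim z)%C (RtoC (1 / 2)) a) as [d [Hd Z]].
  - intros t Ht. apply HA.
    replace (Re (RtoC (1 / 2) + RtoC t * (a - RtoC (1 / 2)))) with ((1 - t) * (1 / 2) + t * Re a)
      by (unfold Re; simpl; field).
    destruct (Req_dec t 1) as [-> | n]; [lra |]. 
    assert (0 < (1 - t) * (1 / 2)) by lra. assert (0 <= t * Re a) by (apply Rmult_le_pos; lra). lra.
  - apply isolated_zeros; [apply HA; simpl; lra |].
    intros e He. set (h := Rmin (e / 2) (1 / 4)).
    assert (Ph : 0 < h) by (apply Rmin_pos; lra).
    assert (h <= e / 2) by apply Rmin_l. assert (h <= 1 / 4) by apply Rmin_r.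
    exists (RtoC (1 / 2 + h)). split; [| split].
    + intros Q. apply RtoC_inj in Q. lra.
    + rewrite <- RtoC_minus, Cmod_R, Rabs_pos_eq; lra.
    + rewrite log_Gamma_eq_real; [ring | exact H | lra].
  - apply Ceq_minus, Z. rewrite Cmod_sub_diag. exact Hd.
Qed.

(** Near [1] the function [Gamma] is the exponential of [log_Gamma_lim], so [digamma 1] is the
    derivative of the latter, to which the derivatives of [stirling N] converge by Weierstrass's
    theorem. *)
Theorem clim_stirling'_1 (logGamma : C -> C) :
  is_log_Gamma logGamma -> clim (fun N => stirling' N 1) (- euler_gamma)%C.
Proof.
  intros H. assert (P1 : 0 < Re 1) by (simpl; lra).
  destruct (log_Gamma_lim_analytic 1 P1) as [_ [l [D L]]].
  replace (- euler_gamma)%C with l; [exact L |].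
  assert (EG : forall z, Cmod (z - 1) < 1 -> Cexp (log_Gamma_lim z) = Gamma z).
  { intros z Hz. apply Re_near in Hz. simpl in Hz.
    rewrite <- (log_Gamma_eq logGamma) by (try exact H; lra). apply H. lra. }
  unfold euler_gamma, digamma.
  rewrite (cderiv_C_derive Gamma 1 (Cexp (log_Gamma_lim 1) * l)).
  - rewrite <- (EG (RtoC 1)).
    + pose proof (Cexp_neq_0 (log_Gamma_lim 1)). field. assumption.
    + rewrite Cmod_sub_diag. lra.
  - apply (cderiv_ext_loc (fun z => Cexp (log_Gamma_lim z)) _ _ _ 1 Rlt_0_1 EG).
    apply cderiv_Cexp_comp, D.
Qed.

(** * Complex integrals over half-lines *)

Definition is_tail (f : R -> C) (e : R) (l : C) : Prop :=
  @is_RInt_gen C_R_NormedModule f (at_point e) (Rbar_locally p_infty) l.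

Lemma at_point_oo (P : R -> R -> Prop) e b0 :
  (forall b, b0 < b -> P e b) ->
  filter_prod (at_point e) (Rbar_locally p_infty) (fun ab => P (fst ab) (snd ab)).
Proof.
  intros H. apply (Filter_prod _ _ _ (fun a => a = e) (fun b => b0 < b)).
  - reflexivity.
  - exists b0. auto.
  - intros a b -> Hb. apply H, Hb.
Qed.

Lemma is_tail_unique f e l m : is_tail f e l -> is_tail f e m -> l = m.
Proof.
  intros H1 H2.
  rewrite <- (is_RInt_gen_unique (V := C_R_CompleteNormedModule) _ _ H1).
  apply (is_RInt_gen_unique (V := C_R_CompleteNormedModule) _ _ H2).
Qed.

Lemma is_tail_ext f g e l : (forall t, e < t -> f t = g t) -> is_tail f e l -> is_tail g e l.
Proof.
  intros E. apply is_RInt_gen_ext.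
  apply (at_point_oo (fun a b => forall t, Rmin a b < t < Rmax a b -> f t = g t) e e).
  intros b Hb t. rewrite Rmin_left, Rmax_right by lra. intros Ht. apply E. lra.
Qed.

Lemma is_tail_plus f g e l m :
  is_tail f e l -> is_tail g e m -> is_tail (fun t => f t + g t)%C e (l + m)%C.
Proof. intros H1 H2. exact (is_RInt_gen_plus _ _ _ _ H1 H2). Qed.

Lemma is_tail_minus f g e l m :
  is_tail f e l -> is_tail g e m -> is_tail (fun t => f t - g t)%C e (l - m)%C.
Proof. intros H1 H2. exact (is_RInt_gen_minus _ _ _ _ H1 H2). Qed.

Lemma ccont_scal c z : ccont (fun w => c * w)%C z.
Proof. apply continuous_Cmult; [apply continuous_Cconst | apply continuous_id]. Qed.

Lemma is_tail_scal c f e l : is_tail f e l -> is_tail (fun t => c * f t)%C e (c * l)%C.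
Proof.
  intros H P HP.
  pose proof (H (fun y => P (c * y)%C) (ccont_scal c l P HP)) as Q.
  unfold filtermapi in *. generalize Q. apply filter_imp.
  intros ab [y [Hy Py]]. exists (c * y)%C. split; [apply is_cint_scal, Hy | exact Py].
Qed.

Lemma is_tail_Chasles f e e' l m :
  is_cint f e e' l -> is_tail f e' m -> is_tail f e (l + m)%C.
Proof.
  intros H1 H2. apply (is_RInt_gen_Chasles (V := C_R_NormedModule) f e' l m); [| exact H2].
  apply is_RInt_gen_at_point, H1.
Qed.

Lemma is_tail_derive (F f : R -> C) e :
  (forall t, e <= t -> rderiv F t (f t)) -> (forall t, e <= t -> rcont f t) ->
  (forall d, 0 < d -> exists X, forall t, X < t -> Cmod (F t) < d) ->
  is_tail f e (- F e)%C.
Proof.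
  intros HF Hf H0 P [d HP].
  destruct (H0 d (cond_pos d)) as [X HX].
  apply (at_point_oo (fun a b => exists y, is_cint f a b y /\ P y) e (Rmax e X)).
  intros b Hb.
  assert (e < b) by (eapply Rle_lt_trans; [apply Rmax_l | exact Hb]).
  assert (X < b) by (eapply Rle_lt_trans; [apply Rmax_r | exact Hb]).
  exists (F b - F e)%C. split.
  - apply is_cint_rderiv; rewrite Rmin_left by lra; intros t Ht; [apply HF | apply Hf]; lra.
  - apply HP. pose proof (HX b H1) as L. split.
    + eapply Rle_lt_trans; [| exact L]. 
      change (Rabs (Re (F b - F e - - F e)) <= Cmod (F b)).
      replace (F b - F e - - F e)%C with (F b) by ring. apply re_le_Cmod.
    + eapply Rle_lt_trans; [| exact L]. 
      change (Rabs (Im (F b - F e - - F e)) <= Cmod (F b)).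
      replace (F b - F e - - F e)%C with (F b) by ring. apply Cmod_Im.
Qed.

Lemma is_RInt_exp_tail (M d e : R) : 0 < d ->
  is_RInt_gen (fun t => M * exp (- d * t)) (at_point e) (Rbar_locally p_infty) (M * exp (- d * e) / d).
Proof.
  intros Hd.
  assert (L : filterlim (fun t => - (M / d) * exp (- d * t)) (Rbar_locally p_infty) (locally 0)).
  { apply (filterlim_comp _ _ _ (fun t => exp (- d * t)) (fun y => - (M / d) * y) _ (locally 0)).
    - apply filterlim_exp_m; [typeclasses eauto |]. intros K. exists (- K / d). intros t Ht.
      apply Rlt_div_l in Ht; [| exact Hd]. lra.
    - replace 0 with (- (M / d) * 0) at 2 by ring.
      apply (@filterlim_scal_r R_AbsRing R_NormedModule (- (M / d)) 0). }
  replace (M * exp (- d * e) / d) with (0 - (- (M / d) * exp (- d * e))) by (field; lra).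
  apply (is_RInt_gen_ext (Derive (fun t => - (M / d) * exp (- d * t)))).
  - apply (at_point_oo (fun a b => forall x, Rmin a b < x < Rmax a b ->
      Derive (fun t => - (M / d) * exp (- d * t)) x = M * exp (- d * x)) e e).
    intros b Hb x _. apply is_derive_unique. auto_derive; [exact I | field; lra].
  - apply is_RInt_gen_Derive.
    + apply (at_point_oo (fun a b => forall x, Rmin a b <= x <= Rmax a b ->
        ex_derive (fun t => - (M / d) * exp (- d * t)) x) e e).
      intros b Hb x _. auto_derive. exact I.
    + apply (at_point_oo (fun a b => forall x, Rmin a b <= x <= Rmax a b ->
        continuous (Derive (fun t => - (M / d) * exp (- d * t))) x) e e).
      intros b Hb x _. apply (continuous_ext (fun x => M * exp (- d * x))).
      * intros y. symmetry. apply is_derive_unique. auto_derive; [exact I | field; lra].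
      * apply (@ex_derive_continuous R_AbsRing R_NormedModule). auto_derive. exact I.
    + intros P HP. apply locally_singleton in HP. exact HP.
    + exact L.
Qed.

Lemma is_tail_bound f e l M d :
  0 < d -> (forall t, e <= t -> Cmod (f t) <= M * exp (- d * t)) -> is_tail f e l ->
  Cmod l <= M * exp (- d * e) / d.
Proof.
  intros Hd HM H. rewrite <- norm_Cmod.
  refine (RInt_gen_norm (V := C_R_CompleteNormedModule) _ _ _ _ _ _ H (is_RInt_exp_tail M d e Hd)).
  - apply (at_point_oo (fun a b => a <= b) e e). intros; lra.
  - apply (at_point_oo (fun a b => forall t, a <= t <= b ->
      @norm R_AbsRing C_R_NormedModule (f t) <= M * exp (- d * t)) e e).
    intros b Hb t Ht. rewrite norm_Cmod. apply HM. lra.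
Qed.

(** Adding [M * exp (- d * t)] makes the integrand nonnegative, so that [ex_improper_pos] applies;
    the exponential is subtracted afterwards. *)
Lemma ex_real_tail (g : R -> R) e M d :
  0 < d -> (forall t, e <= t -> continuous g t) ->
  (forall t, e <= t -> Rabs (g t) <= M * exp (- d * t)) ->
  exists l, is_RInt_gen g (at_point e) (Rbar_locally p_infty) l.
Proof.
  intros Hd Hc HM.
  pose proof (is_RInt_exp_tail M d e Hd) as IW.
  assert (PM : 0 <= M).
  { pose proof (HM e ltac:(lra)). pose proof (Rabs_pos (g e)). pose proof (exp_pos (- d * e)).
    apply Rnot_lt_le. intros Q. assert (M * exp (- d * e) < 0) by nra. lra. }
  assert (Cw : forall t, continuous (fun t => M * exp (- d * t)) t).
  { intros t. apply (@ex_derive_continuous R_AbsRing R_NormedModule). auto_derive. exact I. }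
  destruct (ex_improper_pos (at_point e) (fun a => a = e) (fun t => g t + M * exp (- d * t))
    (2 * (M * exp (- d * e) / d))) as [l [Hl _]].
  - typeclasses eauto.
  - reflexivity.
  - exists e. reflexivity.
  - intros a ->. split; [lra | reflexivity].
  - intros a t -> Ht. apply (@continuous_plus R_UniformSpace R_AbsRing R_NormedModule); [apply Hc, Ht | apply Cw].
  - intros a t -> Ht. pose proof (HM t Ht). pose proof (Rle_abs (- g t)). rewrite Rabs_Ropp in *. lra.
  - intros a X -> HX.
    assert (I2 : is_RInt (fun t => 2 * (M * exp (- d * t))) e X
      (- 2 * (M / d) * exp (- d * X) - - 2 * (M / d) * exp (- d * e))).
    { apply (is_RInt_primitive (fun t => - 2 * (M / d) * exp (- d * t))); [| | reflexivity].
      - intros t. auto_derive; [exact I | field; lra].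
      - intros t. apply (@ex_derive_continuous R_AbsRing R_NormedModule). auto_derive. exact I. }
    eapply Rle_trans; [apply (RInt_le _ (fun t => 2 * (M * exp (- d * t))) e X HX) |].
    + apply (@ex_RInt_continuous R_CompleteNormedModule). rewrite Rmin_left, Rmax_right by exact HX.
      intros t Ht. apply (@continuous_plus R_UniformSpace R_AbsRing R_NormedModule); [apply Hc; lra | apply Cw].
    + eexists. exact I2.
    + intros t Ht. pose proof (HM t ltac:(lra)). pose proof (Rle_abs (g t)). lra.
    + rewrite (is_RInt_unique _ _ _ _ I2).
      assert (0 <= M / d) by (apply Rdiv_le_0_compat; lra).
      pose proof (exp_pos (- d * X)). assert (0 <= M / d * exp (- d * X)) by nra.
      unfold Rdiv in *. lra.
  - pose proof (is_RInt_gen_minus _ _ _ _ Hl IW) as Q. eexists.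
    apply (is_RInt_gen_ext _ g) in Q; [exact Q |].
    apply (at_point_oo (fun a b => forall x, Rmin a b < x < Rmax a b ->
      minus (g x + M * exp (- d * x)) (M * exp (- d * x)) = g x) e e).
    intros b Hb x _. unfold minus, plus, opp; simpl. ring.
Qed.

Lemma ex_tail f e M d :
  0 < d -> (forall t, e <= t -> rcont f t) ->
  (forall t, e <= t -> Cmod (f t) <= M * exp (- d * t)) ->
  exists l, is_tail f e l.
Proof.
  intros Hd Hc HM.
  destruct (ex_real_tail (fun t => Re (f t)) e M d Hd) as [x Hx].
  - intros t Ht. apply continuous_Re, Hc, Ht.
  - intros t Ht. eapply Rle_trans; [apply re_le_Cmod | apply HM, Ht].
  - destruct (ex_real_tail (fun t => Im (f t)) e M d Hd) as [y Hy].
    + intros t Ht. apply continuous_Im, Hc, Ht.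
    + intros t Ht. eapply Rle_trans; [apply Cmod_Im | apply HM, Ht].
    + exists (x, y). intros P [k HP].
      pose proof (Hx (ball x k) (locally_ball x k)) as Q1.
      pose proof (Hy (ball y k) (locally_ball y k)) as Q2.
      unfold filtermapi in *. generalize (filter_and _ _ Q1 Q2). apply filter_imp.
      intros ab [[u [Hu Bu]] [v [Hv Bv]]]. exists (u, v). split.
      * apply is_cint_pair; assumption.
      * apply HP. split; assumption.
Qed.

(** Under [x = - t] the sign of [dx] and the exchange of the two ends cancel. *)
Lemma is_tail_reflect (f : R -> C) e l :
  is_tail (fun t => f (- t)) e l ->
  @is_RInt_gen C_R_NormedModule f (Rbar_locally m_infty) (at_point (- e)) l.
Proof.
  intros H P HP. pose proof (H P HP) as Q. unfold filtermapi in *.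
  destruct Q as [A B HA HB Q].
  apply (Filter_prod _ _ _ (fun x => B (- x)) (fun y => y = - e)).
  - destruct HB as [M HM]. exists (- M). intros x Hx. apply HM. lra.
  - reflexivity.
  - intros x y Hx ->. destruct (Q e (- x) HA Hx) as [v [Hv Pv]]. simpl in Hv |- *.
    exists v. split; [| exact Pv].
    assert (K : @is_RInt C_R_NormedModule (fun y => f (- y)) (- (- e)) (- x) v)
      by (rewrite Ropp_involutive; exact Hv).
    apply is_RInt_comp_opp in K. apply is_RInt_swap in K. apply is_RInt_opp in K.
    rewrite opp_opp in K.
    apply (is_RInt_ext (V := C_R_NormedModule)) with (2 := K).
    intros t _. cbv beta. rewrite Ropp_involutive. rewrite opp_opp. reflexivity.
Qed.

(** * The Hankel contour *)

(** The modulus forces [Re z = 0]; the half-angle formula then reduces the claim to the zeros of the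
    sine in [(- PI, PI)]. *)
Lemma Cexp_eq_1 z : Cexp z = RtoC 1 -> Cmod z < 2 * PI -> z = RtoC 0.
Proof.
  intros H Hz.
  pose proof (f_equal Cmod H) as M. rewrite Cmod_Cexp, Cmod_1 in M.
  assert (R0 : Re z = 0) by (rewrite <- (ln_exp (Re z)), M; apply ln_1).
  pose proof (f_equal Re H) as C. unfold Cexp in C. rewrite R0, exp_0 in C. simpl in C.
  assert (C1 : cos (Im z) = 1) by lra.
  pose proof (Cmod_Im z) as B. assert (B2 : Rabs (Im z) < 2 * PI) by lra. apply Rabs_def2 in B2.
  replace (Im z) with (2 * (Im z / 2)) in C1 by field. rewrite cos_2a_sin in C1.
  assert (S : sin (Im z / 2) = 0) by nra.
  assert (I0 : Im z = 0).
  { destruct (Rtotal_order (Im z) 0) as [L | [E | L]]; [| exact E |].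
    - pose proof (sin_gt_0 (- (Im z / 2)) ltac:(lra) ltac:(lra)) as Q. rewrite sin_neg in Q. lra.
    - pose proof (sin_gt_0 (Im z / 2) ltac:(lra) ltac:(lra)). lra. }
  apply Ceq; assumption.
Qed.

Lemma one_sub_Cexp_neq_0 z : 0 < Cmod z -> Cmod z < 2 * PI -> (1 - Cexp z)%C <> RtoC 0.
Proof.
  intros H0 H1 Q. apply Ceq_minus in Q. symmetry in Q. apply Cexp_eq_1 in Q; [| exact H1].
  rewrite Q, Cmod_0 in H0. lra.
Qed.

Lemma Cexp_neg_real t : Cexp (- RtoC t) = RtoC (exp (- t)).
Proof. rewrite <- RtoC_opp. apply Cexp_RtoC. Qed.

Lemma exp_neg_lt_1 t : 0 < t -> exp (- t) < 1.
Proof. intros H. rewrite <- exp_0. apply exp_increasing. lra. Qed.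

Lemma one_sub_Cexp_neg_neq_0 t : 0 < t -> (1 - Cexp (- RtoC t))%C <> RtoC 0.
Proof.
  intros H. rewrite Cexp_neg_real, <- RtoC_minus. intros Q. apply RtoC_inj in Q.
  pose proof (exp_neg_lt_1 t H). lra.
Qed.

(** The integrand without [Log z / z]: on a circle, [dz / z = i dt] absorbs the factor [1 / z]. *)
Definition hankel_kernel (a z : C) : C := (Cexp (a * z) * / (1 - Cexp z))%C.

Definition hankel_kernel' (a z : C) : C :=
  (Cexp (a * z) * a * / (1 - Cexp z) + Cexp (a * z) * (Cexp z * / ((1 - Cexp z) * (1 - Cexp z))))%C.

Lemma cderiv_hankel_kernel a z : (1 - Cexp z)%C <> RtoC 0 -> cderiv (hankel_kernel a) z (hankel_kernel' a z).
Proof.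
  intros N. unfold hankel_kernel. eapply cderiv_eq.
  - apply cderiv_mult.
    + apply cderiv_Cexp_comp, cderiv_scal, cderiv_id.
    + apply cderiv_inv; [| exact N]. apply cderiv_minus; [apply cderiv_const | apply cderiv_Cexp].
  - unfold hankel_kernel'. Cfield. exact N.
Qed.

Lemma ccont_hankel_kernel a z : (1 - Cexp z)%C <> RtoC 0 -> ccont (hankel_kernel a) z.
Proof. intros N. eapply cderiv_cont, cderiv_hankel_kernel, N. Qed.

Lemma ccont_hankel_kernel' a z : (1 - Cexp z)%C <> RtoC 0 -> ccont (hankel_kernel' a) z.
Proof.
  intros N. unfold hankel_kernel'.
  assert (C1 : ccont (fun z => Cexp (a * z))%C z).
  { eapply cderiv_cont, cderiv_Cexp_comp, cderiv_scal, cderiv_id. }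
  assert (C2 : ccont (fun z => 1 - Cexp z)%C z).
  { eapply cderiv_cont, cderiv_minus; [apply cderiv_const | apply cderiv_Cexp]. }
  pose proof (ccont_Cexp z). pose proof (Cmult_neq_0 _ _ N N). Ccont.
Qed.

Lemma rcont_hk_neg a t : 0 < t -> rcont (fun t => hankel_kernel a (- RtoC t)) t.
Proof.
  intros Ht. apply (continuous_Ccomp (fun t => - RtoC t)%C (hankel_kernel a)); [Ccont |].
  apply ccont_hankel_kernel, one_sub_Cexp_neg_neq_0, Ht.
Qed.

(** The logarithm of the radius is written with [Clog_right], so that the dependence on [u] extends
    to a complex variable and the rules for [cderiv] apply to it. *)
Definition circle_integrand (a : C) (u t : R) : C :=
  (Ci * (hankel_kernel a (circ u t) * (Clog_right (RtoC u) + Ci * RtoC t)))%C.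

Definition circle_integral (a : C) (u : R) : C := cint (circle_integrand a u) (- PI) PI.

Definition ray_integrand (a : C) (t : R) : C := (hankel_kernel a (- RtoC t) * / RtoC t)%C.

Lemma rcont_ray a t : 0 < t -> rcont (ray_integrand a) t.
Proof.
  intros Ht. apply continuous_Cmult; [apply rcont_hk_neg, Ht |].
  apply continuous_Cinv; [Ccont | apply RtoC_neq_0; lra].
Qed.

Lemma circ_one_sub_neq_0 u t : 0 < u < 2 * PI -> (1 - Cexp (circ u t))%C <> RtoC 0.
Proof. intros H. apply one_sub_Cexp_neq_0; rewrite Cmod_circ; lra. Qed.

Lemma rcont_hk_circ a u t : 0 < u < 2 * PI -> rcont (fun t => hankel_kernel a (circ u t)) t.
Proof.
  intros Hu. apply (continuous_Ccomp (circ u) (hankel_kernel a)); [apply rcont_circ | apply ccont_hankel_kernel, circ_one_sub_neq_0, Hu].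
Qed.

Lemma rcont_circle_integrand a u t : 0 < u < 2 * PI -> rcont (circle_integrand a u) t.
Proof.
  intros Hu. pose proof (rcont_hk_circ a u t Hu). unfold circle_integrand. Ccont.
Qed.

Lemma circle_integral_is a u : 0 < u < 2 * PI ->
  is_cint (circle_integrand a u) (- PI) PI (circle_integral a u).
Proof. intros Hu. apply cint_correct, ex_cint_cont. intros t _. apply rcont_circle_integrand, Hu. Qed.

Definition circle_integrand' (a : C) (u t : R) : C :=
  (Ci * (hankel_kernel' a (circ u t) * Cexp (Ci * RtoC t) * (Clog_right (RtoC u) + Ci * RtoC t)
    + hankel_kernel a (circ u t) * / RtoC u))%C.

(** Up to the factor [i u], the radial derivative of the integrand is its angular derivative;
    only the jump of the logarithm across the cut remains. *)
Lemma cint_circle_integrand' a u : 0 < u < 2 * PI ->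
  cint (circle_integrand' a u) (- PI) PI = (2 * RtoC PI * Ci * ray_integrand a u)%C.
Proof.
  intros Hu. assert (Nu : RtoC u <> RtoC 0) by (intros Q; apply RtoC_inj in Q; lra).
  apply is_cint_unique.
  set (G := fun t => (/ RtoC u * (hankel_kernel a (circ u t) * (Clog_right (RtoC u) + Ci * RtoC t)))%C).
  replace (2 * RtoC PI * Ci * ray_integrand a u)%C with (G PI - G (- PI)%R)%C.
  2:{ unfold G, ray_integrand. rewrite circ_PI, circ_mPI, RtoC_opp. ring. }
  apply is_cint_rderiv.
  - intros t _. eapply rderiv_eq.
    + apply (cderiv_line (fun w => / RtoC u * (hankel_kernel a (RtoC u * Cexp (Ci * w)) * (Clog_right (RtoC u) + Ci * w)))%C).
      apply cderiv_scal, cderiv_mult.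
      * apply (cderiv_comp (hankel_kernel a)); [apply cderiv_hankel_kernel, (circ_one_sub_neq_0 u t), Hu | apply cderiv_circ].
      * apply cderiv_plus; [apply cderiv_const | apply cderiv_scal, cderiv_id].
    + unfold circle_integrand', circ. Cfield. exact Nu.
  - intros t _. pose proof (rcont_hk_circ a u t Hu).
    assert (rcont (fun t => hankel_kernel' a (circ u t)) t).
    { apply (continuous_Ccomp (circ u) (hankel_kernel' a)); [apply rcont_circ | apply ccont_hankel_kernel', circ_one_sub_neq_0, Hu]. }
    assert (rcont (fun t => Cexp (Ci * RtoC t)) t).
    { apply (continuous_Ccomp (fun t => Ci * RtoC t)%C Cexp); [Ccont | apply ccont_Cexp]. }
    unfold circle_integrand'. Ccont.
Qed.

Lemma rderiv_circle_integral a u : 0 < u < 2 * PI ->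
  rderiv (circle_integral a) u (2 * RtoC PI * Ci * ray_integrand a u)%C.
Proof.
  intros Hu. rewrite <- cint_circle_integrand' by exact Hu.
  set (d := Rmin u (2 * PI - u)).
  assert (Pd : 0 < d) by (apply Rmin_pos; lra).
  assert (In : forall v, Rabs (v - u) < d -> 0 < v < 2 * PI).
  { intros v Hv. apply Rabs_def2 in Hv. assert (d <= u) by apply Rmin_l.
    assert (d <= 2 * PI - u) by apply Rmin_r. lra. }
  apply (cint_param_derive (circle_integrand a) (circle_integrand' a) (- PI) PI u d Pd).
  - intros v t Hv. apply In in Hv. eapply rderiv_eq.
    + apply (cderiv_line (fun w => Ci * (hankel_kernel a (w * Cexp (Ci * RtoC t)) * (Clog_right w + Ci * RtoC t)))%C).
      apply cderiv_scal, cderiv_mult.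
      * apply (cderiv_comp (hankel_kernel a)).
        -- apply cderiv_hankel_kernel, (circ_one_sub_neq_0 v t), Hv.
        -- apply cderiv_mult; [apply cderiv_id | apply cderiv_const].
      * apply cderiv_plus; [apply cderiv_Clog_right; simpl; lra | apply cderiv_const].
    + unfold circle_integrand', circ. Cring.
  - intros t. unfold circle_integrand'.
    set (T := prod_UniformSpace R_UniformSpace R_UniformSpace).
    assert (C1 : @continuous T C_UniformSpace (fun p => Cexp (Ci * RtoC (snd p)))%C (u, t)).
    { apply (continuous_Ccomp (fun p : T => RtoC (snd p)) (fun w => Cexp (Ci * w))%C).
      - apply continuous_RtoC, continuous_snd.
      - eapply cderiv_cont, cderiv_Cexp_comp, cderiv_scal, cderiv_id. }
    assert (C0 : @continuous T C_UniformSpace (fun p => RtoC (fst p)) (u, t))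
      by (apply continuous_RtoC, continuous_fst).
    assert (C2 : @continuous T C_UniformSpace (fun p => circ (fst p) (snd p)) (u, t)).
    { unfold circ. apply continuous_Cmult; [exact C0 | exact C1]. }
    assert (@continuous T C_UniformSpace (fun p => hankel_kernel' a (circ (fst p) (snd p))) (u, t)).
    { apply (continuous_Ccomp (fun p : T => circ (fst p) (snd p)) (hankel_kernel' a)); [exact C2 |].
      apply ccont_hankel_kernel', circ_one_sub_neq_0, Hu. }
    assert (@continuous T C_UniformSpace (fun p => hankel_kernel a (circ (fst p) (snd p))) (u, t)).
    { apply (continuous_Ccomp (fun p : T => circ (fst p) (snd p)) (hankel_kernel a)); [exact C2 |].
      apply ccont_hankel_kernel, circ_one_sub_neq_0, Hu. }
    assert (@continuous T C_UniformSpace (fun p => Clog_right (RtoC (fst p))) (u, t)).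
    { apply (continuous_Ccomp (fun p : T => RtoC (fst p)) Clog_right); [exact C0 |].
      apply ccont_Clog_right. simpl. lra. }
    pose proof (continuous_RtoC snd (u, t) (continuous_snd u t)).
    assert (RtoC (fst (u, t)) <> RtoC 0) by (apply RtoC_neq_0; simpl; lra).
    Ccont.
  - intros v Hv. apply ex_cint_cont. intros t _. apply rcont_circle_integrand, In, Hv.
Qed.

(** The circle gains [2 PI i] times the ray integrand per unit of radius, and the two rays together
    lose the same amount, since their logarithms differ by [2 PI i]. *)
Lemma hankel_radius_indep a u v Tu Tv : 0 < u -> u <= v -> v < 2 * PI ->
  is_tail (ray_integrand a) u Tu -> is_tail (ray_integrand a) v Tv ->
  (circle_integral a u + 2 * RtoC PI * Ci * Tu = circle_integral a v + 2 * RtoC PI * Ci * Tv)%C.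
Proof.
  intros Hu Huv Hv HTu HTv.
  assert (I : is_cint (fun t => 2 * RtoC PI * Ci * ray_integrand a t)%C u v
    (circle_integral a v - circle_integral a u)%C).
  { apply is_cint_rderiv; rewrite Rmin_left, Rmax_right by exact Huv; intros t Ht.
    - apply rderiv_circle_integral. lra.
    - apply continuous_Cmult; [apply continuous_Cconst | apply rcont_ray; lra]. }
  assert (X : ex_cint (ray_integrand a) u v).
  { apply ex_cint_cont. rewrite Rmin_left, Rmax_right by exact Huv. intros t Ht. apply rcont_ray. lra. }
  pose proof (cint_correct _ _ _ X) as I2. set (D := cint (ray_integrand a) u v) in *.
  pose proof (is_tail_unique _ _ _ _ HTu (is_tail_Chasles _ _ _ _ _ I2 HTv)) as ET.
  pose proof (is_cint_unique _ _ _ _ I) as E1.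
  rewrite (is_cint_unique _ _ _ _ (is_cint_scal (2 * RtoC PI * Ci)%C _ _ _ _ I2)) in E1.
  rewrite ET.
  replace (circle_integral a u + 2 * RtoC PI * Ci * (D + Tv))%C
    with (circle_integral a u + (2 * RtoC PI * Ci * D) + 2 * RtoC PI * Ci * Tv)%C by ring.
  rewrite E1. ring.
Qed.

Lemma hankel_kernel_neg_le a e t : 0 < e -> e <= t ->
  Cmod (hankel_kernel a (- RtoC t)) <= / (1 - exp (- e)) * exp (- Re a * t).
Proof.
  intros He Ht. unfold hankel_kernel.
  rewrite Cmod_mult, Cmod_Cexp, Cmod_inv by (apply one_sub_Cexp_neg_neq_0; lra).
  replace (Re (a * - RtoC t)) with (- Re a * t) by (unfold Re; simpl; ring).
  rewrite Cexp_neg_real, <- RtoC_minus, Cmod_R.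
  pose proof (exp_neg_lt_1 e He). pose proof (exp_neg_lt_1 t ltac:(lra)).
  rewrite Rabs_pos_eq by lra. rewrite Rmult_comm.
  apply Rmult_le_compat_r; [left; apply exp_pos |].
  apply Rinv_le_contravar; [lra |]. pose proof (exp_le (- t) (- e) ltac:(lra)). lra.
Qed.

Lemma Rabs_ln_div_le e t : 0 < e -> e <= t -> Rabs (ln t) * / t <= 1 + / (e * e).
Proof.
  intros He Ht.
  assert (L : Rabs (ln t) <= t + / t).
  { assert (0 < / t) by (apply Rinv_0_lt_compat; lra).
    pose proof (exp_ineq1_le (ln t)) as A. rewrite exp_ln in A by lra.
    pose proof (exp_ineq1_le (- ln t)) as B. rewrite exp_Ropp, exp_ln in B by lra.
    apply Rabs_le. lra. }
  apply Rle_trans with ((t + / t) * / t).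
  - apply Rmult_le_compat_r; [left; apply Rinv_0_lt_compat; lra | exact L].
  - replace ((t + / t) * / t) with (1 + / (t * t)) by (field; lra).
    apply Rplus_le_compat_l, Rinv_le_contravar; nra.
Qed.

Lemma ex_tail_ray a e : 0 < Re a -> 0 < e ->
  (exists T, is_tail (ray_integrand a) e T) /\
  (exists T, is_tail (fun t => ray_integrand a t * RtoC (ln t))%C e T).
Proof.
  intros Ha He.
  assert (PK : 0 < / (1 - exp (- e))).
  { apply Rinv_0_lt_compat. pose proof (exp_neg_lt_1 e He). lra. }
  assert (Inv : forall t, e <= t -> Cmod (/ RtoC t) = / t).
  { intros t Ht. rewrite Cmod_inv, Cmod_R, Rabs_pos_eq; [reflexivity | lra |].
    intros Q. apply RtoC_inj in Q. lra. }
  split.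
  - apply (ex_tail _ e (/ (1 - exp (- e)) * / e) (Re a) Ha).
    + intros t Ht. apply rcont_ray. lra.
    + intros t Ht. unfold ray_integrand. rewrite Cmod_mult, Inv by exact Ht.
      pose proof (hankel_kernel_neg_le a e t He Ht). rewrite (Rmult_assoc _ (/ e)), (Rmult_comm (/ e)), <- Rmult_assoc.
      apply Rmult_le_compat; [apply Cmod_ge_0 | left; apply Rinv_0_lt_compat; lra | assumption |].
      apply Rinv_le_contravar; lra.
  - apply (ex_tail _ e (/ (1 - exp (- e)) * (1 + / (e * e))) (Re a) Ha).
    + intros t Ht. apply continuous_Cmult; [apply rcont_ray; lra |].
      apply continuous_RtoC, continuous_ln. lra.
    + intros t Ht. unfold ray_integrand. rewrite !Cmod_mult, Inv, Cmod_R by exact Ht.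
      pose proof (hankel_kernel_neg_le a e t He Ht) as H1. pose proof (Rabs_ln_div_le e t He Ht) as H2.
      rewrite (Rmult_assoc (/ (1 - exp (- e)))), (Rmult_comm (1 + / (e * e))), <- Rmult_assoc.
      rewrite Rmult_assoc, (Rmult_comm (/ t)).
      apply Rmult_le_compat; try assumption; [apply Cmod_ge_0 |].
      apply Rmult_le_pos; [apply Rabs_pos | left; apply Rinv_0_lt_compat; lra].
Qed.

(** At [x = - t] both rays carry [- ray_integrand a t * (ln t + i b)], with [b = - PI] below and
    [b = PI] above. As they run in opposite directions, the parts with [ln t] cancel and the
    arguments add up to [2 PI i]. *)
Lemma hankel_int_value a e : 0 < Re a -> 0 < e < 2 * PI ->
  exists T, is_tail (ray_integrand a) e T /\
    is_hankel_int (hankel_integrand a) e (circle_integral a e + 2 * RtoC PI * Ci * T)%C.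
Proof.
  intros Ha He.
  destruct (ex_tail_ray a e Ha ltac:(lra)) as [[T HT] [L HL]].
  exists T. split; [exact HT |].
  assert (Ray : forall b : R, @is_RInt_gen C_R_NormedModule
    (fun x : R => hankel_integrand a (RtoC x) (ln (Rabs x), b))
    (Rbar_locally m_infty) (at_point (- e)) (- (1) * L - Ci * RtoC b * T)%C).
  { intros b. apply is_tail_reflect.
    apply (is_tail_ext (fun t => - (1) * (ray_integrand a t * RtoC (ln t)) - Ci * RtoC b * ray_integrand a t)%C).
    - intros t Ht. unfold hankel_integrand, ray_integrand, hankel_kernel.
      rewrite Rabs_Ropp, Rabs_pos_eq by lra.
      replace ((ln t, b) : C) with (RtoC (ln t) + Ci * RtoC b)%C by (apply Ceq; simpl; ring).
      rewrite RtoC_opp. pose proof (one_sub_Cexp_neg_neq_0 t ltac:(lra)).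
      field. split; [| assumption]. intros Q. apply RtoC_inj in Q. lra.
    - apply is_tail_minus; apply is_tail_scal; assumption. }
  exists (- (1) * L - Ci * RtoC (- PI) * T)%C, (circle_integral a e), (- (- (1) * L - Ci * RtoC PI * T))%C.
  split; [apply Ray |]. split; [| split].
  - apply (is_RInt_gen_at_point (V := C_R_NormedModule)).
    apply (is_cint_ext (circle_integrand a e)); [| apply circle_integral_is, He].
    intros t _. cbv zeta. fold (circ e t). unfold circle_integrand, hankel_integrand, hankel_kernel.
    rewrite Clog_right_RtoC by lra.
    replace ((ln e, t) : C) with (RtoC (ln e) + Ci * RtoC t)%C by (apply Ceq; simpl; ring).
    Cfield. split; [apply circ_neq_0; lra | apply circ_one_sub_neq_0, He].
  - apply (is_RInt_gen_swap (V := C_R_NormedModule)). apply Ray.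
  - rewrite RtoC_opp. ring.
Qed.

(** * Shrinking the circle *)

(** Laurent expansion at the simple pole. Over the common denominator [z * (1 - Cexp z)] the
    numerator is of third order. The radius [1 / 6] ensures [3 x^2 <= x / 2], hence the lower bound
    [x / 2] for [Cmod (1 - Cexp z)]. *)
Lemma hankel_kernel_near_0 a : exists K, 0 < K /\ forall z, 0 < Cmod z -> Cmod z <= 1 / 6 ->
  Cmod (hankel_kernel a z + / z - (1 / 2 - a)) <= K * Cmod z.
Proof.
  set (A := Cmod a). assert (PA : 0 <= A) by apply Cmod_ge_0.
  (* The three summands of [K] bound [z R1], [R2] and the last product of the numerator, each
     relative to [x^3]; the factor [2] in the witness comes from the denominator [x * (x / 2)]. *)
  set (K1 := A * A * exp A). set (K := K1 + 3 + (1 / 2 + A) * (1 / 2 + 3)).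
  assert (PK1 : 0 <= K1) by (unfold K1; pose proof (exp_pos A); apply Rmult_le_pos; [nra | lra]).
  exists (2 * K). split; [unfold K; nra |].
  intros z Hz0 Hz. set (x := Cmod z) in *.
  assert (Nz : z <> RtoC 0) by (apply Cmod_gt_0; exact Hz0).
  assert (E3 : forall w, Cmod w <= 1 -> Rmax 1 (exp (Re w)) <= 3).
  { intros w Hw. apply Rmax_lub; [lra |]. apply Rle_trans with (exp 1); [| apply exp_le_3].
    apply exp_le. pose proof (Re_le_Cmod w). lra. }
  set (R1 := (Cexp (a * z) - 1 - a * z)%C).
  set (R2 := (Cexp z - 1 - z - z * z / 2)%C).
  assert (B1 : Cmod R1 <= K1 * (x * x)).
  { eapply Rle_trans; [apply Cexp_taylor1_le |]. rewrite Cmod_mult. fold A x. unfold K1.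
    replace (A * A * exp A * (x * x)) with (A * x * (A * x) * exp A) by ring.
    apply Rmult_le_compat_l.
    - apply Rmult_le_pos; apply Rmult_le_pos; lra.
    - apply Rmax_lub.
      + rewrite <- exp_0. apply exp_le, PA.
      + apply exp_le. pose proof (Re_le_Cmod (a * z)). rewrite Cmod_mult in H. fold A x in H. nra. }
  assert (B2 : Cmod R2 <= 3 * (x * x * x)).
  { eapply Rle_trans; [apply Cexp_taylor2_le |]. fold x.
    pose proof (E3 z ltac:(fold x; lra)). assert (0 <= x * x * x) by (apply Rmult_le_pos; nra). nra. }
  assert (BD : x / 2 <= Cmod (1 - Cexp z)).
  { pose proof (Cexp_taylor1_le z) as Q. fold x in Q. pose proof (E3 z ltac:(fold x; lra)) as Q3.
    assert (Cmod (Cexp z - 1 - z) <= x / 2).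
    { assert (x * x * Rmax 1 (exp (Re z)) <= x * x * 3) by (apply Rmult_le_compat_l; nra). nra. }
    pose proof (Cmod_ge_sub (- z) (Cexp z - 1 - z)) as G. rewrite Cmod_opp in G. fold x in G.
    replace (- z - (Cexp z - 1 - z))%C with (1 - Cexp z)%C in G by ring. lra. }
  assert (ND : (1 - Cexp z)%C <> RtoC 0) by (apply Cmod_gt_0; lra).
  replace (hankel_kernel a z + / z - (1 / 2 - a))%C
    with ((z * R1 - R2 + (1 / 2 - a) * z * (z * z / 2 + R2)) * / (z * (1 - Cexp z)))%C.
  2:{ unfold R1, R2, hankel_kernel. field. split; assumption. }
  rewrite Cmod_mult, Cmod_inv, Cmod_mult by (apply Cmult_neq_0; assumption). fold x.
  assert (BN : Cmod (z * R1 - R2 + (1 / 2 - a) * z * (z * z / 2 + R2)) <= K * (x * x * x)).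
  { eapply Rle_trans; [apply Cmod_triangle |].
    pose proof (Cmod_sub_le (z * R1) R2) as T1. rewrite Cmod_mult in T1. fold x in T1.
    rewrite !Cmod_mult. fold x.
    assert (T2 : Cmod (1 / 2 - a) <= 1 / 2 + A).
    { eapply Rle_trans; [apply Cmod_sub_le |]. rewrite Cmod_half. fold A. lra. }
    assert (T3 : Cmod (z * z / 2 + R2) <= (1 / 2 + 3) * (x * x)).
    { eapply Rle_trans; [apply Cmod_triangle |].
      replace (z * z / 2)%C with (z * z * (1 / 2))%C by field.
      rewrite !Cmod_mult, Cmod_half. fold x. assert (x * x * x <= x * x) by nra. lra. }
    assert (T4 : Cmod (1 / 2 - a) * x * Cmod (z * z / 2 + R2) <= (1 / 2 + A) * x * ((1 / 2 + 3) * (x * x))).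
    { apply Rmult_le_compat; [apply Rmult_le_pos; [apply Cmod_ge_0 | lra] | apply Cmod_ge_0 | | exact T3].
      apply Rmult_le_compat_r; lra. }
    assert (T5 : x * Cmod R1 <= x * (K1 * (x * x))) by (apply Rmult_le_compat_l; lra).
    unfold K. lra. }
  apply Rle_trans with (K * (x * x * x) * / (x * (x / 2))).
  - apply Rmult_le_compat; [apply Cmod_ge_0 | | exact BN |].
    + left. apply Rinv_0_lt_compat. nra.
    + apply Rinv_le_contravar; [nra |]. apply Rmult_le_compat_l; lra.
  - right. field. lra.
Qed.

(** A sequence of radii tending to [0], so that limits are taken over [nat]; the [7] keeps them
    within the range [1 / 6] of [hankel_kernel_near_0]. *)
Definition radius (n : nat) : R := / (INR n + 7).

Lemma radius_pos n : 0 < radius n.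
Proof. apply Rinv_0_lt_compat. pose proof (pos_INR n). lra. Qed.

Lemma radius_le n : radius n <= 1 / 6.
Proof.
  unfold radius. replace (1 / 6) with (/ 6) by field. apply Rinv_le_contravar; [lra |].
  pose proof (pos_INR n). lra.
Qed.

Lemma radius_lt_2PI n : radius n < 2 * PI.
Proof. pose proof (radius_le n). pose proof PI2_1. lra. Qed.

Lemma is_lim_seq_radius : is_lim_seq radius 0.
Proof.
  unfold radius. replace (Finite 0) with (Rbar_inv p_infty) by reflexivity.
  apply is_lim_seq_inv; [| discriminate].
  apply (is_lim_seq_plus INR (fun _ => 7) p_infty 7 p_infty);
    [apply is_lim_seq_INR | apply is_lim_seq_const | reflexivity].
Qed.

Lemma is_lim_seq_radius_ln : is_lim_seq (fun n => radius n * Rabs (ln (radius n))) 0.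
Proof.
  apply (is_lim_seq_ext (fun n => ln (INR n + 7) / (INR n + 7))).
  - intros n. unfold radius. pose proof (pos_INR n). rewrite ln_Rinv by lra.
    assert (0 <= ln (INR n + 7)) by (rewrite <- ln_1; apply ln_le; lra).
    rewrite Rabs_Ropp, Rabs_pos_eq by assumption. unfold Rdiv. ring.
  - apply (filterlim_comp _ _ _ (fun n => INR n + 7) (fun y => ln y / y) _ (Rbar_locally p_infty));
      [| exact is_lim_div_ln_p].
    apply (is_lim_seq_plus INR (fun _ => 7) p_infty 7 p_infty);
      [apply is_lim_seq_INR | apply is_lim_seq_const | reflexivity].
Qed.

Lemma cint_circle_main u c : 0 < u ->
  is_cint (fun t => Ci * ((- / circ u t + c) * (RtoC (ln u) + Ci * RtoC t)))%C (- PI) PI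
    (2 * RtoC PI * Ci * (c * RtoC (ln u) - / RtoC u))%C.
Proof.
  intros Hu. assert (Nu : RtoC u <> RtoC 0) by (intros Q; apply RtoC_inj in Q; lra).
  (* The first part comes from integrating [exp (- i w) (ln u + i w)] by parts. The primitive is
     written for a complex [w], so that it can be differentiated with the rules for [cderiv]. *)
  set (G := fun w => (- (Ci * / RtoC u) * (Cexp (- (Ci) * w) * (Ci * (RtoC (ln u) + 1) - w))
    + c * (Ci * RtoC (ln u) * w - w * w / 2))%C).
  assert (EP : Cexp (- Ci * RtoC PI) = (- (1))%C).
  { replace (- Ci * RtoC PI)%C with (Ci * RtoC (- PI))%C by (rewrite RtoC_opp; ring).
    pose proof (circ_mPI 1) as Q. unfold circ in Q. rewrite Cmult_1_l in Q. exact Q. }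
  assert (EM : Cexp (- Ci * RtoC (- PI)) = (- (1))%C).
  { replace (- Ci * RtoC (- PI))%C with (Ci * RtoC PI)%C by (rewrite RtoC_opp; ring).
    pose proof (circ_PI 1) as Q. unfold circ in Q. rewrite Cmult_1_l in Q. exact Q. }
  replace (2 * RtoC PI * Ci * (c * RtoC (ln u) - / RtoC u))%C with (G (RtoC PI) - G (RtoC (- PI)))%C.
  2:{ unfold G. rewrite EP, EM, RtoC_opp. field. exact Nu. }
  apply (is_cint_rderiv (fun t => G (RtoC t))).
  - intros t _. eapply rderiv_eq.
    + apply cderiv_line. unfold G. apply cderiv_plus.
      * apply cderiv_scal, cderiv_mult.
        -- apply cderiv_Cexp_comp, cderiv_scal, cderiv_id.
        -- apply cderiv_minus; [apply cderiv_const | apply cderiv_id].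
      * apply cderiv_scal, cderiv_minus; [apply cderiv_scal, cderiv_id |].
        apply (cderiv_mult (fun w => w * w)%C (fun _ => / 2)%C); [| apply cderiv_const].
        apply cderiv_mult; apply cderiv_id.
    + unfold circ. replace (- Ci * RtoC t)%C with (- (Ci * RtoC t))%C by ring.
      rewrite Cexp_opp. pose proof (Cexp_neq_0 (Ci * RtoC t)).
      set (e := Cexp (Ci * RtoC t)) in *.
      assert (I2 : (Ci * Ci = - (1))%C) by (apply Ceq; simpl; ring).
      (* To [field], [Ci] is an indeterminate; the two sides differ by a multiple of [Ci * Ci + 1],
         which is made explicit and then removed. *)
      transitivity (Ci * ((- / (RtoC u * e) + c) * (RtoC (ln u) + Ci * RtoC t))
        + (Ci * Ci + 1) * (Ci * (RtoC (ln u) + 1) / (RtoC u * e) - c * RtoC t))%C.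
      * Cfield. split; assumption.
      * rewrite I2. Cring.
  - intros t _. pose proof (circ_neq_0 u t Hu). Ccont.
Qed.

Lemma circle_integral_asymp a :
  clim (fun n => circle_integral a (radius n)
    - 2 * RtoC PI * Ci * ((1 / 2 - a) * RtoC (ln (radius n)) - / RtoC (radius n)))%C 0.
Proof.
  destruct (hankel_kernel_near_0 a) as [K [PK HK]]. pose proof PI_RGT_0 as HPI.
  apply clim_le with (fun n => (PI - - PI) * K * (radius n * Rabs (ln (radius n)) + PI * radius n)).
  2:{ apply is_lim_seq_scal0, is_lim_seq_plus0; [apply is_lim_seq_radius_ln |].
      apply is_lim_seq_scal0, is_lim_seq_radius. }
  intros n. pose proof (radius_pos n) as P. pose proof (radius_le n) as L. pose proof (radius_lt_2PI n).
  set (u := radius n) in *.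
  pose proof (is_cint_minus _ _ _ _ _ _ (circle_integral_is a u ltac:(lra))
    (cint_circle_main u (1 / 2 - a)%C P)) as I.
  unfold Cminus at 1. rewrite Copp_0, Cplus_0_r.
  rewrite Rmult_assoc. refine (is_cint_Cmod_le _ _ _ _ _ _ _ I); [lra |].
  intros t Ht. unfold circle_integrand. rewrite Clog_right_RtoC by exact P.
  replace (Ci * (hankel_kernel a (circ u t) * (RtoC (ln u) + Ci * RtoC t)) -
    Ci * ((- / circ u t + (1 / 2 - a)) * (RtoC (ln u) + Ci * RtoC t)))%C
    with (Ci * ((hankel_kernel a (circ u t) + / circ u t - (1 / 2 - a)) * (RtoC (ln u) + Ci * RtoC t)))%C by ring.
  rewrite !Cmod_mult, Cmod_Ci, Rmult_1_l.
  pose proof (HK (circ u t)) as B. rewrite Cmod_circ in B by exact P. specialize (B P L).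
  assert (B2 : Cmod (RtoC (ln u) + Ci * RtoC t) <= Rabs (ln u) + PI).
  { eapply Rle_trans; [apply Cmod_triangle |]. rewrite Cmod_mult, Cmod_Ci, !Cmod_R.
    assert (Rabs t <= PI) by (apply Rabs_le; lra). lra. }
  replace (K * (u * Rabs (ln u) + PI * u)) with (K * u * (Rabs (ln u) + PI)) by ring.
  apply Rmult_le_compat; try assumption; apply Cmod_ge_0.
Qed.

Definition tail_int (f : R -> C) (e : R) : C :=
  @RInt_gen C_R_CompleteNormedModule f (at_point e) (Rbar_locally p_infty).

Lemma is_tail_int f e l : is_tail f e l -> tail_int f e = l.
Proof. intros H. exact (is_RInt_gen_unique (V := C_R_CompleteNormedModule) _ _ H). Qed.

Definition ray_int (e : R) (a : C) : C := tail_int (ray_integrand a) e.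

Lemma ray_int_correct e a : 0 < Re a -> 0 < e -> is_tail (ray_integrand a) e (ray_int e a).
Proof.
  intros Ha He. destruct (ex_tail_ray a e Ha He) as [[T HT] _].
  unfold ray_int. rewrite (is_tail_int _ _ _ HT). exact HT.
Qed.

(** Radius independence equates the contour value at [e] with the one at each [radius n], where the
    circle is known up to a null sequence. *)
Lemma hankel_limit a e T : 0 < Re a -> 0 < e < 2 * PI -> is_tail (ray_integrand a) e T ->
  clim (fun n => ray_int (radius n) a - / RtoC (radius n) + (1 / 2 - a) * RtoC (ln (radius n)))%C
    (/ (2 * RtoC PI * Ci) * (circle_integral a e + 2 * RtoC PI * Ci * T))%C.
Proof.
  intros Ha He HT.
  set (J := (circle_integral a e + 2 * RtoC PI * Ci * T)%C).
  assert (N : (2 * RtoC PI * Ci)%C <> RtoC 0).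
  { apply Cmult_neq_0; [| apply Ci_nz]. rewrite <- RtoC_mult. apply RtoC_2PI_neq_0. }
  assert (EJ : forall n, J = (circle_integral a (radius n) + 2 * RtoC PI * Ci * ray_int (radius n) a)%C).
  { intros n. pose proof (radius_pos n) as P. pose proof (radius_lt_2PI n) as L.
    pose proof (ray_int_correct (radius n) a Ha P) as HTn.
    destruct (Rle_lt_dec e (radius n)) as [Q | Q].
    - apply hankel_radius_indep; try assumption; lra.
    - symmetry. apply hankel_radius_indep; try assumption; lra. }
  pose proof (clim_minus _ _ _ _ (clim_const J) (circle_integral_asymp a)) as L.
  apply (clim_scal (/ (2 * RtoC PI * Ci))%C) in L.
  replace (/ (2 * RtoC PI * Ci) * J)%C with (/ (2 * RtoC PI * Ci) * (J - 0))%C by ring.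
  eapply clim_ext; [| exact L]. intros n. cbv beta. rewrite (EJ n) at 1.
  assert (RtoC (radius n) <> RtoC 0) by (intros Q; apply RtoC_inj in Q; pose proof (radius_pos n); lra).
  field. repeat split; try assumption; [apply Ci_nz |].
  intros Q. apply RtoC_inj in Q. pose proof PI_RGT_0. lra.
Qed.

(** * Exponential integrals *)

(** Written with [b * - t] so as to be convertible to the exponential in [hankel_kernel b (- t)], on
    which later uses of [change] rely. *)
Definition decay (b : C) (t : R) : C := Cexp (b * - RtoC t).

Lemma Cmod_decay b t : Cmod (decay b t) = exp (- Re b * t).
Proof. unfold decay. rewrite Cmod_Cexp. f_equal. unfold Re; simpl; ring. Qed.

Lemma decay_plus b c t : decay (b + c) t = (decay b t * decay c t)%C.
Proof. unfold decay. rewrite <- Cexp_plus. f_equal. ring. Qed.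

Lemma cderiv_decay b w : cderiv (fun w => Cexp (b * - w))%C w (Cexp (b * - w) * - b)%C.
Proof.
  eapply cderiv_eq; [apply cderiv_Cexp_comp, cderiv_scal, cderiv_opp, cderiv_id |]. Cring.
Qed.

Lemma rcont_decay b t : rcont (decay b) t.
Proof. apply (ccont_line (fun w => Cexp (b * - w))%C). eapply cderiv_cont, cderiv_decay. Qed.

#[global] Hint Resolve rcont_decay : ccont.

Lemma exp_neg_eventually_lt c d : 0 < c -> 0 < d -> exists X, forall t, X < t -> exp (- c * t) < d.
Proof.
  intros Hc Hd. exists (- ln d / c). intros t Ht.
  rewrite <- (exp_ln d) by exact Hd. apply exp_increasing.
  apply Rlt_div_l in Ht; [| exact Hc]. lra.
Qed.

Lemma is_tail_decay b e : 0 < Re b -> is_tail (decay b) e (decay b e / b)%C.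
Proof.
  intros Hb. assert (Nb : b <> RtoC 0) by (apply Re_pos_neq_0, Hb).
  replace (decay b e / b)%C with (- (- / b * decay b e))%C by (field; exact Nb).
  apply (is_tail_derive (fun t => - / b * decay b t)%C).
  - intros t _. eapply rderiv_eq.
    + apply (cderiv_line (fun w => - / b * Cexp (b * - w))%C). apply cderiv_scal, cderiv_decay.
    + unfold decay. Cfield. exact Nb.
  - intros t _. apply rcont_decay.
  - intros d Hd. assert (P : 0 < Cmod (- / b)).
    { rewrite Cmod_opp, Cmod_inv by exact Nb. apply Rinv_0_lt_compat, Cmod_gt_0, Nb. }
    destruct (exp_neg_eventually_lt (Re b) (d / Cmod (- / b)) Hb ltac:(apply Rdiv_lt_0_compat; assumption)) as [X HX].
    exists X. intros t Ht. rewrite Cmod_mult, Cmod_decay. specialize (HX t Ht).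
    apply Rlt_div_r in HX; [| exact P]. lra.
Qed.

(** The exponential integral [E_1 (b e)]. *)
Definition exp_int (e : R) (b : C) : C := tail_int (fun t => decay b t * / RtoC t)%C e.

(** Raising [b] by [1] multiplies the integrand by [exp (- t)], so the difference cancels the
    denominator [1 - exp (- t)]. This is the telescoping step that turns ray integrals into
    exponential integrals. *)
Lemma ray_integrand_diff b t : 0 < t ->
  (ray_integrand b t - ray_integrand (b + 1) t = decay b t * / RtoC t)%C.
Proof.
  intros Ht. unfold ray_integrand, hankel_kernel. change (Cexp (b * - RtoC t)) with (decay b t).
  change (Cexp ((b + 1) * - RtoC t)) with (decay (b + 1) t). rewrite decay_plus.
  replace (decay 1 t) with (Cexp (- RtoC t)) by (unfold decay; f_equal; ring).
  pose proof (one_sub_Cexp_neg_neq_0 t Ht). field. split; [apply RtoC_neq_0; lra | assumption].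
Qed.

Lemma Re_add_1 b : Re (b + 1) = Re b + 1.
Proof. unfold Re; simpl; ring. Qed.

Lemma exp_int_ray e b : 0 < Re b -> 0 < e ->
  is_tail (fun t => decay b t * / RtoC t)%C e (exp_int e b) /\
  (exp_int e b = ray_int e b - ray_int e (b + 1))%C.
Proof.
  intros Hb He.
  assert (H : is_tail (fun t => decay b t * / RtoC t)%C e (ray_int e b - ray_int e (b + 1))%C).
  { apply (is_tail_ext (fun t => ray_integrand b t - ray_integrand (b + 1) t)%C).
    - intros t Ht. apply ray_integrand_diff. lra.
    - apply is_tail_minus; apply ray_int_correct; rewrite ?Re_add_1; lra. }
  unfold exp_int. rewrite (is_tail_int _ _ _ H). split; [exact H | reflexivity].
Qed.

Lemma is_tail_decay_sqr e b : 0 < Re b -> 0 < e ->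
  is_tail (fun t => decay b t * / (RtoC t * RtoC t))%C e (decay b e / RtoC e - b * exp_int e b)%C.
Proof.
  intros Hb He. destruct (exp_int_ray e b Hb He) as [HE _].
  assert (H : is_tail (fun t => - b * (decay b t * / RtoC t) - decay b t * / (RtoC t * RtoC t))%C e
    (- (decay b e * / RtoC e))%C).
  { apply (is_tail_derive (fun t => decay b t * / RtoC t)%C).
    - intros t Ht. assert (RtoC t <> RtoC 0) by (apply RtoC_neq_0; lra). eapply rderiv_eq.
      + apply (cderiv_line (fun w => Cexp (b * - w) * / w)%C).
        apply cderiv_mult; [apply cderiv_decay | apply cderiv_inv; [apply cderiv_id | assumption]].
      + unfold decay. Cfield. assumption.
    - intros t Ht.
      assert (RtoC t <> RtoC 0) as Nt by (apply RtoC_neq_0; lra). pose proof (Cmult_neq_0 _ _ Nt Nt). Ccont.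
    - intros d Hd. destruct (exp_neg_eventually_lt (Re b) (d * e) Hb ltac:(nra)) as [X HX].
      exists (Rmax e X). intros t Ht.
      assert (e < t) by (eapply Rle_lt_trans; [apply Rmax_l | exact Ht]).
      assert (X < t) by (eapply Rle_lt_trans; [apply Rmax_r | exact Ht]).
      rewrite Cmod_mult, Cmod_decay, Cmod_inv, Cmod_R, Rabs_pos_eq by (try apply RtoC_neq_0; lra).
      specialize (HX t H0). apply Rlt_div_l; [lra |]. apply Rlt_le_trans with (d * e); [exact HX |].
      apply Rmult_le_compat_l; lra. }
  pose proof (is_tail_minus _ _ _ _ _ (is_tail_scal (- b)%C _ _ _ HE) H) as H2.
  replace (decay b e / RtoC e - b * exp_int e b)%C
    with (- b * exp_int e b - - (decay b e * / RtoC e))%C by (unfold Cdiv; ring).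
  apply (is_tail_ext _ _ _ _) with (2 := H2). intros t Ht. cbv beta. ring.
Qed.

(** The function [1 / (e^t - 1) - 1 / t + 1 / 2] of Binet's formula. *)
Definition binet (t : R) : C := (/ (1 - Cexp (- RtoC t)) - / RtoC t - 1 / 2)%C.

(** Up to [1 / 6] this is the expansion of [hankel_kernel 0] at [- t], which gives [K t]; beyond,
    each term is bounded separately. The quotient by [t] is for [binet_rem], the function itself for
    [digamma_rem]. *)
Lemma binet_bound : exists M, 0 < M /\ forall t, 0 < t ->
  Cmod (binet t) <= M /\ Cmod (binet t) * / t <= M.
Proof.
  destruct (hankel_kernel_near_0 0) as [K [PK HK]].
  set (M1 := / (1 - exp (- (1 / 6))) + 7).
  assert (PM1 : 0 < M1).
  { pose proof (exp_neg_lt_1 (1 / 6) ltac:(lra)).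
    assert (0 < / (1 - exp (- (1 / 6)))) by (apply Rinv_0_lt_compat; lra). unfold M1. lra. }
  exists (Rmax K (6 * M1)). split; [eapply Rlt_le_trans; [exact PK | apply Rmax_l] |].
  intros t Ht.
  assert (Nt : RtoC t <> RtoC 0) by (apply RtoC_neq_0; lra).
  destruct (Rle_lt_dec t (1 / 6)) as [L | L].
  - pose proof (HK (- RtoC t)%C) as B. rewrite Cmod_opp, Cmod_R, Rabs_pos_eq in B by lra.
    specialize (B Ht L).
    replace (hankel_kernel 0 (- RtoC t) + / - RtoC t - (1 / 2 - 0))%C with (binet t) in B.
    2:{ unfold binet, hankel_kernel. rewrite Cmult_0_l, Cexp_0. pose proof (one_sub_Cexp_neg_neq_0 t Ht).
        field. split; assumption. }
    assert (Kt : K * t <= K) by nra.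
    split; (eapply Rle_trans; [| apply Rmax_l]); [lra |].
    apply Rle_div_l; [exact Ht | exact B].
  - assert (B : Cmod (binet t) <= M1).
    { unfold binet. eapply Rle_trans; [apply Cmod_sub_le |].
      pose proof (Cmod_sub_le (/ (1 - Cexp (- RtoC t))) (/ RtoC t)) as Q.
      pose proof (exp_neg_lt_1 (1 / 6) ltac:(lra)). pose proof (exp_neg_lt_1 t ltac:(lra)).
      assert (Cw : Cmod (1 - Cexp (- RtoC t)) = 1 - exp (- t)).
      { rewrite Cexp_neg_real, <- RtoC_minus, Cmod_R. apply Rabs_pos_eq. lra. }
      rewrite !Cmod_inv, Cw, Cmod_R, Rabs_pos_eq in Q by (try apply one_sub_Cexp_neg_neq_0; try assumption; lra).
      assert (/ (1 - exp (- t)) <= / (1 - exp (- (1 / 6)))).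
      { apply Rinv_le_contravar; [lra |]. pose proof (exp_le (- t) (- (1 / 6)) ltac:(lra)). lra. }
      assert (/ t <= 6).
      { replace 6 with (/ (1 / 6)) by field. apply Rinv_le_contravar; lra. }
      unfold M1. rewrite Cmod_half. lra. }
    assert (/ t <= 6).
    { replace 6 with (/ (1 / 6)) by field. apply Rinv_le_contravar; lra. }
    split; (eapply Rle_trans; [| apply Rmax_r]); [lra |].
    rewrite Rmult_comm. apply Rmult_le_compat; try lra; [left; apply Rinv_0_lt_compat; lra | apply Cmod_ge_0].
Qed.

Lemma is_tail_decay_le f b e l M :
  0 < Re b -> 0 < e -> 0 <= M -> (forall t, 0 < t -> Cmod (f t) <= M) ->
  is_tail (fun t => decay b t * f t)%C e l -> Cmod l <= M / Re b.
Proof.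
  intros Hb He PM HM H.
  eapply Rle_trans; [apply (is_tail_bound _ e l M (Re b) Hb) with (2 := H) |].
  - intros t Ht. rewrite Cmod_mult, Cmod_decay, Rmult_comm.
    apply Rmult_le_compat_r; [left; apply exp_pos | apply HM; lra].
  - assert (exp (- Re b * e) <= 1).
    { rewrite <- exp_0. apply exp_le. nra. }
    unfold Rdiv. apply Rmult_le_compat_r; [left; apply Rinv_0_lt_compat, Hb |]. nra.
Qed.

(** The integral of [exp (- b t) binet t / t] from [e] on, once [is_tail_decay_sqr] has integrated
    the term in [1 / t^2] by parts. *)
Definition binet_rem (e : R) (b : C) : C :=
  (ray_int e b - decay b e / RtoC e - (1 / 2 - b) * exp_int e b)%C.

(** The constant does not depend on [e], which is what [clim_approx] needs to let [e] tend to [0]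
    before [N] tends to infinity. *)
Lemma binet_rem_le : exists M, 0 < M /\ forall e b, 0 < Re b -> 0 < e -> Cmod (binet_rem e b) <= M / Re b.
Proof.
  destruct binet_bound as [M [PM HM]]. exists M. split; [exact PM |]. intros e b Hb He.
  apply (is_tail_decay_le (fun t => binet t * / RtoC t)%C b e _ M Hb He ltac:(lra)).
  - intros t Ht. rewrite Cmod_mult, Cmod_inv, Cmod_R, Rabs_pos_eq by (try apply RtoC_neq_0; lra).
    apply HM, Ht.
  - destruct (exp_int_ray e b Hb He) as [HE _].
    pose proof (is_tail_minus _ _ _ _ _
      (is_tail_minus _ _ _ _ _ (ray_int_correct e b Hb He) (is_tail_decay_sqr e b Hb He))
      (is_tail_scal (1 / 2)%C _ _ _ HE)) as H.
    replace (binet_rem e b) with (ray_int e b - (decay b e / RtoC e - b * exp_int e b) - 1 / 2 * exp_int e b)%C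
      by (unfold binet_rem; ring).
    apply (is_tail_ext _ _ _ _) with (2 := H). intros t Ht.
    unfold ray_integrand, hankel_kernel, binet. change (Cexp (b * - RtoC t)) with (decay b t).
    pose proof (one_sub_Cexp_neg_neq_0 t ltac:(lra)). field. split; [apply RtoC_neq_0; lra | assumption].
Qed.

(** Together with [exp_int e 1] it forms Gauss's integral for the digamma function, cut off at
    [e]. *)
Definition geom_int (e : R) (b : C) : C := tail_int (fun t => hankel_kernel b (- RtoC t)) e.

Lemma geom_int_correct e b : 0 < Re b -> 0 < e ->
  is_tail (fun t => hankel_kernel b (- RtoC t)) e (geom_int e b).
Proof.
  intros Hb He.
  destruct (ex_tail (fun t => hankel_kernel b (- RtoC t)) e (/ (1 - exp (- e))) (Re b) Hb) as [l Hl].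
  - intros t Ht. apply rcont_hk_neg. lra.
  - intros t Ht. apply hankel_kernel_neg_le; assumption.
  - replace (geom_int e b) with l; [exact Hl | symmetry; exact (is_tail_int _ _ _ Hl)].
Qed.

Lemma geom_int_rec e b : 0 < Re b -> 0 < e ->
  (geom_int e b - geom_int e (b + 1) = decay b e / b)%C.
Proof.
  intros Hb He. apply (is_tail_unique (decay b) e); [| apply is_tail_decay, Hb].
  apply (is_tail_ext (fun t => hankel_kernel b (- RtoC t) - hankel_kernel (b + 1) (- RtoC t))%C).
  - intros t Ht. unfold hankel_kernel. change (Cexp (b * - RtoC t)) with (decay b t).
    change (Cexp ((b + 1) * - RtoC t)) with (decay (b + 1) t). rewrite decay_plus.
    replace (decay 1 t) with (Cexp (- RtoC t)) by (unfold decay; f_equal; ring).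
    pose proof (one_sub_Cexp_neg_neq_0 t ltac:(lra)). field. assumption.
  - apply is_tail_minus; apply geom_int_correct; rewrite ?Re_add_1; lra.
Qed.

(** Here the primitive is [ln (1 - exp (- t))]; this closed form anchors the evaluation of Euler's
    constant. *)
Lemma geom_int_1 e : 0 < e -> geom_int e 1 = RtoC (- ln (1 - exp (- e))).
Proof.
  intros He. pose proof (exp_neg_lt_1 e He) as L.
  assert (P1 : 0 < Re 1) by (simpl; lra).
  apply (is_tail_unique (fun t => hankel_kernel 1 (- RtoC t)) e); [apply geom_int_correct; assumption |].
  rewrite RtoC_opp.
  apply (is_tail_derive (fun t => RtoC (ln (1 - exp (- t))))).
  - intros t Ht. pose proof (exp_neg_lt_1 t ltac:(lra)).
    replace (hankel_kernel 1 (- RtoC t)) with (RtoC (exp (- t) / (1 - exp (- t)))).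
    + split; simpl.
      * auto_derive; [lra |]. field. lra.
      * apply @is_derive_const.
    + unfold hankel_kernel. replace (1 * - RtoC t)%C with (- RtoC t)%C by ring.
      rewrite !Cexp_neg_real, <- RtoC_minus, RtoC_div by lra. reflexivity.
  - intros t Ht. apply rcont_hk_neg. lra.
  - intros d Hd.
    (* The wanted [ln (1 - exp (- t)) > - d] means [exp (- t) < 1 - exp (- d)]. *)
    destruct (exp_neg_eventually_lt 1 (1 - exp (- d)) ltac:(lra)) as [X HX].
    { pose proof (exp_neg_lt_1 d Hd). lra. }
    exists (Rmax 0 X). intros t Ht.
    assert (0 < t) by (eapply Rle_lt_trans; [apply Rmax_l | exact Ht]).
    assert (X < t) by (eapply Rle_lt_trans; [apply Rmax_r | exact Ht]).
    specialize (HX t H0). replace (- (1) * t) with (- t) in HX by ring.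
    pose proof (exp_neg_lt_1 t H). pose proof (exp_pos (- t)). rewrite Cmod_R.
    assert (ln (1 - exp (- t)) < 0) by (rewrite <- ln_1; apply ln_increasing; lra).
    rewrite Rabs_left by assumption.
    assert (- d < ln (1 - exp (- t))); [| lra].
    rewrite <- (ln_exp (- d)). apply ln_increasing; [apply exp_pos | lra].
Qed.

Definition digamma_rem (e : R) (b : C) : C :=
  (geom_int e b - exp_int e b - 1 / 2 * (decay b e / b))%C.

Lemma digamma_rem_le : exists M, 0 < M /\ forall e b, 0 < Re b -> 0 < e -> Cmod (digamma_rem e b) <= M / Re b.
Proof.
  destruct binet_bound as [M [PM HM]]. exists M. split; [exact PM |]. intros e b Hb He.
  apply (is_tail_decay_le binet b e _ M Hb He ltac:(lra)); [apply HM |].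
  destruct (exp_int_ray e b Hb He) as [HE _].
  pose proof (is_tail_minus _ _ _ _ _
    (is_tail_minus _ _ _ _ _ (geom_int_correct e b Hb He) HE)
    (is_tail_scal (1 / 2)%C _ _ _ (is_tail_decay b e Hb))) as H.
  apply (is_tail_ext _ _ _ _) with (2 := H). intros t Ht.
  unfold hankel_kernel, binet. change (Cexp (b * - RtoC t)) with (decay b t).
  pose proof (one_sub_Cexp_neg_neq_0 t ltac:(lra)). field. split; [apply RtoC_neq_0; lra | assumption].
Qed.

(** * Frullani's integral *)

Lemma rderiv_plus f g t l m :
  rderiv f t l -> rderiv g t m -> rderiv (fun s => f s + g s)%C t (l + m)%C.
Proof.
  intros [F1 F2] [G1 G2]. split.
  - exact (is_derive_plus _ _ _ _ _ F1 G1).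
  - exact (is_derive_plus _ _ _ _ _ F2 G2).
Qed.

Lemma le_exp_mul c t : 0 < c -> t <= / c * exp (c * t).
Proof.
  intros Hc. pose proof (exp_ineq1_le (c * t)).
  apply Rmult_le_reg_l with c; [exact Hc |]. rewrite <- Rmult_assoc, Rinv_r by lra. lra.
Qed.

(** This carries out differentiation under the improper integral in [b]. After division by [t], the
    Taylor remainder of the exponential leaves one factor [t], which is absorbed by giving up half
    of the decay [exp (- 2 beta t)]. *)
Lemma exp_int_taylor e p q beta : 0 < e -> 0 < beta -> 2 * beta <= Re p -> 2 * beta <= Re q ->
  Cmod (exp_int e q - exp_int e p + (q - p) * (decay p e / p)) <=
    / (beta * beta) * (Cmod (q - p) * Cmod (q - p)).
Proof.
  intros He Hbeta Hp Hq.
  destruct (exp_int_ray e p ltac:(lra) He) as [Ep _]. destruct (exp_int_ray e q ltac:(lra) He) as [Eq _].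
  pose proof (is_tail_plus _ _ _ _ _ (is_tail_minus _ _ _ _ _ Eq Ep)
    (is_tail_scal (q - p)%C _ _ _ (is_tail_decay p e ltac:(lra)))) as H.
  set (x := Cmod (q - p)). assert (Px : 0 <= x) by apply Cmod_ge_0.
  eapply Rle_trans.
  { apply (is_tail_bound _ e _ (/ beta * (x * x)) beta Hbeta) with (2 := H).
    intros t Ht. assert (Pt : 0 < t) by lra.
    assert (Nt : RtoC t <> RtoC 0) by (apply RtoC_neq_0; lra).
    set (w := ((q - p) * - RtoC t)%C).
    replace (decay q t * / RtoC t - decay p t * / RtoC t + (q - p) * decay p t)%C
      with (decay p t * (Cexp w - 1 - w) * / RtoC t)%C.
    2:{ replace (decay q t) with (decay p t * Cexp w)%C.
        - unfold w. field. exact Nt.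
        - unfold decay, w. rewrite <- Cexp_plus. f_equal. ring. }
    rewrite !Cmod_mult, Cmod_inv, Cmod_R, Rabs_pos_eq, Cmod_decay by (try assumption; lra).
    pose proof (Cexp_taylor1_le w) as T.
    assert (Cw : Cmod w = x * t).
    { unfold w. rewrite Cmod_mult, Cmod_opp, Cmod_R, Rabs_pos_eq by lra. reflexivity. }
    rewrite Cw in T.
    assert (M : exp (- Re p * t) * Rmax 1 (exp (Re w)) <= exp (- (2 * beta) * t)).
    { apply Rmax_case.
      - rewrite Rmult_1_r. apply exp_le. nra.
      - rewrite <- exp_plus. apply exp_le. replace (Re w) with (- (Re q - Re p) * t)
          by (unfold w, Re; simpl; ring). nra. }
    apply Rle_trans with (x * x * t * exp (- (2 * beta) * t)).
    - apply Rle_trans with (exp (- Re p * t) * (x * t * (x * t) * Rmax 1 (exp (Re w))) * / t).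
      + apply Rmult_le_compat_r; [left; apply Rinv_0_lt_compat; lra |].
        apply Rmult_le_compat_l; [left; apply exp_pos | exact T].
      + replace (exp (- Re p * t) * (x * t * (x * t) * Rmax 1 (exp (Re w))) * / t)
          with (x * x * t * (exp (- Re p * t) * Rmax 1 (exp (Re w)))) by (field; lra).
        apply Rmult_le_compat_l; [| exact M]. apply Rmult_le_pos; [nra | lra].
    - pose proof (le_exp_mul beta t Hbeta) as L.
      replace (- beta * t) with (beta * t + - (2 * beta) * t) by ring. rewrite exp_plus.
      pose proof (exp_pos (- (2 * beta) * t)) as P2.
      assert (0 <= x * x) by nra.
      apply Rle_trans with (x * x * (/ beta * exp (beta * t)) * exp (- (2 * beta) * t)); [| right; ring].
      apply Rmult_le_compat_r; [lra |]. apply Rmult_le_compat_l; assumption. }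
  assert (E1 : exp (- beta * e) <= 1).
  { rewrite <- exp_0. apply exp_le. nra. }
  replace (/ (beta * beta) * (x * x)) with (/ beta * (x * x) * 1 / beta) by (field; lra).
  unfold Rdiv. apply Rmult_le_compat_r; [left; apply Rinv_0_lt_compat, Hbeta |].
  apply Rmult_le_compat_l; [| exact E1].
  apply Rmult_le_pos; [left; apply Rinv_0_lt_compat, Hbeta | nra].
Qed.

(** Along the segment from [1] to [b] the left-hand side has derivative
    [(b - 1) (1 - exp (- p e)) / p], of modulus at most [|b - 1| e]. *)
Lemma frullani e b : 0 < e -> 0 < Re b ->
  Cmod (exp_int e b - exp_int e 1 + Clog_right b) <= Cmod (b - 1) * e.
Proof.
  intros He Hb.
  set (p := fun s : R => (1 + RtoC s * (b - 1))%C).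
  set (m := Rmin 1 (Re b)). assert (Pm : 0 < m) by (apply Rmin_pos; lra).
  assert (Rp : forall s, Re (p s) = 1 + s * (Re b - 1)) by (intros s; unfold p, Re; simpl; ring).
  assert (Lp : forall s, 0 <= s <= 1 -> m <= Re (p s)).
  { intros s Hs. rewrite Rp. assert (m <= 1) by apply Rmin_l. assert (m <= Re b) by apply Rmin_r. nra. }
  assert (D1 : forall s, 0 <= s <= 1 ->
    rderiv (fun s => exp_int e (p s)) s (- (b - 1) * (decay (p s) e / p s))%C).
  { intros s Hs. pose proof (Lp s Hs) as Ls.
    set (x := Cmod (b - 1)). assert (Px : 0 <= x) by apply Cmod_ge_0.
    set (K := / (m / 4 * (m / 4)) * (x * x)).
    assert (PK : 0 <= K).
    { apply Rmult_le_pos; [left; apply Rinv_0_lt_compat; nra | nra]. }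
    apply rderiv_eps. intros d Hd.
    (* The first bound keeps [Re (p u) >= m / 2], as [exp_int_taylor] with [beta = m / 4] requires;
       the second makes [K * Rabs (u - s)] at most [d]. Adding [1] keeps the denominators
       positive. *)
    exists (Rmin (m / 2 / (x + 1)) (d / (K + 1))). split.
    { apply Rmin_pos; apply Rdiv_lt_0_compat; lra. }
    intros u Hu.
    assert (H1 : Rabs (u - s) < m / 2 / (x + 1)) by (eapply Rlt_le_trans; [exact Hu | apply Rmin_l]).
    assert (H2 : Rabs (u - s) < d / (K + 1)) by (eapply Rlt_le_trans; [exact Hu | apply Rmin_r]).
    apply Rlt_div_r in H1; [| lra]. apply Rlt_div_r in H2; [| lra].
    assert (Eqp : (p u - p s = RtoC (u - s) * (b - 1))%C) by (unfold p; rewrite RtoC_minus; ring).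
    assert (Cqp : Cmod (p u - p s) = Rabs (u - s) * x) by (rewrite Eqp, Cmod_mult, Cmod_R; reflexivity).
    pose proof (Rabs_pos (u - s)) as Pu.
    assert (Lu : m / 2 <= Re (p u)).
    { pose proof (re_le_Cmod (p u - p s)) as Q. rewrite Cqp in Q.
      replace (Re (p u - p s)) with (Re (p u) - Re (p s)) in Q by (unfold Re; simpl; ring).
      pose proof (Rle_abs (- (Re (p u) - Re (p s)))) as Q2. rewrite Rabs_Ropp in Q2. nra. }
    pose proof (exp_int_taylor e (p s) (p u) (m / 4) He ltac:(lra) ltac:(lra) ltac:(lra)) as T.
    rewrite Cqp in T. rewrite Eqp in T.
    replace (exp_int e (p u) - exp_int e (p s) - - (b - 1) * (decay (p s) e / p s) * RtoC (u - s))%C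
      with (exp_int e (p u) - exp_int e (p s) + RtoC (u - s) * (b - 1) * (decay (p s) e / p s))%C by ring.
    eapply Rle_trans; [exact T |].
    replace (/ (m / 4 * (m / 4)) * (Rabs (u - s) * x * (Rabs (u - s) * x)))
      with (Rabs (u - s) * K * Rabs (u - s)) by (unfold K; ring).
    apply Rmult_le_compat_r; [exact Pu | nra]. }
  assert (D2 : forall s, 0 <= s <= 1 -> rderiv (fun s => Clog_right (p s)) s ((b - 1) / p s)%C).
  { intros s Hs. pose proof (Lp s Hs). eapply rderiv_eq.
    - apply (cderiv_line (fun w => Clog_right (1 + w * (b - 1)))%C).
      apply cderiv_Clog_comp; [| change (0 < Re (p s)); lra].
      apply cderiv_plus; [apply cderiv_const |]. apply cderiv_mult; [apply cderiv_id | apply cderiv_const].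
    - unfold p. unfold Cdiv. ring. }
  pose proof (MVT_C (fun s => exp_int e (p s) + Clog_right (p s))%C
    (fun s => - (b - 1) * (decay (p s) e / p s) + (b - 1) / p s)%C 0 1 (Cmod (b - 1) * e) ltac:(lra)) as Q.
  cbv beta in Q.
  replace (p 1) with b in Q by (unfold p; ring). replace (p 0) with (RtoC 1) in Q by (unfold p; ring).
  assert (L1 : Clog_right 1 = RtoC 0) by (rewrite Clog_right_RtoC, ln_1 by lra; reflexivity).
  rewrite L1 in Q.
  replace (exp_int e b - exp_int e 1 + Clog_right b)%C
    with (exp_int e b + Clog_right b - (exp_int e 1 + 0))%C by ring.
  eapply Rle_trans; [apply Q | lra].
  - intros s Hs. apply rderiv_plus; [apply D1, Hs | apply D2, Hs].
  - intros s Hs. pose proof (Lp s Hs) as Ls.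
    assert (Np : p s <> RtoC 0) by (apply Re_pos_neq_0; lra).
    replace (- (b - 1) * (decay (p s) e / p s) + (b - 1) / p s)%C
      with ((b - 1) * (- (decay (p s) e - 1) * / p s))%C by (field; exact Np).
    rewrite !Cmod_mult, Cmod_opp, Cmod_inv by exact Np.
    apply Rmult_le_compat_l; [apply Cmod_ge_0 |].
    pose proof (Cexp_sub_1_le (p s * - RtoC e)) as B.
    rewrite Cmod_mult, Cmod_opp, Cmod_R, Rabs_pos_eq in B by lra.
    rewrite Rmax_left in B.
    2:{ rewrite <- exp_0. apply exp_le.
        replace (Re (p s * - RtoC e)) with (- (Re (p s) * e)) by (unfold Re; simpl; ring). nra. }
    unfold decay. pose proof (proj1 (Cmod_gt_0 _) Np) as Pp.
    apply (Rle_div_l _ _ _ Pp). lra.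
Qed.

(** * Binet's formula in the limit *)

(** Exchange of limits by three thirds of [d]: first [N] is fixed according to [m] and [y], and only
    then is [n] taken large. The error bound [m N] must be uniform in [n]. *)
Lemma clim_approx (x y : nat -> C) (m : nat -> R) (l : C) :
  (forall N, exists w p : nat -> C, (forall n, x n = w n + p n)%C /\ clim w (y N) /\
     forall n, Cmod (p n) <= m N) ->
  is_lim_seq m 0 -> clim y l -> clim x l.
Proof.
  intros H Hm Hy. apply is_lim_seq_spec. intros d.
  assert (Pd : 0 < d / 3) by (pose proof (cond_pos d); lra).
  destruct (is_lim_seq_0_lt m _ Hm Pd) as [N1 HN1].
  destruct (is_lim_seq_0_lt _ _ Hy Pd) as [N2 HN2].
  set (N := Nat.max N1 N2). specialize (HN1 N ltac:(lia)). specialize (HN2 N ltac:(lia)).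
  destruct (H N) as [w [p [E [Hw Hp]]]].
  destruct (is_lim_seq_0_lt _ _ Hw Pd) as [K HK]. exists K. intros n Hn. specialize (HK n Hn).
  cbv beta in *. rewrite Rminus_0_r, Rabs_pos_eq by apply Cmod_ge_0.
  rewrite E. replace (w n + p n - l)%C with ((w n - y N) + p n + (y N - l))%C by ring.
  eapply Rle_lt_trans; [apply Cmod_triangle |].
  pose proof (Cmod_triangle (w n - y N) (p n)). pose proof (Hp n). lra.
Qed.

Lemma clim_csum (u : nat -> nat -> C) (l : nat -> C) N :
  (forall k, clim (fun n => u n k) (l k)) -> clim (fun n => csum (u n) N) (csum l N).
Proof.
  intros H. induction N as [| N IH]; simpl; [apply clim_const | apply clim_plus; auto].
Qed.

Lemma clim_decay b : 0 < Re b -> clim (fun n => decay b (radius n)) 1.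
Proof.
  intros Hb. apply clim_le with (fun n => Cmod b * radius n).
  2: apply is_lim_seq_scal0, is_lim_seq_radius.
  intros n. pose proof (radius_pos n). unfold decay.
  eapply Rle_trans; [apply Cexp_sub_1_le |].
  rewrite Rmax_left.
  - rewrite Cmod_mult, Cmod_opp, Cmod_R, Rabs_pos_eq by lra. lra.
  - rewrite <- exp_0. apply exp_le.
    replace (Re (b * - RtoC (radius n))) with (- (Re b * radius n)) by (unfold Re; simpl; ring). nra.
Qed.

Lemma clim_decay_slope b : 0 < Re b ->
  clim (fun n => (decay b (radius n) - 1) / RtoC (radius n))%C (- b)%C.
Proof.
  intros Hb. apply clim_le with (fun n => Cmod b * Cmod b * radius n).
  2: apply is_lim_seq_scal0, is_lim_seq_radius.
  intros n. pose proof (radius_pos n) as P.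
  assert (N : RtoC (radius n) <> RtoC 0) by (apply RtoC_neq_0; lra).
  unfold decay. set (w := (b * - RtoC (radius n))%C).
  replace ((Cexp w - 1) / RtoC (radius n) - - b)%C with ((Cexp w - 1 - w) / RtoC (radius n))%C
    by (unfold w; field; exact N).
  rewrite Cmod_div, Cmod_R, Rabs_pos_eq by (try exact N; lra).
  apply Rle_div_l; [exact P |].
  eapply Rle_trans; [apply Cexp_taylor1_le |]. rewrite Rmax_left.
  - unfold w. rewrite Cmod_mult, Cmod_opp, Cmod_R, Rabs_pos_eq by lra. right; ring.
  - rewrite <- exp_0. apply exp_le.
    replace (Re w) with (- (Re b * radius n)) by (unfold w, Re; simpl; ring). nra.
Qed.

(** The common divergent part of all exponential integrals, regularised. It serves as a reference
    quantity until its limit is identified in [clim_exp_int_const]. *)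
Definition exp_int_const (n : nat) : C := (exp_int (radius n) 1 + RtoC (ln (radius n)))%C.

Lemma clim_exp_int b : 0 < Re b ->
  clim (fun n => exp_int (radius n) b + RtoC (ln (radius n)) - exp_int_const n)%C (- Clog_right b)%C.
Proof.
  intros Hb. apply clim_le with (fun n => Cmod (b - 1) * radius n).
  2: apply is_lim_seq_scal0, is_lim_seq_radius.
  intros n. eapply Rle_trans; [| apply (frullani (radius n) b (radius_pos n) Hb)].
  right. f_equal. unfold exp_int_const. ring.
Qed.

Lemma clim_geom_int_1 : clim (fun n => geom_int (radius n) 1 + RtoC (ln (radius n)))%C 0.
Proof.
  apply clim_le with radius; [| apply is_lim_seq_radius]. intros n.
  pose proof (radius_pos n) as P. set (e := radius n) in *.
  rewrite geom_int_1 by exact P. rewrite <- RtoC_plus, <- RtoC_minus, Cmod_R.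
  pose proof (exp_neg_lt_1 e P) as L.
  pose proof (exp_ineq1_le (- e)) as L1. pose proof (exp_ineq1_le e) as L2.
  assert (L3 : exp (- e) <= / (1 + e)).
  { rewrite exp_Ropp. apply Rinv_le_contravar; lra. }
  assert (U : ln (1 - exp (- e)) <= ln e) by (apply ln_le; lra).
  assert (Lo : ln e - e <= ln (1 - exp (- e))).
  { apply Rle_trans with (ln (e / (1 + e))).
    - rewrite ln_div by lra. assert (ln (1 + e) <= e); [| lra].
      rewrite <- (ln_exp e) at 2. apply ln_le; lra.
    - apply ln_le; [apply Rdiv_lt_0_compat; lra |].
      replace (e / (1 + e)) with (1 - / (1 + e)) by (field; lra). lra. }
  apply Rabs_le. lra.
Qed.

Lemma Re_shift_pos_1 N : 0 < Re (shift N 1).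
Proof. apply Re_shift_pos. simpl. lra. Qed.

Lemma telescope_shift (F f : C -> C) a N :
  (forall k, F (shift k a) - F (shift k a + 1) = f (shift k a))%C ->
  (F a = csum (fun k => f (shift k a)) N + F (shift N a))%C.
Proof.
  intros H. induction N as [| N IH].
  - simpl. unfold shift. simpl. rewrite !Cplus_0_l. reflexivity.
  - simpl. rewrite IH, <- H, shift_S, (Cplus_comm 1). ring.
Qed.

Lemma is_lim_seq_div_shift M x : is_lim_seq (fun N => M / (INR N + x)) 0.
Proof.
  apply (is_lim_seq_ext (fun N => M * / (INR N + x))); [reflexivity |].
  apply is_lim_seq_scal0. replace (Finite 0) with (Rbar_inv p_infty) by reflexivity.
  apply is_lim_seq_inv; [apply is_lim_seq_shift_p | discriminate].
Qed.

(** Telescoping [geom_int] from [1] to [N + 1] and replacing the last integral by an exponential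
    integral yields the terms of [stirling' N 1], up to [digamma_rem]. *)
Lemma clim_exp_int_const (logGamma : C -> C) :
  is_log_Gamma logGamma -> clim exp_int_const (- euler_gamma)%C.
Proof.
  intros HG. destruct digamma_rem_le as [M [PM HM]].
  apply (clim_approx _ (fun N => stirling' N 1) (fun N => M / (INR N + 1)));
    [| apply is_lim_seq_div_shift | apply (clim_stirling'_1 logGamma HG)].
  intros N. set (s := shift N 1). pose proof (Re_shift_pos_1 N) as Ps. fold s in Ps.
  assert (Ns : s <> RtoC 0) by (apply Re_pos_neq_0, Ps).
  (* [exp_int_const n] itself occurs in this sequence, but inside a difference whose limit is known
     from Frullani's argument. *)
  exists (fun n => (geom_int (radius n) 1 + RtoC (ln (radius n)))
    - csum (fun k => / shift k 1 * decay (shift k 1) (radius n)) N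
    - 1 / 2 * / s * decay s (radius n)
    - (exp_int (radius n) s + RtoC (ln (radius n)) - exp_int_const n))%C,
    (fun n => - digamma_rem (radius n) s)%C.
  split; [| split].
  - intros n.
    rewrite (telescope_shift (geom_int (radius n)) (fun b => / b * decay b (radius n))%C 1 N).
    + fold s. unfold digamma_rem. field. exact Ns.
    + intros k. rewrite geom_int_rec by (apply Re_shift_pos_1 || apply radius_pos).
      unfold Cdiv. ring.
  - replace (stirling' N 1) with (0 - csum (fun k => / shift k 1 * 1) N - 1 / 2 * / s * 1 - - Clog_right s)%C.
    + apply clim_minus; [apply clim_minus; [apply clim_minus |] |].
      * apply clim_geom_int_1.
      * apply (clim_csum (fun n k => / shift k 1 * decay (shift k 1) (radius n))%C).
        intros k. apply clim_scal, clim_decay, Re_shift_pos_1.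
      * apply clim_scal, clim_decay, Ps.
      * apply clim_exp_int, Ps.
    + unfold stirling'. fold s. unfold log_shift. fold s.
      rewrite (csum_ext (fun k => / shift k 1 * 1)%C (fun k => / shift k 1)%C) by (intros; ring).
      field. exact Ns.
  - intros n. rewrite Cmod_opp. replace (INR N + 1) with (Re s); [apply HM; [exact Ps | apply radius_pos] |].
    unfold s. rewrite Re_shift_n. reflexivity.
Qed.

(** Telescoping produces [N] exponential integrals and a ray integral at [s = N + a], which
    [binet_rem] reduces to one more exponential integral with coefficient [1 / 2 - s]. Since
    [N + (1 / 2 - s) = 1 / 2 - a], the reference quantity appears with a coefficient free of [N]. *)
Lemma clim_ray_int a : 0 < Re a ->
  clim (fun n => ray_int (radius n) a - / RtoC (radius n) + (1 / 2 - a) * RtoC (ln (radius n))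
    - (1 / 2 - a) * exp_int_const n)%C (log_Gamma_lim a - RtoC (ln (sqrt (2 * PI))))%C.
Proof.
  intros Ha. destruct binet_rem_le as [M [PM HM]].
  apply (clim_approx _ (fun N => stirling N a - RtoC (ln (sqrt (2 * PI))))%C (fun N => M / (INR N + Re a)));
    [| apply is_lim_seq_div_shift | apply clim_minus; [apply clim_stirling, Ha | apply clim_const]].
  intros N. set (s := shift N a).
  assert (Pk : forall k, 0 < Re (shift k a)) by (intros k; apply Re_shift_pos, Ha).
  exists (fun n =>
    csum (fun k => exp_int (radius n) (shift k a) + RtoC (ln (radius n)) - exp_int_const n) N
    + (decay s (radius n) - 1) / RtoC (radius n)
    + (1 / 2 - s) * (exp_int (radius n) s + RtoC (ln (radius n)) - exp_int_const n))%C,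
    (fun n => binet_rem (radius n) s).
  split; [| split].
  - intros n. assert (Ne : RtoC (radius n) <> RtoC 0) by (apply RtoC_neq_0; pose proof (radius_pos n); lra).
    rewrite (telescope_shift (ray_int (radius n)) (exp_int (radius n)) a N).
    2:{ intros k. symmetry. apply exp_int_ray; [apply Pk | apply radius_pos]. }
    (* [d] is the correction common to all exponential integrals, so the sum contributes it [N]
       times. *)
    set (d := (RtoC (ln (radius n)) - exp_int_const n)%C).
    assert (E : csum (fun k => exp_int (radius n) (shift k a) + RtoC (ln (radius n)) - exp_int_const n)%C N
      = (csum (fun k => exp_int (radius n) (shift k a)) N + RtoC (INR N) * d)%C).
    { unfold d. clear. induction N as [| N IH]; [simpl; ring |].
      simpl csum. rewrite IH, S_INR, RtoC_plus. ring. }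
    rewrite E. fold s. unfold binet_rem.
    replace (RtoC (INR N)) with (s - a)%C by (unfold s, shift; ring).
    unfold d. field. exact Ne.
  - replace (stirling N a - RtoC (ln (sqrt (2 * PI))))%C
      with (csum (fun k => - Clog_right (shift k a)) N + - s + (1 / 2 - s) * - Clog_right s)%C.
    + apply clim_plus; [apply clim_plus |].
      * apply (clim_csum (fun n k => exp_int (radius n) (shift k a) + RtoC (ln (radius n)) - exp_int_const n)%C).
        intros k. apply clim_exp_int, Pk.
      * apply clim_decay_slope, Pk.
      * apply clim_scal, clim_exp_int, Pk.
    + unfold stirling. fold s.
      rewrite (csum_ext _ (fun k => - (1) * log_shift k a)%C) by (intros; unfold log_shift; ring).
      rewrite csum_scal. unfold log_shift at 2. fold s. ring.
  - intros n. replace (INR N + Re a) with (Re s); [apply HM; [apply Pk | apply radius_pos] |].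
    unfold s. apply Re_shift_n.
Qed.

(** * The two representations of log Gamma *)

Theorem hankel_integral_log_Gamma (logGamma : C -> C) (a : C) (e : R) :
  is_log_Gamma logGamma -> 0 < Re a -> 0 < e < 2 * PI ->
  exists J, is_hankel_int (hankel_integrand a) e J /\
    (/ (2 * RtoC PI * Ci) * J =
      log_Gamma_lim a - RtoC (ln (sqrt (2 * PI))) + (1 / 2 - a) * - euler_gamma)%C.
Proof.
  intros HG Ha He. destruct (hankel_int_value a e Ha He) as [T [HT HJ]].
  exists (circle_integral a e + 2 * RtoC PI * Ci * T)%C. split; [exact HJ |].
  eapply clim_unique; [apply (hankel_limit a e T Ha He HT) |].
  eapply clim_ext; [| apply clim_plus; [apply (clim_ray_int a Ha) |
    apply clim_scal, (clim_exp_int_const logGamma HG)]].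
  intros n. cbv beta. ring.
Qed.

Open Scope R_scope.
Open Scope C_scope.

Theorem lemma3 (logGamma : C -> C) (zeta : C -> C -> C) (a : C) (eps : R)
  (hlogGamma : is_log_Gamma logGamma)
  (hzeta : is_hurwitz_zeta zeta)
  (ha : (0 < Re a)%R)
  (heps : (0 < eps < 2 * PI)%R) :
  (exists J : C,
     is_hankel_int (hankel_integrand a) eps J /\
     logGamma a =
       RtoC (ln (sqrt (2 * PI))) - euler_gamma * (a - 1 / 2)
       + 1 / (2 * RtoC PI * Ci) * J) /\
  logGamma a =
    RtoC (ln (sqrt (2 * PI))) - euler_gamma * (a - 1 / 2) + g0 zeta a.
Proof.
  rewrite (log_Gamma_eq logGamma a hlogGamma ha). split.
  - destruct (hankel_integral_log_Gamma logGamma a eps hlogGamma ha heps) as [J [HJ E]].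
    exists J. split; [exact HJ |].
    replace (1 / (2 * RtoC PI * Ci) * J) with (/ (2 * RtoC PI * Ci) * J) by (unfold Cdiv; ring).
    rewrite E. ring.
  - unfold g0. destruct (hurwitz_zeta_at_0 zeta a hzeta ha) as [Z D]. rewrite Z, D.
    replace (digamma 1) with (- euler_gamma) by (unfold euler_gamma; ring). ring.
Qed.
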